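(* Suppose $\boldsymbol u_h\in\boldsymbol V_h$ satisfies $\int_{\Omega_h}q_h\operatorname{div}_h\boldsymbol u_h\,\mathrm dx=0$ for all $q_h\in Q_h$. Then $\operatorname{div}_h\boldsymbol u_h=0$ in $\Omega_h$.
   Context: Mesh. $\Omega\subset\mathbb R^2$ is a bounded, sufficiently smooth domain (curved boundary). $\tilde{\mathcal T}_h$ is a shape-regular affine triangulation whose boundary vertices lie on $\partial\Omega$, each triangle having at most two boundary vertices; $h$ is the maximal diameter, $\tilde\Omega_h$ the interior of the union of the closed triangles $\tilde T\in\tilde{\mathcal T}_h$. $G:\tilde\Omega_h\to\Omega$ is a bijection with $G(x)=x$ at all vertices, $\|G\|_{W^{1,\infty}(\tilde\Omega_h)}\le C$, and $G$ is the identity on triangles with three interior vertices. $G_h$ is the piecewise quadratic nodal interpolant of $G$, with $\|DG_h\|_{W^{1,\infty}(\tilde T)}\le C$ and $\|DG_h^{-1}\|_{W^{1,\infty}(\tilde T)}\le C$ for all $\tilde T$. Set $\mathcal T_h=\{G_h(\tilde T):\tilde T\in\tilde{\mathcal T}_h\}$ and let $\Omega_h$ be the interior of $\bigcup_{T\in\mathcal T_h}\overline T$; interior edges of $\mathcal T_h$ are straight. $\hat T$ is the reference triangle with vertices $(0,0),(1,0),(0,1)$, $F_{\tilde T}:\hat T\to\tilde T$ is affine, and for $T=G_h(\tilde T)$, $F_T=G_h\circ F_{\tilde T}:\hat T\to T$ is a quadratic diffeomorphism with $\det(DF_T)>0$, affine on those edges of $\hat T$ mapped to straight edges, and affine (with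 $T=\tilde T$) if all edges of $T$ are straight. $A_T(\hat x)=DF_T(\hat x)/\det(DF_T(\hat x))$ is the Piola matrix. $\operatorname{div}_h$ is the elementwise divergence on $\mathcal T_h$. Boldface denotes vector-valued functions/spaces. $C$ is a generic constant independent of the mesh size. Velocity space. $\hat{\boldsymbol W}(\hat T)=\boldsymbol P_2(\hat T)$ (vector quadratics); $\hat{\boldsymbol\Phi}(\hat T)=\operatorname{span}\{(\phi_{\hat T},0)^\top,(0,\phi_{\hat T})^\top\}$ with $\phi_{\hat T}(\hat x)=2-3[(1-\hat x_1-\hat x_2)^2+\hat x_1^2+\hat x_2^2]$ (which vanishes at the two Gauss–Legendre points of each edge of $\hat T$). For $T\in\mathcal T_h$, $\boldsymbol W(T)$ (resp. $\boldsymbol\Phi(T)$) is the set of $\boldsymbol v_T$ with $\boldsymbol v_T(x)=A_T(\hat x)\hat{\boldsymbol v}(\hat x)$, $x=F_T(\hat x)$, $\hat{\boldsymbol v}\in\hat{\boldsymbol W}(\hat T)$ (resp. $\hat{\boldsymbol\Phi}(\hat T)$). $\boldsymbol W_h$ is the set of $\boldsymbol w_h$ with $\boldsymbol w_h|_T\in\boldsymbol W(T)$ for all $T$, continuous (resp. zero) at the two endpoints and the midpoint of each internal (resp. boundary) edge of $\mathcal T_h$ (the midpoint of a curved edge is the $F_T$-image of the midpoint of the reference edge). $\boldsymbol\Phi_h=\{\boldsymbol\phi_h\in\boldsymbol L^2(\Omega_h):\boldsymbol\phi_h|_T\in\boldsymbol\Phi(T)\ \forall T\in\mathcal T_h\}$.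 $\boldsymbol V_h=\boldsymbol W_h+\boldsymbol\Phi_h$. Pressure space. $\tilde Q_h=\{\tilde q_h\in L^2_0(\tilde\Omega_h):\tilde q_h|_{\tilde T}\in P_1(\tilde T)\ \forall\tilde T\in\tilde{\mathcal T}_h\}$ ($L^2_0$: zero mean), and $Q_h=\{q_h\in L^2(\Omega_h): q_h(G_h(\tilde x))=\tilde q_h(\tilde x)\text{ for some }\tilde q_h\in\tilde Q_h\}$. *)

(* Defs.v *)
From HB Require Import structures.
From mathcomp Require Import all_boot all_order all_algebra.
From mathcomp Require Import all_classical all_reals all_analysis.

Set Implicit Arguments.
Unset Strict Implicit.
Unset Printing Implicit Defensive.

Import Order.TTheory GRing.Theory Num.Theory.
Import numFieldNormedType.Exports.

Local Open Scope classical_set_scope.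
Local Open Scope ring_scope.

Notation plane R := (R * R)%type.

Section Plane.
Context {R : realType}.
Implicit Types (x y : plane R) (A D : set (plane R)) (f : plane R -> R).

Definition leb2 :
    {measure set (measurableTypeR R * measurableTypeR R) -> \bar R} :=
  (@lebesgue_measure R \x @lebesgue_measure R)%E.

Definition crd (i : 'I_2) x : R := if i == 0 then x.1 else x.2.

Definition dir (i : 'I_2) : plane R := if i == 0 then (1, 0) else (0, 1).

Definition dotp x y : R := x.1 * y.1 + x.2 * y.2.

Definition enorm x : R := Num.sqrt (dotp x x).

Definition bdry A : set (plane R) := closure A `\` interior A.

Definition segment x y : set (plane R) :=
  [set z | exists2 t : R, 0 <= t <= 1 & z = (1 - t) *: x + t *: y].

Definition midpt x y : plane R := 2^-1 *: (x + y).

Definition pder (i : 'I_2) f x : R := 'D_(dir i) f x.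

Definition jac (F : plane R -> plane R) x : 'M[R]_2 :=
  \matrix_(i, j) pder j (crd i \o F) x.

Definition diverg (u : plane R -> plane R) x : R :=
  \sum_(i < 2) pder i (crd i \o u) x.

Definition mxv (A : 'M[R]_2) x : plane R :=
  (A 0 0 * x.1 + A 0 1 * x.2, A 1 0 * x.1 + A 1 1 * x.2).

Definition isP1 f : Prop :=
  exists a b c : R, forall x, f x = a + b * x.1 + c * x.2.

Definition isP2 f : Prop :=
  exists a b c d e g : R, forall x,
    f x = a + b * x.1 + c * x.2
        + d * x.1 ^+ 2 + e * (x.1 * x.2) + g * x.2 ^+ 2.

Definition isP1v (F : plane R -> plane R) : Prop :=
  forall i, isP1 (crd i \o F).

Definition isP2v (F : plane R -> plane R) : Prop :=
  forall i, isP2 (crd i \o F).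

Definition L2 D f : Prop :=
  measurable_fun (D : set (measurableTypeR R * measurableTypeR R)) f /\
  (\int[leb2]_(x in D) ((f x) ^+ 2)%:E < +oo)%E.

Definition pders (s : seq 'I_2) f : plane R -> R := foldr pder f s.

(* C^oo functions with compact support in D. *)
Definition test_fun D f : Prop :=
  [/\ forall s, continuous (pders s f),
      forall s i x, derivable (pders s f) x (dir i)
    & exists K, [/\ compact K, K `<=` D & forall x, ~ K x -> f x = 0]].

Definition ess_bounded D (C : R) f : Prop :=
  measurable_fun (D : set (measurableTypeR R * measurableTypeR R)) f /\
  {ae leb2, forall x, D x -> `|f x| <= C}.

Definition weak_pder D (i : 'I_2) f g : Prop :=
  forall phi, test_fun D phi ->
    (\int[leb2]_(x in D) (f x * pder i phi x)%:E =
     - \int[leb2]_(x in D) (g x * phi x)%:E)%E.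

(* f is in W^{1,oo}(D) with norm (the maximum of the L^oo norms of f and of
   its weak partial derivatives) at most C. *)
Definition W1oo D (C : R) f : Prop :=
  ess_bounded D C f /\
  forall i, exists2 g, ess_bounded D C g & weak_pder D i f g.

Definition Ck1 (k : nat) (gam : R -> R) : Prop :=
  forall j, (j <= k)%N -> continuous (derive1n j gam) /\
    ((j < k)%N -> forall t, derivable (derive1n j gam) t 1).

(* Bounded domain whose boundary is locally, in some orthonormal frame (t, n),
   the graph of a C^k function with the domain on one side. *)
Record Ck_domain (k : nat) (Omega : set (plane R)) : Prop := {
  dom_open : open Omega ;
  dom_connected : connected Omega ;
  dom_nonempty : Omega !=set0 ;
  dom_bounded : bounded_set Omega ;
  dom_boundary : forall p, bdry Omega p ->
    exists t n gam U,
      [/\ [/\ dotp t t = 1, dotp n n = 1 & dotp t n = 0],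
          Ck1 k gam, open U, U p
        & forall x, U x -> (Omega x <-> dotp x n < gam (dotp x t))] }.

(* Reference triangle, with barycentric coordinates; edge i is opposite to
   vertex i. *)

Definition rvtx (i : 'I_3) : plane R :=
  if val i == 0%N then (0, 0) else if val i == 1%N then (1, 0) else (0, 1).

Definition bary (i : 'I_3) x : R :=
  if val i == 0%N then 1 - x.1 - x.2 else if val i == 1%N then x.1 else x.2.

Definition refT : set (plane R) := [set x | forall i, 0 < bary i x].

Definition crefT : set (plane R) := [set x | forall i, 0 <= bary i x].

Definition redge (i : 'I_3) : set (plane R) :=
  [set x | crefT x /\ bary i x = 0].

(* Endpoints (j = l) and midpoint (j <> l) of edge i are the rnode j l with
   j and l both different from i. *)
Definition rnode (j l : 'I_3) : plane R := midpt (rvtx j) (rvtx l).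

(* The affine map sending the reference vertices to v. *)
Definition affT (v : 'I_3 -> plane R) x : plane R := \sum_(i < 3) bary i x *: v i.

Definition phi_ref x : R :=
  2 - 3 * ((1 - x.1 - x.2) ^+ 2 + x.1 ^+ 2 + x.2 ^+ 2).

Definition piola (F : plane R -> plane R) x : 'M[R]_2 :=
  (\det (jac F x))^-1 *: jac F x.

End Plane.

Section Mesh.
Context {R : realType} {E : finType}.
Variable vtx : E -> 'I_3 -> plane R.
Implicit Types (e : E) (i : 'I_3).

Definition tT e : set (plane R) := affT (vtx e) @` refT.

Definition ctT e : set (plane R) := affT (vtx e) @` crefT.

Definition tedge e i : set (plane R) := affT (vtx e) @` redge i.

Definition tOmega : set (plane R) :=
  interior (\bigcup_(e in setT) ctT e).

Definition internal_edge e i : Prop :=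
  exists e' i', e' != e /\ tedge e' i' = tedge e i.

Definition boundary_vtx e i : Prop := bdry tOmega (vtx e i).

Definition conforming : Prop :=
  forall e e', e != e' ->
    [\/ ctT e `&` ctT e' = set0,
        exists i i', vtx e i = vtx e' i' /\ ctT e `&` ctT e' = [set vtx e i]
      | exists i i', tedge e i = tedge e' i' /\ ctT e `&` ctT e' = tedge e i].

Definition shape_regular (sigma : R) : Prop :=
  forall e, exists c r, [/\ 0 < r,
    [set x | enorm (x - c) <= r] `<=` ctT e
    & forall x y, ctT e x -> ctT e y -> enorm (x - y) <= sigma * r].

Variable Gh : plane R -> plane R.
Variable F : E -> plane R -> plane R.

Definition elT e : set (plane R) := Gh @` tT e.

Definition elEdge e i : set (plane R) := F e @` redge i.

Definition Omegah : set (plane R) :=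
  interior (\bigcup_(e in setT) closure (elT e)).

Definition straight (S : set (plane R)) : Prop :=
  exists a b, S = segment a b.

(* F e is the quadratic polynomial map of the plane that agrees with
   Gh \o affT (vtx e) on the closed reference triangle, so that its Jacobian
   makes sense up to the boundary of that triangle. *)
Record curved_mesh (Omega : set (plane R)) (sigma C : R)
    (G : plane R -> plane R) : Prop := {
  mesh_nondeg : forall e, injective (affT (vtx e)) ;
  mesh_conforming : conforming ;
  mesh_shape : shape_regular sigma ;
  mesh_bdry_vtx : forall e i, boundary_vtx e i -> bdry Omega (vtx e i) ;
  mesh_two_bdry_vtx : forall e, exists i, ~ boundary_vtx e i ;
  G_bij : set_bij tOmega Omega G ;
  G_cont : {within closure tOmega, continuous G} ;
  G_vtx : forall e i, G (vtx e i) = vtx e i ;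
  G_W1oo : forall i : 'I_2, W1oo tOmega C (crd i \o G) ;
  G_id : forall e, (forall i, ~ boundary_vtx e i) ->
    forall x, ctT e x -> G x = x ;
  Gh_P2 : forall e, exists2 P, isP2v P & forall x, ctT e x -> Gh x = P x ;
  Gh_nodes : forall e j l,
    Gh (midpt (vtx e j) (vtx e l)) = G (midpt (vtx e j) (vtx e l)) ;
  Gh_W1oo : forall e (i j : 'I_2), W1oo (tT e) C (fun x => jac Gh x i j) ;
  Gh_inv_W1oo : forall e (i j : 'I_2), W1oo (tT e) C (fun x => invmx (jac Gh x) i j) ;
  Gh_inj : forall x y, tOmega x -> tOmega y -> Gh x = Gh y -> x = y ;
  mesh_internal_straight : forall e i, internal_edge e i ->
    straight (elEdge e i) ;
  F_P2 : forall e, isP2v (F e) ;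
  F_Gh : forall e x, crefT x -> F e x = Gh (affT (vtx e) x) ;
  F_inj : forall e x y, crefT x -> crefT y -> F e x = F e y -> x = y ;
  F_det : forall e x, crefT x -> 0 < \det (jac (F e) x) ;
  F_affine_edge : forall e i, straight (elEdge e i) ->
    exists2 L, isP1v L & forall x, redge i x -> F e x = L x ;
  F_affine : forall e, (forall i, straight (elEdge e i)) ->
    isP1v (F e) /\ elT e = tT e }.

Implicit Types u w phi : plane R -> plane R.

Definition inW e w : Prop :=
  exists2 wh, isP2v wh &
    forall x, refT x -> w (F e x) = mxv (piola (F e) x) (wh x).

Definition inPhi e phi : Prop :=
  exists a b : R, forall x, refT x ->
    phi (F e x) = mxv (piola (F e) x) (a * phi_ref x, b * phi_ref x).

Definition elements : set (plane R) := \bigcup_(e in setT) elT e.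

Definition edge_node e i (a : plane R) : Prop :=
  exists j l, [/\ j != i, l != i & a = F e (rnode j l)].

(* Elementwise functions are only relevant on the open elements: continuity at
   a node of an internal edge means that the limits from all elements sharing
   the edge exist and agree, and vanishing at a node of a boundary edge that the
   limit from the element is 0. *)
Definition Wh w : Prop :=
  [/\ forall e, inW e w,
      forall e i a, internal_edge e i -> edge_node e i a ->
        exists l : plane R, forall e' i', tedge e' i' = tedge e i ->
          w @ within (elT e') (nbhs a) --> l
    & forall e i a, ~ internal_edge e i -> edge_node e i a ->
        w @ within (elT e) (nbhs a) --> (0 : plane R)].

Definition Phih phi : Prop :=
  (forall i : 'I_2, L2 Omegah (crd i \o phi)) /\ forall e, inPhi e phi.

Definition Vh u : Prop :=
  exists w phi, [/\ Wh w, Phih phi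
    & forall x, Omegah x -> u x = w x + phi x].

Definition tQh (q : plane R -> R) : Prop :=
  [/\ L2 tOmega q, (\int[leb2]_(x in tOmega) (q x)%:E = 0)%E
    & forall e, exists2 p, isP1 p & forall x, tT e x -> q x = p x].

Definition Qh (q : plane R -> R) : Prop :=
  L2 Omegah q /\
  exists2 tq, tQh tq & forall x, tOmega x -> q (Gh x) = tq x.

(* The value 0 on the mesh skeleton, a null set, is a convention. *)
Definition divh u (x : plane R) : R :=
  if `[< elements x >] then diverg u x else 0.

End Mesh.

(* Main.v *)
(* In reference coordinates [u] is the Piola transform of a quadratic field [vh],
   so that [div u = (div vh) / det DF] on each element, and [p = div vh] is affine.

   The integrals of [p] over the reference triangle sum up to 0 over the mesh: each
   is the flux of [vh] through the three edges, and Simpson's rule expresses it by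
   the values at the nodes of the edges.  The functions of Phi_h do not contribute.
   For those of W_h, the flux density on a straight edge only depends on the limit of
   the function at the node and on the edge vector; the latter is traversed in
   opposite directions by the two positively oriented elements sharing the edge, and
   on boundary edges the nodal values are 0.

   Hence, with [c] chosen so that [p - c] has mean 0 over the affine mesh, testing
   with [q = p - c] gives [sum_T int p ^ 2 = c * sum_T int p = 0], whence [p = 0].

   Each element has an interior vertex, the two edges through which are internal, hence
   straight.  So [F_T] is affine along two edges, and up to an affine change of coordinates
   [F_T (s, t) = c0 + s a + t b + s t e].  Such a map preserves the lines parallel to [e]
   (in suitable coordinates), which reduces the change of variables formula to its
   one-dimensional version and Fubini's theorem. *)

Require Import Defs.
From mathcomp Require Import all_boot all_order all_algebra.
From mathcomp Require Import all_classical all_reals all_analysis.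
From mathcomp Require Import measurable_realfun ring lra.

Set Implicit Arguments.
Unset Strict Implicit.
Unset Printing Implicit Defensive.

Import Order.TTheory GRing.Theory Num.Theory.
Import numFieldNormedType.Exports.

Local Open Scope classical_set_scope.
Local Open Scope ring_scope.

(** * Integration in the plane *)

(** The Piola factor makes the test exact: in reference coordinates, the [1 / det DF] of the
    divergence cancels the Jacobian of the change of variables, so that [q * div u] becomes the
    polynomial [(p - c) * p] on the reference triangle.

    Three obstacles shape the rest. Differentiating [u] on a curved element means differentiating
    the inverse of [F_T]: the midpoint rule, exact for quadratics, gives its difference quotients in
    closed form, once the image of the open triangle is known to be open. The orientation of the
    affine triangles is not part of the data: it is read off from [det DF_T > 0] at the corner where
    the two straight edges meet, since there [F_T] is tangent to its affine interpolant. Finally,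
    the mean value condition weights each element by its affine area, whereas the fluxes give an
    unweighted sum of reference integrals: the former fixes [c], the latter removes it from the
    result.

    All integrands are 0 on the mesh skeleton, so that they split pointwise into their restrictions
    to the open elements. *)

Section plane_measurability.
Context {R : realType}.
Notation mplane := (measurableTypeR R * measurableTypeR R)%type.

(** The product sigma-algebra is generated by rectangles; an open set is the countable union of the
    boxes with rational corners that it contains. *)
Lemma open_measurable_plane (A : set (plane R)) :
  open A -> measurable (A : set mplane).
Proof.
move=> oA.
pose box (q : (rat * rat) * (rat * rat)) : set mplane :=
  [set` `]ratr q.1.1 : R, ratr q.1.2[] `*` [set` `]ratr q.2.1, ratr q.2.2[].
rewrite (_ : A = \bigcup_q (if `[< box q `<=` A >] then box q else set0)).
  apply: countable_bigcupT_measurable => // q.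
  by case: ifP => // _; apply: measurableX; exact: measurable_itv.
apply/seteqP; split=> [[x y] Axy|x [q _]]; last first.
  by case: ifP => // /asboolP; apply.
have [[U V] [/= Ux Vy] UV] : nbhs (x, y) A by apply: open_nbhs_nbhs.
have itv (z : R) (W : set R) : nbhs z W ->
    exists2 q : rat * rat, `]ratr q.1 : R, ratr q.2[ `<=` W
      & z \in `]ratr q.1 : R, ratr q.2[.
  case/nbhs_ballP => e /= e0 zW.
  have [q1] : exists q : rat, (ratr q : R) \in `]z - e, z[.
    by apply: rat_in_itvoo; rewrite ltrBlDr ltrDl.
  have [q2] : exists q : rat, (ratr q : R) \in `]z, z + e[.
    by apply: rat_in_itvoo; rewrite ltrDl.
  rewrite !in_itv/= => /andP[zq2 q2e] /andP[eq1 q1z].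
  exists (q1, q2); last by rewrite in_itv/= q1z.
  move=> w /=; rewrite in_itv/= => /andP[q1w wq2]; apply: zW.
  rewrite /ball/= ltr_distlC; apply/andP; split; lra.
have [q1 q1U xq1] := itv _ _ Ux; have [q2 q2V yq2] := itv _ _ Vy.
exists (q1, q2) => //; case: ifP => [_|/asboolP]; first by split.
by case=> -[a b] [/= /q1U Ua /q2V Vb]; apply: UV.
Qed.


Lemma measurable_fun_affine (a d : R) : measurable_fun setT (fun x : R => a * x + d).
Proof. by apply: measurable_funD => //; exact: measurable_funM. Qed.

(** The push-forward of Lebesgue measure under [x |-> a * x + d], scaled by [|a|], gives half-open
    intervals their length, hence is Lebesgue measure. *)
Lemma ge0_integral_affine (a d : R) (g : R -> \bar R) : a != 0 ->
  measurable_fun [set: measurableTypeR R] g -> (forall x, 0 <= g x)%E ->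
  (\int[@lebesgue_measure R]_x g x =
   `|a|%:E * \int[@lebesgue_measure R]_x g (a * x + d)%R)%E.
Proof.
move=> a0 mg g0.
pose phi : measurableTypeR R -> measurableTypeR R := fun x => a * x + d.
have mphi : measurable_fun setT phi by exact: measurable_fun_affine.
pose nu0 : {measure set (measurableTypeR R) -> \bar R} :=
  mscale (NngNum (normr_ge0 a)) (pushforward (@lebesgue_measure R) phi).
pose nu := nu0 mphi.
have -> : (\int[@lebesgue_measure R]_x g x = \int[nu]_x g x)%E.
  apply: eq_measure_integral => A mA _.
  apply: lebesgue_measure_unique => // _ [[b c] _ <-].
  rewrite [RHS](_ : _ = (`|a|%:E * @lebesgue_measure R (phi @^-1` [set` `]b, c]]))%E)//.
  case: (ltP 0 a) => [a_gt0|a_le0].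
    have -> : phi @^-1` [set` `]b, c]] = [set` `](b - d) / a, (c - d) / a]].
      apply/seteqP; split=> x /=; rewrite /phi !in_itv/=.
        by rewrite ltr_pdivrMr// ler_pdivlMr// ltrBlDr lerBrDr mulrC.
      by rewrite ltr_pdivrMr// ler_pdivlMr// ltrBlDr lerBrDr mulrC.
    rewrite !lebesgue_measure_itv/= !lte_fin ltr_pM2r ?invr_gt0// ltrD2r.
    case: ifPn => bc; last by rewrite mule0.
    by rewrite -!EFinB -EFinM gtr0_norm//; congr EFin; field.
  have a_lt0 : a < 0 by rewrite lt_neqAle a0.
  have -> : phi @^-1` [set` `]b, c]] = [set` `[(c - d) / a, (b - d) / a[].
    apply/seteqP; split=> x /=; rewrite /phi !in_itv/=.
      by rewrite ltr_ndivlMr// ler_ndivrMr// ltrBlDr lerBrDr mulrC andbC.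
    by rewrite ltr_ndivlMr// ler_ndivrMr// ltrBlDr lerBrDr mulrC andbC.
  rewrite !lebesgue_measure_itv/= !lte_fin ltr_nM2r ?invr_lt0// ltrD2r.
  case: ifPn => bc; last by rewrite mule0.
  by rewrite -!EFinB -EFinM ltr0_norm//; congr EFin; field.
rewrite /nu /nu0 ge0_integral_mscale//; congr (_ * _)%E.
by rewrite ge0_integral_pushforward// preimage_setT.
Qed.

End plane_measurability.

Section linear_change_of_variables.
Context {R : realType}.
Notation mplane := (measurableTypeR R * measurableTypeR R)%type.

(** Nonnegative integrands on the whole plane allow Tonelli without integrability conditions. The
    property is stable under composition, so that swaps and shears suffice to build the affine maps
    needed later. *)
Definition linear_cov (M : plane R -> plane R) (d : R) :=
  [/\ measurable_fun [set: mplane] (M : mplane -> mplane), 0 <= d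
    & forall g : mplane -> \bar R, measurable_fun setT g ->
        (forall x, 0 <= g x)%E ->
        (\int[leb2]_x g x = d%:E * \int[leb2]_x g (M x))%E].

Lemma linear_cov_comp M N d e :
  linear_cov M d -> linear_cov N e -> linear_cov (M \o N) (d * e).
Proof.
move=> [mM d0 MP] [mN e0 NP]; split; first exact: measurableT_comp.
  exact: mulr_ge0.
move=> g mg g0; rewrite MP// NP//; first by rewrite EFinM muleA.
exact: (measurableT_comp mg mM).
Qed.

Lemma linear_cov_swap : linear_cov (fun x => (x.2, x.1)) 1.
Proof.
have ms : measurable_fun [set: mplane] ((fun x => (x.2, x.1)) : mplane -> mplane).
  by apply: measurable_fun_pair.
split => // g mg g0; rewrite mul1e /leb2 fubini_tonelli1// [RHS]fubini_tonelli2//.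
exact: (measurableT_comp mg ms).
Qed.

(** Tonelli with the first variable innermost: for fixed [x.2] the map is an affine substitution on
    the line, of slope [a]. *)
Lemma linear_cov_shear (a b d : R) : a != 0 ->
  linear_cov (fun x => (a * x.1 + b * x.2 + d, x.2)) `|a|.
Proof.
move=> a0.
have ms : measurable_fun [set: mplane]
    ((fun x => (a * x.1 + b * x.2 + d, x.2)) : mplane -> mplane).
  apply: measurable_fun_pair => //; apply: measurable_funD => //.
  by apply: measurable_funD; apply: measurable_funM.
split => // g mg g0; rewrite /leb2 fubini_tonelli2// [in RHS]fubini_tonelli2//; last first.
  exact: (measurableT_comp mg ms).
rewrite -ge0_integralZl//; last 2 first.
  apply: measurable_fun_fubini_tonelli_G => //.
    exact: (measurableT_comp mg ms).
  by move=> y _; apply: integral_ge0.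
apply: eq_integral => y _; rewrite /fubini_G/=.
rewrite (@ge0_integral_affine _ a (b * y + d)) //=.
  by under [in RHS]eq_integral do rewrite -addrA.
by apply: (measurableT_comp mg); apply: measurable_fun_pair.
Qed.

Lemma linear_cov_image M d (D : set (plane R)) (g : plane R -> \bar R) :
  linear_cov M d -> injective M ->
  measurable ((M @` D) : set mplane) ->
  measurable_fun ((M @` D) : set mplane) g ->
  (forall x, (M @` D) x -> 0 <= g x)%E ->
  (\int[leb2]_(x in M @` D) g x = d%:E * \int[leb2]_(x in D) g (M x))%E.
Proof.
move=> [mM d0 MP] Minj mMD mg g0.
rewrite integral_mkcond MP; last 2 first.
- exact/(measurable_restrictT _ mMD).
- by move=> x; rewrite patchE; case: ifPn => // /[!inE] /g0.
rewrite [in RHS]integral_mkcond; congr (_ * _)%E; apply: eq_integral => x _.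
rewrite !patchE; congr (if _ then _ else _).
apply/idP/idP; rewrite !inE; first by case=> y Dy /Minj <-.
by exists x.
Qed.

End linear_change_of_variables.

Section vertical_change_of_variables.
Context {R : realType}.
Notation mplane := (measurableTypeR R * measurableTypeR R)%type.

Lemma within_continuous_image_comp (T U V : topologicalType) (A : set T) (B : set U)
    (f : T -> U) (g : U -> V) :
  {within A, continuous f} -> f @` A `<=` B -> {within B, continuous g} ->
  {within A, continuous (g \o f)}.
Proof.
move=> /subspace_continuousP cf fAB /subspace_continuousP cg.
apply/subspace_continuousP => x Ax.
apply: cvg_comp (cg _ (fAB _ _)); last by exists x.
move=> W /= WB; have := cf _ Ax _ WB; rewrite /nbhs/= /within/=.
by apply: filterS2 (withinT _ _) => y Ay; apply; apply: fAB; exists y.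
Qed.

Lemma image_increasing_itvoo (f : R -> R) (a b : R) : a < b ->
  {within `[a, b], continuous f} ->
  {in `[a, b] &, {homo f : x y / x < y}} ->
  f @` [set` `]a, b[] = [set` `]f a, f b[].
Proof.
move=> ab cf incf; apply/seteqP; split; first exact: increasing_image_oo.
move=> y /=; rewrite in_itv/= => /andP[ay yb].
have fab : f a < f b by apply: incf; rewrite // in_itv/= lexx ltW.
have [|x xab fxy] := IVT (ltW ab) cf (v := y).
  by rewrite min_l ?max_r ?(ltW fab)// !ltW.
exists x => //=; move: xab; rewrite !in_itv/= !le_eqVlt.
move=> /andP[/orP[/eqP xa|->] /orP[/eqP xb|->]] //.
- by move: ab; rewrite xa xb ltxx.
- by move: ay; rewrite -fxy xa ltxx.
- by move: yb; rewrite -fxy xb ltxx.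
Qed.

(** The vertical slices of an open element are open intervals. Continuity of [h] up to the end
    points serves the substitution rule on the closed interval; the end points do not contribute to
    the integrals. *)
Lemma integral_image_increasing (f f' h : R -> R) (a b : R) : a < b ->
  (forall t : R, is_derive t (1 : R) f (f' t)) -> continuous f' ->
  (forall t, a <= t <= b -> 0 < f' t) ->
  {within f @` [set` `[a, b]], continuous h} ->
  (\int[@lebesgue_measure R]_(y in f @` [set` `]a, b[]) (h y)%:E =
   \int[@lebesgue_measure R]_(t in [set` `]a, b[]) (h (f t) * f' t)%:E)%E.
Proof.
move=> ab df cf' f'0 ch.
have f'E : derive1 f = f'.
  by apply/funext => t; rewrite derive1E; apply: derive_val.
have drf (t : R) : derivable f t 1 by case: (df t).
have cf : continuous f by move=> t; apply/differentiable_continuous/derivable1_diffP.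
have cfab : {within `[a, b], continuous f} by exact: continuous_subspaceT.
have incf : {in `[a, b] &, {homo f : x y / x < y}}.
  apply: gtr0_derive1_lt_cc => // t /[!in_itv]/= /andP[at_ tb].
  by rewrite f'E f'0// !ltW.
have fab : f a < f b by apply: incf; rewrite // in_itv/= lexx ltW.
have imc : f @` [set` `[a, b]] = [set` `[f a, f b]].
  apply/seteqP; split=> [_ [t /= tab <-]|y /= yab].
    have/andP[at_ tb] : a <= t <= b by move: tab; rewrite in_itv.
    by rewrite in_itv/= !(le_mono_in incf) ?at_// in_itv/= lexx ltW.
  have [|t tab <-] := IVT (ltW ab) cfab (v := y).
    by rewrite min_l ?max_r ?(ltW fab)//; move: yab; rewrite in_itv.
  by exists t.
rewrite imc in ch.
have mh : measurable_fun [set` `]f a, f b[] h.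
  apply: (measurable_funS (E := [set` `[f a, f b]])) => //.
    exact: subset_itv_oo_cc.
  exact: subspace_continuous_measurable_fun.
have mhf : measurable_fun [set` `]a, b[] (fun t => h (f t) * f' t).
  apply: measurable_funM; last by apply: measurable_funTS; exact: continuous_measurable_fun.
  apply: (measurable_comp _ _ mh) => //.
    by rewrite -image_increasing_itvoo//; apply: subset_refl.
  by apply: measurable_funTS; exact: continuous_measurable_fun.
rewrite image_increasing_itvoo//.
rewrite -(@integral_itv_bndoo _ _ _ _ true false); last exact/measurable_EFinP.
rewrite integration_by_substitution_increasing ?ltW//; last 4 first.
- by rewrite f'E => t _; exact: cf'.
- by rewrite f'E; apply/cvg_ex; exists (f' a); apply: cvg_at_right_filter; exact: cf'.
- by rewrite f'E; apply/cvg_ex; exists (f' b); apply: cvg_at_left_filter; exact: cf'.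
- split => //; first by apply: cvg_at_right_filter; exact: cf.
  by apply: cvg_at_left_filter; exact: cf.
by rewrite f'E integral_itv_bndoo//; exact/measurable_EFinP.
Qed.

(** [Phi] preserves each vertical line, so Tonelli with the vertical variable innermost leaves an
    increasing substitution on every slice. [K] acts as the closure of [D]: it contains the closed
    slices, [f'] is positive on it, and [g] is continuous on its image. *)
Lemma integral_vertical_map (f f' : R -> R -> R) (D K : set (plane R))
    (g : plane R -> R) (Phi := fun x : plane R => (x.1, f x.1 x.2)) :
  measurable (D : set mplane) -> measurable (Phi @` D : set mplane) ->
  measurable_fun (Phi @` D : set mplane) g ->
  measurable_fun (D : set mplane) (fun x => g (Phi x) * f' x.1 x.2) ->
  (forall x, 0 <= g x) ->
  (forall x, (forall t, ~ D (x, t)) \/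
     exists a b, [/\ a < b, forall t, D (x, t) <-> a < t < b
                   & forall t, a <= t <= b -> K (x, t)]) ->
  (forall x t : R, is_derive t (1 : R) (f x) (f' x t)) ->
  (forall x, continuous (f' x)) ->
  (forall x t, K (x, t) -> 0 < f' x t) ->
  {within Phi @` K, continuous g} ->
  (\int[leb2]_(y in Phi @` D) (g y)%:E =
   \int[leb2]_(x in D) (g (Phi x) * f' x.1 x.2)%:E)%E.
Proof.
move=> mD mPD mg mgf g0 slices df cf' f'0 cg.
have gf0 z : (0 <= ((fun x => (g (Phi x) * f' x.1 x.2)%:E) \_ D) z)%E.
  rewrite patchE; case: ifPn => // /set_mem; case: z => x t Dxt.
  rewrite lee_fin mulr_ge0//= ltW// f'0//.
  case: (slices x) => [/(_ t)//|[a [b [ab Dab]]]]; apply.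
  by move/Dab : Dxt => /andP[? ?]; rewrite !ltW.
rewrite integral_mkcond [RHS]integral_mkcond /leb2 fubini_tonelli1; last 2 first.
- by apply/(measurable_restrictT _ mPD)/measurable_EFinP.
- by move=> z; rewrite patchE; case: ifPn => //; rewrite lee_fin.
rewrite fubini_tonelli1; last 2 first.
- by apply/(measurable_restrictT _ mD)/measurable_EFinP.
- exact: gf0.
apply: eq_integral => x _; rewrite /fubini_F.
have [Dx|[a [b [ab Dx Kx]]]] := slices x.
  rewrite [LHS]integral0_eq ?[RHS]integral0_eq// => t _; rewrite patchE.
    by rewrite memNset.
  by rewrite memNset// => -[[x' t'] /= Dx't [xx _]]; rewrite xx in Dx't; case: (Dx t').
transitivity (\int[@lebesgue_measure R]_(y in f x @` [set` `]a, b[]) (g (x, y))%:E)%E.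
  rewrite [RHS]integral_mkcond; apply: eq_integral => y _; rewrite !patchE.
  congr (if _ then _ else _); apply/idP/idP; rewrite !inE.
    move=> [[x' t'] /= Dx't [xx <-]]; subst x'; exists t' => //=.
    by rewrite in_itv/=; apply/Dx.
  by move=> [t /=]; rewrite in_itv/= => /Dx Dxt <-; exists (x, t).
rewrite (@integral_image_increasing _ (f' x))//; last 2 first.
- by move=> t /Kx; exact: f'0.
- apply: (within_continuous_image_comp (B := Phi @` K)) cg.
    by apply: continuous_subspaceT => y; apply: (@cvg_pair _ _ _ _ (nbhs x) (nbhs y)); [exact: cvg_cst|exact: cvg_id].
  by move=> _ [_ [t /Kx Kxt <-] <-]; exists (x, t).
- rewrite [LHS]integral_mkcond; apply: eq_integral => t _; rewrite !patchE.
  congr (if _ then _ else _); apply/idP/idP; rewrite !inE/= in_itv/=; by move/Dx.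
Qed.

End vertical_change_of_variables.

(** * Quadratic maps *)

Section quadratic_functions.
Context {R : realType}.
Implicit Types (x y z : plane R) (f : plane R -> R) (F : plane R -> plane R).

Lemma is_derive_line f x v (df : R) :
  is_derive (0 : R) (1 : R) (fun h : R => f (h *: v + x)) df -> is_derive x v f df.
Proof.
have E : (fun h : R => h^-1 *: (((fun h => f (h *: v + x)) \o shift 0) (h *: (1 : R)) - f (0 *: v + x)))
    = (fun h : R => h^-1 *: ((f \o shift x) (h *: v) - f x)).
  by apply/funext => h /=; rewrite addr0 scale0r add0r [h *: 1]mulr1.
by case=> d dE; split; rewrite /derivable /derive -E.
Qed.

Lemma is_derive_quadratic (a b c t : R) :
  is_derive t (1 : R) (fun h => a + b * h + c * h ^+ 2) (b + 2 * c * t).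
Proof.
have -> : (fun h => a + b * h + c * h ^+ 2) = horner (a%:P + b%:P * 'X + c%:P * 'X^2).
  by apply/funext => h; rewrite !hornerE.
apply: is_derive_eq (is_derive_poly _ _) _.
by rewrite !derivD !derivM !derivC !derivX !hornerE/=; ring.
Qed.

Lemma pder_isP2 f (a b c d e g : R) :
  (forall x, f x = a + b * x.1 + c * x.2
        + d * x.1 ^+ 2 + e * (x.1 * x.2) + g * x.2 ^+ 2) ->
  (forall x, is_derive x (dir 0) f (b + 2 * d * x.1 + e * x.2)) /\
  (forall x, is_derive x (dir 1) f (c + e * x.1 + 2 * g * x.2)).
Proof.
move=> fE; split=> x; apply: is_derive_line; rewrite /dir /=.
  rewrite (_ : (fun _ => _) = (fun h => f x + (b + 2 * d * x.1 + e * x.2) * h + d * h ^+ 2)).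
    by apply: is_derive_eq (is_derive_quadratic _ _ _ _) _; ring.
  by apply/funext => h; rewrite !fE /= /GRing.scale/=; ring.
rewrite (_ : (fun _ => _) = (fun h => f x + (c + e * x.1 + 2 * g * x.2) * h + g * h ^+ 2)).
  by apply: is_derive_eq (is_derive_quadratic _ _ _ _) _; ring.
by apply/funext => h; rewrite !fE /= /GRing.scale/=; ring.
Qed.

Lemma isP1_isP2 f : isP1 f -> isP2 f.
Proof.
by move=> [a [b [c fE]]]; exists a, b, c, 0, 0, 0 => x; rewrite fE; ring.
Qed.

Lemma isP1_pder f (i : 'I_2) : isP2 f -> isP1 (pder i f).
Proof.
move=> [a [b [c [d [e [g fE]]]]]]; have [d0 d1] := pder_isP2 fE.
have [->|i1] := eqVneq i 0.
  by exists b, (2 * d), e => x; rewrite /pder derive_val.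
have -> : i = 1 by case: i i1 => [[|[|]]] // lt2 _; apply/val_inj.
by exists c, e, (2 * g) => x; rewrite /pder derive_val.
Qed.

(** The exactness of this rule lets inverses of quadratic maps be differentiated without error
    terms. *)
Lemma isP2_midpoint_rule f : isP2 f -> forall x y, f x - f y =
  pder 0 f (midpt x y) * (x.1 - y.1) + pder 1 f (midpt x y) * (x.2 - y.2).
Proof.
move=> [a [b [c [d [e [g fE]]]]]] x y; have [d0 d1] := pder_isP2 fE.
by rewrite /pder !derive_val !fE /midpt/= /GRing.scale/=; field.
Qed.

(** Makes the terms with derivatives of the Jacobian matrix cancel in the divergence of a Piola
    transform. *)
Lemma pder_comm f : isP2 f -> forall x, pder 0 (pder 1 f) x = pder 1 (pder 0 f) x.
Proof.
move=> [a [b [c [d [e [g fE]]]]]] x; have [d0 d1] := pder_isP2 fE.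
have H0 z : pder 0 f z = b + 2 * d * z.1 + e * z.2
    + 0 * z.1 ^+ 2 + 0 * (z.1 * z.2) + 0 * z.2 ^+ 2.
  by rewrite /pder derive_val; ring.
have H1 z : pder 1 f z = c + e * z.1 + 2 * g * z.2
    + 0 * z.1 ^+ 2 + 0 * (z.1 * z.2) + 0 * z.2 ^+ 2.
  by rewrite /pder derive_val; ring.
have [d10 _] := pder_isP2 H1.
have [_ d01] := pder_isP2 H0.
by case: (d10 x) => _ E10; case: (d01 x) => _ E01; rewrite [LHS]E10 [RHS]E01; ring.
Qed.

Lemma continuous_isP2 f : isP2 f -> continuous f.
Proof.
move=> [a [b [c [d [e [g fE]]]]]] x; rewrite (_ : f = (fun x => a + b * x.1 + c * x.2
        + d * x.1 ^+ 2 + e * (x.1 * x.2) + g * x.2 ^+ 2)); last exact/funext.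
have c1 : (fun y : plane R => y.1) @ x --> x.1 by exact: cvg_fst.
have c2 : (fun y : plane R => y.2) @ x --> x.2 by exact: cvg_snd.
have cD (g1 g2 : plane R -> R) : g1 @ x --> g1 x -> g2 @ x --> g2 x ->
  (fun y => g1 y + g2 y) @ x --> g1 x + g2 x by move=> *; exact: cvgD.
have cM (g1 g2 : plane R -> R) : g1 @ x --> g1 x -> g2 @ x --> g2 x ->
  (fun y => g1 y * g2 y) @ x --> g1 x * g2 x by move=> *; exact: cvgM.
have cC (r : R) : (fun _ : plane R => r) @ x --> r by exact: cvg_cst.
have c11 := cM _ _ c1 c1; have c12 := cM _ _ c1 c2; have c22 := cM _ _ c2 c2.
exact: (cD _ _ (cD _ _ (cD _ _ (cD _ _ (cD _ _ (cC a) (cM _ _ (cC b) c1))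
  (cM _ _ (cC c) c2)) (cM _ _ (cC d) c11)) (cM _ _ (cC e) c12)) (cM _ _ (cC g) c22)).
Qed.

Lemma continuous_isP2v (F : plane R -> plane R) : isP2v F -> continuous F.
Proof.
move=> FP x; rewrite (_ : F = (fun x => (crd 0 (F x), crd 1 (F x)))); last first.
  by apply/funext => y; rewrite /crd/=; case: (F y).
by apply: (@cvg_pair _ _ _ _ (nbhs (crd 0 (F x))) (nbhs (crd 1 (F x)))); [exact: (continuous_isP2 (FP 0))|exact: (continuous_isP2 (FP 1))].
Qed.

Lemma isP1v_isP2v (F : plane R -> plane R) : isP1v F -> isP2v F.
Proof. by move=> FP i; exact/isP1_isP2. Qed.

End quadratic_functions.

(** * Topology of the reference triangle and continuity of inverse maps *)

Section reference_triangle.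
Context {R : realType}.
Implicit Types (x y z : plane R) (D : set (plane R)).

Lemma det_mx2 (A : 'M[R]_2) : \det A = A 0 0 * A 1 1 - A 0 1 * A 1 0.
Proof.
rewrite (expand_det_row _ 0) big_ord_recl big_ord1 /cofactor !det_mx11 !mxE/=.
rewrite expr0 expr1 !mul1r mulN1r mulrN; congr (_ * A _ _ - A _ _ * A _ _);
  exact/val_inj.
Qed.

Lemma det_jac (F : plane R -> plane R) x : \det (jac F x) =
  pder 0 (crd 0 \o F) x * pder 1 (crd 1 \o F) x
  - pder 1 (crd 0 \o F) x * pder 0 (crd 1 \o F) x.
Proof. by rewrite det_mx2 !mxE. Qed.

Lemma isP1_bary (i : 'I_3) : isP1 (@bary R i).
Proof.
case: i => [[|[|[|]]]] //= lt3; rewrite /bary/=.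
- by exists 1, (-1), (-1) => x; ring.
- by exists 0, 1, 0 => x; ring.
- by exists 0, 0, 1 => x; ring.
Qed.

Lemma ord3_ind (P : 'I_3 -> Prop) : P 0 -> P 1 -> P 2%R -> forall i, P i.
Proof.
move=> P0 P1 P2 [[|[|[|]]]] // lt3.
- by rewrite (_ : Ordinal lt3 = 0)//; exact/val_inj.
- by rewrite (_ : Ordinal lt3 = 1)//; exact/val_inj.
- by rewrite (_ : Ordinal lt3 = 2%R)//; exact/val_inj.
Qed.

Lemma refTE x : refT x <-> [/\ 0 < x.1, 0 < x.2 & x.1 + x.2 < 1].
Proof.
split=> [xT|[x1 x2 x12]].
  by move: (xT 0) (xT 1) (xT 2%R); rewrite /bary/= => x0 x1 x2; split => //; lra.
by apply: ord3_ind; rewrite /bary//=; lra.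
Qed.

Lemma crefTE x : crefT x <-> [/\ 0 <= x.1, 0 <= x.2 & x.1 + x.2 <= 1].
Proof.
split=> [xT|[x1 x2 x12]].
  by move: (xT 0) (xT 1) (xT 2%R); rewrite /bary/= => x0 x1 x2; split => //; lra.
by apply: ord3_ind; rewrite /bary//=; lra.
Qed.

Lemma refT_sub_crefT : @refT R `<=` crefT.
Proof. by move=> x xT i; exact/ltW. Qed.

Lemma open_refT : open (@refT R).
Proof.
have ob i : open (@bary R i @^-1` [set t | 0 < t]).
  apply: open_comp; last exact: open_gt.
  by move=> x _; apply: continuous_isP2; exact/isP1_isP2/isP1_bary.
have -> : @refT R = bary 0 @^-1` [set t | 0 < t] `&` bary 1 @^-1` [set t | 0 < t]
    `&` bary 2%R @^-1` [set t | 0 < t].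
  by apply/seteqP; split=> [x xT|x [[x0 x1] x2]]; [split; [split|]; exact: xT|exact: ord3_ind].
by apply: openI; [apply: openI|].
Qed.

Lemma compact_crefT : compact (@crefT R).
Proof.
have cK : compact ([set` `[0 : R, 1]] `*` [set` `[0 : R, 1]]).
  by apply: compact_setX; exact: segment_compact.
apply: subclosed_compact cK _; last first.
  move=> x /crefTE[x1 x2 x12]; split; rewrite /= in_itv/=; apply/andP; split; lra.
have -> : @crefT R = \bigcap_(i in [set: 'I_3]) (bary i @^-1` [set t | 0 <= t]).
  by apply/seteqP; split=> x xT i; [move=> _; exact: xT|exact: (xT i I)].
apply: closed_bigI => i _; apply: closed_comp; last exact: closed_ge.
by move=> x _; apply: continuous_isP2; exact/isP1_isP2/isP1_bary.
Qed.

Lemma hausdorff_plane : hausdorff_space (plane R).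
Proof. exact: norm_hausdorff. Qed.

(** Compactness argument: the part of [K] outside a neighbourhood [V] of [x] has a compact, hence
    closed, image, and this image misses [F x]. *)
Lemma within_continuous_inverse (K : set (plane R)) (F G : plane R -> plane R) :
  compact K -> continuous F -> (forall x, K x -> G (F x) = x) ->
  {within F @` K, continuous G}.
Proof.
move=> cK cF GF; apply/subspace_continuousP => _ [x Kx <-]; rewrite /from_subspace (GF x Kx) => W.
rewrite nbhsE => -[V [oV Vx] VW]; rewrite /nbhs/= /within/=.
have cKV : compact (F @` (K `&` ~` V)).
  apply: continuous_compact; first exact: continuous_subspaceT.
  by apply: compact_closedI => //; exact: open_closedC.
have oFKV := closed_openC (compact_closed hausdorff_plane cKV).
have : nbhs (F x) (~` (F @` (K `&` ~` V))).
  apply: open_nbhs_nbhs; split => // -[z [Kz Vz] Fzx]; apply: Vz.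
  by rewrite (_ : z = x)// -[LHS]GF// -[RHS]GF// Fzx.
apply: filterS => y ny [z Kz zy]; apply: VW; rewrite -zy GF//.
by apply: contrapT => Vz; apply: ny; exists z.
Qed.

End reference_triangle.

(** * Open mapping theorem for injective quadratic maps *)

Section open_mapping.
Context {R : realType}.
Implicit Types (x y z v : plane R) (D : set (plane R)).

Lemma isP2_line (f : plane R -> R) v x : isP2 f -> exists k, forall t : R,
  f (t *: v + x) = f x + (pder 0 f x * v.1 + pder 1 f x * v.2) * t + k * t ^+ 2.
Proof.
move=> [a [b [c [d [e [g fE]]]]]]; have [d0 d1] := pder_isP2 fE.
exists (d * v.1 ^+ 2 + e * (v.1 * v.2) + g * v.2 ^+ 2) => t.
by rewrite /pder !derive_val !fE /= /GRing.scale/=; ring.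
Qed.

Definition sqdist x y : R := (x.1 - y.1) ^+ 2 + (x.2 - y.2) ^+ 2.

Lemma isP2_sqdist y : isP2 (sqdist^~ y).
Proof.
exists (y.1 ^+ 2 + y.2 ^+ 2), (- 2 * y.1), (- 2 * y.2), 1, 0, 1 => x.
by rewrite /sqdist; ring.
Qed.

(** The conclusion is half the derivative at 0 of the right-hand side, which has a minimum there. *)
Lemma local_min_quadratic (a g k a' g' k' r : R) : 0 < r ->
  (forall t, - r < t < r -> a ^+ 2 + a' ^+ 2 <=
     (a + g * t + k * t ^+ 2) ^+ 2 + (a' + g' * t + k' * t ^+ 2) ^+ 2) ->
  a * g + a' * g' = 0.
Proof.
move=> r0 amin.
pose q (b c d : R) := b%:P + c%:P * 'X + d%:P * ('X * 'X).
pose p := q a g k * q a g k + q a' g' k' * q a' g' k'.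
have pE t : p.[t] =
    (a + g * t + k * t ^+ 2) ^+ 2 + (a' + g' * t + k' * t ^+ 2) ^+ 2.
  by rewrite /p /q !hornerE; ring.
have dp : is_derive (0 : R) (1 : R) (horner p) 0.
  apply: (@derive1_at_min _ _ (- r) r).
  - lra.
  - by move=> t _; exact: derivable_horner.
  - by rewrite in_itv/=; apply/andP; split; lra.
  - move=> t; rewrite in_itv/= => /amin; rewrite !pE => /(le_trans _); apply.
    by rewrite le_eqVlt; apply/orP; left; apply/eqP; ring.
have := derive_val (is_derive := is_derive_poly p 0).
rewrite (derive_val (is_derive := dp)) /p /q.
by rewrite !(derivD, derivM, derivC, derivX) !hornerE/= => h; lra.
Qed.

Lemma nbhs_box x D : nbhs x D -> exists2 r : R, 0 < r &
  [set` `[x.1 - r, x.1 + r]] `*` [set` `[x.2 - r, x.2 + r]] `<=` D.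
Proof.
move/nbhs_ballP => [e /= e0 xeD]; exists (e / 2); first by rewrite divr_gt0.
move=> y [/=]; rewrite !in_itv/= => /andP[? ?] /andP[? ?].
apply: xeD; split; rewrite /ball/= ltr_distlC; apply/andP; split; lra.
Qed.

Lemma cramer_zero (u v a b c d : R) : a * d - b * c != 0 ->
  u * a + v * c = 0 -> u * b + v * d = 0 -> u = 0 /\ v = 0.
Proof.
move=> det0 e1 e2; split; apply: (mulfI det0); rewrite mulr0.
  by transitivity (d * (u * a + v * c) - c * (u * b + v * d)); [ring|rewrite e1 e2; ring].
by transitivity (a * (u * b + v * d) - b * (u * a + v * c)); [ring|rewrite e1 e2; ring].
Qed.

(* Inside a small box, the point minimizing the distance to [y] cannot lie on the
   boundary of the box when [y] is close to [F x0], so that the gradient of the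
   squared distance vanishes there. *)
Lemma open_image_P2v (F : plane R -> plane R) D : open D -> isP2v F ->
  (forall x, D x -> \det (jac F x) != 0) ->
  (forall x y, D x -> D y -> F x = F y -> x = y) -> open (F @` D).
Proof.
move=> oD F2 detF injF; rewrite openE => _ [x0 Dx0 <-].
have cF := continuous_isP2v F2.
have csq y : continuous (fun x => sqdist (F x) y).
  move=> x; apply: (@continuous_comp _ _ _ F (sqdist^~ y)); first exact: cF.
  exact/continuous_isP2/isP2_sqdist.
have [|r r0] := @nbhs_box x0 D; first exact: open_nbhs_nbhs.
set B := _ `*` _ => BD.
have BE x : B x <-> [/\ x0.1 - r <= x.1, x.1 <= x0.1 + r, x0.2 - r <= x.2 & x.2 <= x0.2 + r].
  split; first by move=> [/=]; rewrite !in_itv/= => /andP[? ?] /andP[? ?].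
  by move=> [? ? ? ?]; split; rewrite /= in_itv/=; apply/andP.
have cB : compact B by apply: compact_setX; exact: segment_compact.
pose U : set (plane R) :=
  (fst @^-1` [set` `]x0.1 - r, x0.1 + r[]) `&` (snd @^-1` [set` `]x0.2 - r, x0.2 + r[]).
have oU : open U.
  apply: openI; apply: open_comp; try exact: interval_open.
    by move=> x _; exact: cvg_fst.
  by move=> x _; exact: cvg_snd.
pose S := B `&` ~` U.
have cS : compact S by apply: compact_closedI => //; exact: open_closedC.
have [|d /set_mem[Bd Ud] dmin] := @compact_EVT_min _ _ (fun x => sqdist (F x) (F x0)) S _ cS (continuous_subspaceT (csq _)).
  exists (x0.1 + r, x0.2); split; first by apply/BE; split => /=; lra.
  by move=> [/=]; rewrite !in_itv/= ltxx andbF.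
have d0 : 0 < sqdist (F d) (F x0).
  rewrite lt0r addr_ge0 ?sqr_ge0// andbT; apply/eqP => /eqP.
  rewrite paddr_eq0 ?sqr_ge0// !sqrf_eq0 !subr_eq0 => /andP[/eqP e1 /eqP e2].
  have dx0 : d = x0.
    apply: injF => //; first exact: BD.
    by case: (F d) (F x0) e1 e2 => [? ?] [? ?] /= -> ->.
  by apply: Ud; rewrite dx0; split; rewrite /= in_itv/=; apply/andP; split; lra.
(* With [m = sqdist (F d) (F x0)], a minimizer [x] on the boundary would satisfy [m <= 2 * sqdist (F
   x) y + 2 * sqdist y (F x0) <= 4 * sqdist y (F x0)]; the factor 1/4 makes this less than [m]. *)
have : nbhs (F x0) [set y | sqdist y (F x0) < sqdist (F d) (F x0) / 4].
  apply: open_nbhs_nbhs; split; last by rewrite /= /sqdist !subrr expr0n/= addr0 divr_gt0.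
  apply: (@open_comp _ _ (sqdist^~ (F x0)) [set t | t < sqdist (F d) (F x0) / 4]); last exact: open_lt.
  by move=> y _; exact/continuous_isP2/isP2_sqdist.
apply: filterS => y /= yd.
have Bx0 : B x0 by apply/BE; split; lra.
have [|x /set_mem Bx xmin] := @compact_EVT_min _ _ (fun x => sqdist (F x) y) B _ cB (continuous_subspaceT (csq _)).
  by exists x0.
have Ux : U x.
  apply: contrapT => Ux.
  have {}dmin : sqdist (F d) (F x0) <= sqdist (F x) (F x0) by apply: dmin; exact/mem_set.
  have {}xmin : sqdist (F x) y <= sqdist (F x0) y by apply: xmin; exact/mem_set.
  have : sqdist (F x) (F x0) <= 2 * sqdist (F x) y + 2 * sqdist y (F x0).
    rewrite -subr_ge0 /sqdist.
    rewrite [leRHS](_ : _ = ((F x).1 + (F x0).1 - 2 * y.1) ^+ 2 + ((F x).2 + (F x0).2 - 2 * y.2) ^+ 2); last by ring.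
    by rewrite addr_ge0 ?sqr_ge0.
  have : sqdist (F x0) y = sqdist y (F x0) by rewrite /sqdist; ring.
  lra.
have [r' r'0 xr'U] : exists2 r', 0 < r' & [set` `[x.1 - r', x.1 + r']] `*` [set` `[x.2 - r', x.2 + r']] `<=` B.
  have [|r' r'0 xr'U] := @nbhs_box x U; first exact: open_nbhs_nbhs.
  exists r' => //; apply: (subset_trans xr'U) => z [/=].
  by rewrite !in_itv/= => /andP[? ?] /andP[? ?]; apply/BE; split; lra.
have grad v : `|v.1| <= 1 -> `|v.2| <= 1 ->
    ((F x).1 - y.1) * (pder 0 (crd 0 \o F) x * v.1 + pder 1 (crd 0 \o F) x * v.2) +
    ((F x).2 - y.2) * (pder 0 (crd 1 \o F) x * v.1 + pder 1 (crd 1 \o F) x * v.2) = 0.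
  rewrite !ler_norml => /andP[v1 v1'] /andP[v2 v2'].
  have [k kE] := isP2_line v x (F2 0); have [k' k'E] := isP2_line v x (F2 1).
  apply: (@local_min_quadratic _ _ k _ _ k' r' r'0) => t /andP[tr rt].
  have /mem_set/xmin : B (t *: v + x).
    apply: xr'U; split; rewrite /= in_itv/=; apply/andP; rewrite /GRing.scale/=; split; nra.
  rewrite /sqdist => /le_trans; apply; rewrite le_eqVlt; apply/orP; left; apply/eqP.
  have -> : (F (t *: v + x)).1 = (crd 0 \o F) (t *: v + x) by [].
  have -> : (F (t *: v + x)).2 = (crd 1 \o F) (t *: v + x) by [].
  rewrite kE k'E /crd/=.
  move: (pder _ _ _) (pder _ _ _) (pder _ _ _) (pder _ _ _) ((F x).1) ((F x).2) => *; ring.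
exists x; first exact: BD.
(* The two coordinate directions show that [F x - y] is orthogonal to both columns of the invertible
   Jacobian matrix, hence 0. *)
have := grad (1, 0); have := grad (0, 1); rewrite /= normr0 normr1 ler01 lexx.
move=> /(_ erefl erefl) g1 /(_ erefl erefl) g0.
have := detF x (BD _ Bx); rewrite det_jac => dx.
have [F1 F2'] : (F x).1 - y.1 = 0 /\ (F x).2 - y.2 = 0.
  by move: g0 g1; rewrite !(mulr1, mulr0, addr0, add0r); exact: cramer_zero.
case: (F x) y F1 F2' {yd xmin grad g0 g1} => [a b] [c d'] /= /eqP + /eqP.
by rewrite !subr_eq0 => /eqP -> /eqP ->.
Qed.

End open_mapping.

(** * Change of variables for bilinear maps *)

Section change_of_variables.
Context {R : realType}.
Implicit Types (x y z v : plane R) (D K : set (plane R)) (F M : plane R -> plane R).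
Notation mplane := (measurableTypeR R * measurableTypeR R)%type.

Lemma within_continuous_measurable D K (g : plane R -> R) : open D -> D `<=` K ->
  {within K, continuous g} -> measurable_fun (D : set mplane) g.
Proof.
move=> oD DK /(continuous_subspaceW DK) /continuousP cg.
have mD := open_measurable_plane oD; apply: (measurability _ (RGenOpens.measurableE R)).
move=> _ [_ [a [b ->] <-]].
have /open_subspaceP[V oV VD] := cg _ (@interval_open R (BRight a) (BLeft b) isT isT).
by rewrite setIC -VD; apply: measurableI; exact: open_measurable_plane.
Qed.

(** Central differences are exact on quadratics; they turn identities between Jacobians into
    identities between values, which [field] decides. *)
Lemma pder_central (f : plane R -> R) (i : 'I_2) x : isP2 f ->
  pder i f x = (f (dir i + x) - f (- dir i + x)) / 2.
Proof.
move=> [a [b [c [d [e [g fE]]]]]]; have [d0 d1] := pder_isP2 fE.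
have [->|i1] := eqVneq i 0.
  by rewrite /pder derive_val !fE /dir/=; field.
have -> : i = 1 by case: i i1 => [[|[|]]] // lt2 _; apply/val_inj.
by rewrite /pder derive_val !fE /dir/=; field.
Qed.

Lemma det_jac_central F x : isP2v F -> \det (jac F x) =
  ((F (dir 0 + x)).1 - (F (- dir 0 + x)).1) / 2 *
  (((F (dir 1 + x)).2 - (F (- dir 1 + x)).2) / 2) -
  ((F (dir 1 + x)).1 - (F (- dir 1 + x)).1) / 2 *
  (((F (dir 0 + x)).2 - (F (- dir 0 + x)).2) / 2).
Proof. by move=> F2; rewrite det_jac !pder_central. Qed.

(** The factor [e] fixes a constant sign of the determinant without prescribing it, so that the
    class is stable under reflections of source and target. *)
Definition nondegenerate F := [/\ isP2v F,
  forall x y, crefT x -> crefT y -> F x = F y -> x = y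
  & exists e : R, forall x, crefT x -> 0 < e * \det (jac F x)].

Lemma nondegenerate_det F x : nondegenerate F -> crefT x -> \det (jac F x) != 0.
Proof.
by case=> _ _ [e he] /he; apply: contraTneq => ->; rewrite mulr0 ltxx.
Qed.

Lemma nondegenerate_open F : nondegenerate F -> open (F @` refT).
Proof.
move=> nF; have [F2 injF _] := nF; apply: open_image_P2v => //.
- exact: open_refT.
- by move=> x /refT_sub_crefT; exact: nondegenerate_det.
- by move=> x y xT yT; apply: injF; exact: refT_sub_crefT.
Qed.

(** The absolute value makes this independent of the orientation, so reflections are allowed in the
    reductions. Integrands of variable sign are recovered in [chart_integral]. *)
Definition cov F := forall g : plane R -> R, (forall x, 0 <= g x) ->
  {within F @` crefT, continuous g} ->
  (\int[leb2]_(y in F @` refT) (g y)%:E =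
   \int[leb2]_(x in refT) (g (F x) * `|\det (jac F x)|)%:E)%E.

Lemma nondegenerate_comp F M (d : R) : d != 0 ->
  nondegenerate F -> injective M -> isP2v (M \o F) ->
  (forall x, \det (jac (M \o F) x) = d * \det (jac F x)) ->
  nondegenerate (M \o F).
Proof.
move=> d0 [F2 injF [e he]] injM MF2 dMF; split => //.
  by move=> x y xT yT /injM; exact: injF.
exists (e / d) => x xT; rewrite dMF mulrA divfK//; exact: he.
Qed.

Lemma cov_target F M (d : R) : d != 0 ->
  nondegenerate F -> continuous M -> injective M -> isP2v (M \o F) ->
  (forall x, \det (jac (M \o F) x) = d * \det (jac F x)) ->
  linear_cov M `|d| -> cov F -> cov (M \o F).
Proof.
move=> d0 nF cM injM MF2 dMF lM cF g g0 cg.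
have oMF : open (M @` (F @` refT)).
  by rewrite image_comp; apply: nondegenerate_open; exact: nondegenerate_comp dMF.
have MFT : M @` (F @` refT) `<=` (M \o F) @` crefT.
  by rewrite image_comp; apply: image_subset; exact: refT_sub_crefT.
rewrite -image_comp (linear_cov_image (d := `|d|))//; last 3 first.
- exact: open_measurable_plane.
- by apply/measurable_EFinP; exact: within_continuous_measurable cg.
- by move=> x _; rewrite lee_fin.
rewrite (cF (g \o M)); last 2 first.
  by move=> x /=.
  apply: (within_continuous_image_comp (B := (M \o F) @` crefT)) cg.
    exact: continuous_subspaceT.
  by rewrite image_comp.
rewrite -ge0_integralZl//.
- by apply: eq_integral => x _; rewrite dMF normrM /= -EFinM mulrCA.
- apply: open_measurable_plane; exact: open_refT.
- apply/measurable_EFinP; apply: measurable_funM.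
    apply: (within_continuous_measurable (K := crefT)) => //.
    - exact: open_refT.
    - exact: refT_sub_crefT.
    apply: (within_continuous_image_comp (B := (M \o F) @` crefT)) cg => //.
    apply: continuous_subspaceT; apply: continuous_isP2v.
    exact: MF2.
  apply: measurableT_comp => //.
  apply: (within_continuous_measurable (K := setT)) => //; first exact: open_refT.
  apply: continuous_subspaceT => x.
  have F2 : isP2v F by case: nF.
  under [fun _ => \det _]funext do rewrite det_jac.
  by apply: cvgB; apply: cvgM; apply: continuous_isP2; apply/isP1_isP2/isP1_pder.
- by move=> x _; rewrite lee_fin; apply: mulr_ge0 => //; exact: g0.
Qed.

Lemma cov_source F P (d : R) : `|d| = 1 -> nondegenerate F ->
  continuous P -> injective P -> P @` refT = refT -> P @` crefT = crefT ->
  (forall x, \det (jac (F \o P) x) = d * \det (jac F (P x))) ->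
  linear_cov P 1 -> cov (F \o P) -> cov F.
Proof.
move=> d1 nF cP injP PT PcT dFP lP cFP g g0 cg.
have F2 : isP2v F by case: nF.
have -> : F @` refT = (F \o P) @` refT by rewrite -[RHS]image_comp PT.
have FPc : F @` crefT = (F \o P) @` crefT by rewrite -[RHS]image_comp PcT.
have cg' := cg; rewrite FPc in cg'.
rewrite (cFP g g0 cg').
have oPT : open (P @` refT) by rewrite PT; exact: open_refT.
rewrite -[in RHS]PT (linear_cov_image (d := 1))//; last 3 first.
- exact: open_measurable_plane.
- apply/measurable_EFinP; apply: measurable_funM.
    apply: (within_continuous_measurable (K := crefT)) => //.
      by rewrite PT; exact: refT_sub_crefT.
    apply: (within_continuous_image_comp (B := F @` crefT)) cg => //.
    by apply: continuous_subspaceT; exact: continuous_isP2v.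
  apply: measurableT_comp => //.
  apply: (within_continuous_measurable (K := setT)) => //.
  apply: continuous_subspaceT => x.
  under [fun _ => \det _]funext do rewrite det_jac.
  by apply: cvgB; apply: cvgM; apply: continuous_isP2; apply/isP1_isP2/isP1_pder.
- by move=> x _; rewrite lee_fin; exact: mulr_ge0.
by rewrite mul1e; apply: eq_integral => x _; rewrite dFP normrM d1 mul1r.
Qed.

End change_of_variables.

Section bilinear_maps_core.
Context {R : realType}.
Implicit Types (x y z v : plane R) (D K : set (plane R)) (F M : plane R -> plane R).

Lemma isP2v_pair F : isP2 (fun x => (F x).1) -> isP2 (fun x => (F x).2) -> isP2v F.
Proof.
move=> F1 F2 i; have [->|i1] := eqVneq i 0; first exact: F1.
by have -> : i = 1 by case: i i1 => [[|[|]]] // lt2 _; apply/val_inj.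
Qed.

Definition interval_slice (S T : set R) := (forall t, ~ S t) \/
  exists a b, [/\ a < b, forall t, S t <-> a < t < b & forall t, a <= t <= b -> T t].

(** A triangle is an intersection of half-planes, so its slices arise by imposing one affine
    inequality after the other. The weak inequality in [T] keeps a newly created end point in
    [T]. *)
Lemma interval_slice_cut S T (p q : R) : interval_slice S T ->
  interval_slice (S `&` [set t | 0 < p + q * t]) (T `&` [set t | 0 <= p + q * t]).
Proof.
move=> [S0|[a [b [ab Sab Tab]]]]; first by left=> t [/S0].
have [q0|q0|->] := ltgtP q 0.
- have pq t : (0 < p + q * t) = (t < - p / q).
    by rewrite ltr_ndivlMr//; apply/idP/idP => ?; lra.
  have pq' t : (0 <= p + q * t) = (t <= - p / q).
    by rewrite ler_ndivlMr//; apply/idP/idP => ?; lra.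
  have [abq|abq] := ltP a (Num.min b (- p / q)); last first.
    left=> t [/Sab/andP[at_ tb] /=]; rewrite pq => tq.
    by move: abq; rewrite leNgt lt_min !(lt_trans at_)//.
  right; exists a, (Num.min b (- p / q)); split => // t.
    rewrite /= pq lt_min; split; first by move=> [/Sab/andP[-> ->]].
    by move=> /and3P[at_ tb ->]; split=> //; apply/Sab/andP.
  rewrite le_min => /and3P[at_ tb tq]; split; first by apply/Tab/andP.
  by rewrite /= pq'.
- have pq t : (0 < p + q * t) = (- p / q < t).
    by rewrite ltr_pdivrMr//; apply/idP/idP => ?; lra.
  have pq' t : (0 <= p + q * t) = (- p / q <= t).
    by rewrite ler_pdivrMr//; apply/idP/idP => ?; lra.
  have [abq|abq] := ltP (Num.max a (- p / q)) b; last first.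
    left=> t [/Sab/andP[at_ tb] /=]; rewrite pq => tq.
    by move: abq; rewrite leNgt gt_max !(lt_trans _ tb)//.
  right; exists (Num.max a (- p / q)), b; split => // t.
    rewrite /= pq gt_max; split; first by move=> [/Sab/andP[-> ->] ->].
    by move=> /andP[/andP[at_ tq] tb]; split=> //; apply/Sab/andP.
  rewrite ge_max => /andP[/andP[at_ tq] tb]; split; first by apply/Tab/andP.
  by rewrite /= pq'.
- have [p0|p0] := ltP 0 p; last first.
    by left=> t [_] /=; rewrite mul0r addr0 ltNge p0.
  right; exists a, b; split => // t; rewrite /= mul0r addr0.
    by split=> [[/Sab]//|/Sab].
  by move=> /Tab Tt; split => //; exact: ltW.
Qed.

(* In the coordinates [(x.1, x.2)] with [x.1] the first component of the map, the
   map preserves vertical lines. *)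
Lemma cov_core (c1 c2 a b c d e : R)
    (F := fun x => (c1 + a * x.1 + b * x.2, c2 + c * x.1 + d * x.2 + e * (x.1 * x.2))) :
  a != 0 -> nondegenerate F ->
  (forall x, crefT x -> 0 < a * \det (jac F x)) -> cov F.
Proof.
move=> a0 nF JF.
have F2 : isP2v F by case: nF.
have dF x : \det (jac F x) = a * (d + e * x.1) - b * (c + e * x.2).
  by rewrite det_jac_central// /F /dir/=; field.
pose M x : plane R := (a * x.1 + b * x.2 + c1, x.2).
pose N x : plane R := ((x.1 - b * x.2 - c1) / a, x.2).
have MK : cancel M N by move=> [s t]; rewrite /M /N/=; congr pair; field.
have NK : cancel N M by move=> [s t]; rewrite /M /N/=; congr pair; field.
have M2 : isP2v M.
  apply: isP2v_pair.
    by exists c1, a, b, 0, 0, 0 => x; rewrite /M/=; ring.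
  by exists 0, 0, 1, 0, 0, 0 => x; rewrite /M/=; ring.
have dM x : \det (jac M x) = a by rewrite det_jac_central// /M /dir/=; field.
(* [f s t] is the second component of [F] at [N (s, t)]; it is quadratic in [t] because the first
   coordinate of [N (s, t)] varies with [t]. *)
pose f s t := (c2 + c / a * (s - c1)) + (d - b * c / a + e * (s - c1) / a) * t
  + (- (e * b / a)) * t ^+ 2.
pose f' s t := (d - b * c / a + e * (s - c1) / a) + 2 * (- (e * b / a)) * t.
pose Phi x : plane R := (x.1, f x.1 x.2).
have PhiM x : Phi (M x) = F x by rewrite /Phi /M /F /f/=; congr pair; field.
have f'E x : a * f' (M x).1 (M x).2 = \det (jac F x).
  by rewrite dF /f' /M/=; field.
have imM D x : (M @` D) x <-> D (N x).
  by split=> [[y Dy <-]|Dx]; [rewrite MK|exists (N x)].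
have oMT : open (M @` refT).
  apply: open_image_P2v => //; first exact: open_refT.
    by move=> x _; rewrite dM.
  by move=> x y _ _; exact: (can_inj MK).
have MTK : M @` refT `<=` M @` crefT by apply: image_subset; exact: refT_sub_crefT.
have im D : F @` D = Phi @` (M @` D).
  by rewrite image_comp; congr (_ @` D); apply/funext => x; rewrite /= PhiM.
have oPT : open (Phi @` (M @` refT)) by rewrite -im; exact: nondegenerate_open.
have cPhi : continuous Phi.
  move=> x; have cc : isP2v Phi.
    apply: isP2v_pair.
      by exists 0, 1, 0, 0, 0, 0 => y; rewrite /Phi/=; ring.
    exists (c2 - c / a * c1), (c / a), (d - b * c / a - e * c1 / a), 0, (e / a), (- (e * b / a)).
    by move=> y; rewrite /Phi /f/=; ring.
  exact: continuous_isP2v.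
have cf' : continuous (fun x => f' x.1 x.2).
  apply: continuous_isP2.
  exists (d - b * c / a - e * c1 / a), (e / a), (- 2 * (e * b / a)), 0, 0, 0 => x.
  by rewrite /f'; ring.
move=> g g0 cg.
have cgP : {within M @` crefT, continuous (g \o Phi)}.
  apply: (within_continuous_image_comp (B := F @` crefT)) cg.
    exact: continuous_subspaceT.
  by rewrite im.
have mgf : measurable_fun (M @` refT : set (measurableTypeR R * measurableTypeR R))
    (fun x => g (Phi x) * f' x.1 x.2).
  apply: measurable_funM; first exact: (within_continuous_measurable oMT MTK cgP).
  by apply: (within_continuous_measurable (K := setT)) => //; exact: continuous_subspaceT.
(* As [a * \det (jac F x)] equals [a ^ 2 * f'], the sign condition says that [Phi] is increasing
   along vertical lines. *)
have f'0 s t : (M @` crefT) (s, t) -> 0 < f' s t.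
  move=> [x /JF + xst]; have := f'E x; rewrite xst/= => <-.
  by rewrite mulrA pmulr_rgt0// -expr2 exprn_even_gt0.
have df (s t : R) : is_derive t (1 : R) (f s) (f' s t) by exact: is_derive_quadratic.
rewrite im (@integral_vertical_map _ f f' _ (M @` crefT))//; last 6 first.
- exact: open_measurable_plane.
- exact: open_measurable_plane.
- apply: (within_continuous_measurable (K := Phi @` (M @` crefT))) => //.
    exact: image_subset.
  by rewrite -im.
- move=> s.
  (* The bound [t < 1] follows from the other inequalities of the triangle and provides a bounded
     interval to start from. The two cuts say that the first coordinate of [N (s, t)] is positive
     and that its coordinates sum up to less than 1. *)
  have : interval_slice ([set t | 0 < t < 1] `&` [set t | 0 < (s - c1) / a + (- (b / a)) * t]
     `&` [set t | 0 < (1 - (s - c1) / a) + (b / a - 1) * t])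
    ([set t | 0 <= t <= 1] `&` [set t | 0 <= (s - c1) / a + (- (b / a)) * t]
     `&` [set t | 0 <= (1 - (s - c1) / a) + (b / a - 1) * t]).
    do 2 apply: interval_slice_cut; right; exists 0, 1; split => //.
  have N1 t : (s - b * t - c1) / a = (s - c1) / a + - (b / a) * t by ring.
  move=> [S0|[t1 [t2 [t12 S12 T12]]]].
    left=> t /imM /refTE; rewrite /N/= N1 => -[x1 x2 x12].
    by apply: (S0 t); split; [split|] => /=; [apply/andP; split; lra| |lra].
  right; exists t1, t2; split => // t.
    apply: (iff_trans _ (S12 t)); apply: (iff_trans (imM _ _)); apply: (iff_trans (refTE _)).
    rewrite /N/= N1; split=> [[x1 x2 x12]|[[/andP[x1 x2] x3] x4]].
      by split; [split|] => /=; [apply/andP; split; lra| |lra].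
    by move: x3 x4 => /= x3 x4; split => //; lra.
  move=> /T12[[/andP[x1 x2] x3] x4]; apply/imM/crefTE.
  by rewrite /N/= N1; move: x3 x4 => /= x3 x4; split => //; lra.
- move=> s t.
  apply: (@continuous_comp _ _ _ (fun t => (s, t)) (fun x : plane R => f' x.1 x.2)).
    by apply: (@cvg_pair _ _ _ _ (nbhs s) (nbhs t)); [exact: cvg_cst|exact: cvg_id].
  exact: cf'.
- by rewrite -im.
rewrite (linear_cov_image (d := `|a|))//; last 5 first.
- by have := @linear_cov_shear _ a b c1 a0.
- exact: can_inj MK.
- exact: open_measurable_plane.
- exact/measurable_EFinP.
- move=> [s t] /MTK /f'0 h; rewrite lee_fin; apply: mulr_ge0 => //; exact/ltW.
rewrite -ge0_integralZl//; last 3 first.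
- by apply: open_measurable_plane; exact: open_refT.
- apply/measurable_EFinP; apply: measurable_funM.
    apply: (within_continuous_measurable (K := crefT)) => //.
    + exact: open_refT.
    + exact: refT_sub_crefT.
    apply: (within_continuous_image_comp (f := M) (B := M @` crefT)) cgP => //.
    by apply: continuous_subspaceT; exact: continuous_isP2v.
  apply: (within_continuous_measurable (K := setT)) => //; first exact: open_refT.
  apply: continuous_subspaceT => x.
  apply: (@continuous_comp _ _ _ M (fun x : plane R => f' x.1 x.2)).
    exact: continuous_isP2v.
  exact: cf'.
- move=> x /refT_sub_crefT xT; rewrite lee_fin; apply: mulr_ge0; first exact: g0.
  by apply/ltW/f'0; exists x; rewrite -?surjective_pairing.
apply: eq_integral => x /set_mem/refT_sub_crefT xT.
rewrite -EFinM -[(_, f _ _)]/(Phi (M x)) PhiM; congr EFin; rewrite mulrCA; congr (_ * _).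
rewrite -f'E normrM; congr (_ * _); rewrite gtr0_norm//.
by apply: f'0; exists x; rewrite -?surjective_pairing.
Qed.
End bilinear_maps_core.

Section affine_compositions.
Context {R : realType}.
Implicit Types (x y z v : plane R) (D K : set (plane R)) (F M P : plane R -> plane R).

Lemma affine_isP2_comp (f : plane R -> R) P : isP2 f -> isP1v P ->
  isP2 (f \o P) /\ forall i x, pder i (f \o P) x =
    pder 0 f (P x) * pder i (crd 0 \o P) x + pder 1 f (P x) * pder i (crd 1 \o P) x.
Proof.
move=> f2 P1; have fP2 : isP2 (f \o P).
  have [a [b [c [d [e [g fE]]]]]] := f2.
  have [p0 [p1 [p2 pE]]] := P1 0; have [q0 [q1 [q2 qE]]] := P1 1.
  exists (a + b * p0 + c * q0 + d * p0 ^+ 2 + e * (p0 * q0) + g * q0 ^+ 2),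
    (b * p1 + c * q1 + 2 * d * p0 * p1 + e * (p0 * q1 + p1 * q0) + 2 * g * q0 * q1),
    (b * p2 + c * q2 + 2 * d * p0 * p2 + e * (p0 * q2 + p2 * q0) + 2 * g * q0 * q2),
    (d * p1 ^+ 2 + e * (p1 * q1) + g * q1 ^+ 2),
    (2 * d * p1 * p2 + e * (p1 * q2 + p2 * q1) + 2 * g * q1 * q2),
    (d * p2 ^+ 2 + e * (p2 * q2) + g * q2 ^+ 2) => x.
  rewrite /= fE -[(P x).1]/((crd 0 \o P) x) -[(P x).2]/((crd 1 \o P) x) pE qE; ring.
split => // i x; have P2 := isP1v_isP2v P1.
rewrite (pder_central _ _ fP2) (pder_central _ _ (P2 0)) (pder_central _ _ (P2 1)).
rewrite (pder_central _ _ f2) (pder_central _ _ f2).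
have [a [b [c [d [e [g fE]]]]]] := f2.
have [p0 [p1 [p2 pE]]] := P1 0; have [q0 [q1 [q2 qE]]] := P1 1.
rewrite !fE /= !fE.
have p1E y : (P y).1 = p0 + p1 * y.1 + p2 * y.2 by rewrite -pE.
have q1E y : (P y).2 = q0 + q1 * y.1 + q2 * y.2 by rewrite -qE.
rewrite /crd/= !p1E !q1E.
by rewrite /dir; case: ifP => _ /=; field.
Qed.

Lemma det_jac_source F P : isP2v F -> isP1v P -> isP2v (F \o P) /\
  forall x, \det (jac (F \o P) x) = \det (jac P x) * \det (jac F (P x)).
Proof.
move=> F2 P1; have FPi i := affine_isP2_comp (F2 i) P1.
split=> [i|x]; first by case: (FPi i).
have -> : \det (jac (F \o P) x) = pder 0 ((crd 0 \o F) \o P) x * pder 1 ((crd 1 \o F) \o P) x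
  - pder 1 ((crd 0 \o F) \o P) x * pder 0 ((crd 1 \o F) \o P) x by rewrite det_jac.
rewrite (FPi 0).2 (FPi 1).2 !(FPi 0).2 !(FPi 1).2 !det_jac.
have alg (a b c d a' b' c' d' : R) : (a * a' + b * c') * (c * b' + d * d')
    - (a * b' + b * d') * (c * a' + d * c') = (a' * d' - b' * c') * (a * d - b * c) by ring.
exact: alg.
Qed.

Lemma det_jac_target F M : isP2v F -> isP1v M -> isP2v (M \o F) /\
  forall x, \det (jac (M \o F) x) = \det (jac M (F x)) * \det (jac F x).
Proof.
move=> F2 M1.
have [p0 [p1 [p2 pE]]] := M1 0; have [q0 [q1 [q2 qE]]] := M1 1.
have MF2 : isP2v (M \o F).
  have [a [b [c [d [e [g fE]]]]]] := F2 0.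
  have [a' [b' [c' [d' [e' [g' fE']]]]]] := F2 1.
  apply: isP2v_pair.
    exists (p0 + p1 * a + p2 * a'), (p1 * b + p2 * b'), (p1 * c + p2 * c'),
      (p1 * d + p2 * d'), (p1 * e + p2 * e'), (p1 * g + p2 * g') => x /=.
    rewrite -[(M _).1]/((crd 0 \o M) (F x)) pE.
    rewrite -[(F x).1]/((crd 0 \o F) x) -[(F x).2]/((crd 1 \o F) x) fE fE'; ring.
  exists (q0 + q1 * a + q2 * a'), (q1 * b + q2 * b'), (q1 * c + q2 * c'),
    (q1 * d + q2 * d'), (q1 * e + q2 * e'), (q1 * g + q2 * g') => x /=.
  rewrite -[(M _).2]/((crd 1 \o M) (F x)) qE.
  rewrite -[(F x).1]/((crd 0 \o F) x) -[(F x).2]/((crd 1 \o F) x) fE fE'; ring.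
split => // x; rewrite !det_jac_central//; last exact: isP1v_isP2v.
have p1E y : (M y).1 = p0 + p1 * y.1 + p2 * y.2 by rewrite -pE.
have q1E y : (M y).2 = q0 + q1 * y.1 + q2 * y.2 by rewrite -qE.
by rewrite /= !p1E !q1E /dir/=; field.
Qed.

Definition swap x : plane R := (x.2, x.1).

Lemma isP1v_pair F : isP1 (fun x => (F x).1) -> isP1 (fun x => (F x).2) -> isP1v F.
Proof.
move=> F1 F2 i; have [->|i1] := eqVneq i 0; first exact: F1.
by have -> : i = 1 by case: i i1 => [[|[|]]] // lt2 _; apply/val_inj.
Qed.

Definition shear (a b d : R) x : plane R := (a * x.1 + b * x.2 + d, x.2).

Lemma isP1v_swap : isP1v swap.
Proof.
by apply: isP1v_pair; [exists 0, 0, 1|exists 0, 1, 0] => x; rewrite /swap/=; ring.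
Qed.

Lemma isP1v_shear a b d : isP1v (shear a b d).
Proof.
by apply: isP1v_pair; [exists d, a, b|exists 0, 0, 1] => x; rewrite /shear/=; ring.
Qed.

Lemma det_swap x : \det (jac swap x) = -1.
Proof.
by rewrite det_jac_central; [rewrite /swap /dir/=; field|exact/isP1v_isP2v/isP1v_swap].
Qed.

Lemma det_shear a b d x : \det (jac (shear a b d) x) = a.
Proof.
rewrite det_jac_central; first by rewrite /shear /dir/=; field.
exact/isP1v_isP2v/isP1v_shear.
Qed.

Lemma swap_inj : injective swap.
Proof. by move=> [a b] [c d] [-> ->]. Qed.

Lemma shear_inj a b d : a != 0 -> injective (shear a b d).
Proof.
move=> a0 [x1 x2] [y1 y2] [+ e]; rewrite e => /addIr /addIr /(mulfI a0) ->; by [].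
Qed.

Lemma swap_ref (T : set (plane R)) : T = refT \/ T = crefT -> swap @` T = T.
Proof.
case=> ->; apply/seteqP; split=> [_ [x /[swap] <-]|x].
- by move=> /refTE[? ? ?]; apply/refTE; split => //=; lra.
- by move=> /refTE[? ? ?]; exists (swap x); [apply/refTE; split => //=; lra|case: (x)].
- by move=> /crefTE[? ? ?]; apply/crefTE; split => //=; lra.
- by move=> /crefTE[? ? ?]; exists (swap x); [apply/crefTE; split => //=; lra|case: (x)].
Qed.

Lemma nondegenerate_target F M (d : R) : d != 0 -> isP1v M -> injective M ->
  (forall x, \det (jac M x) = d) -> nondegenerate F -> nondegenerate (M \o F).
Proof.
move=> d0 M1 injM dM nF; have [F2 _ _] := nF.
have [MF2 dMF] := det_jac_target F2 M1.
by apply: (nondegenerate_comp d0) => // x; rewrite dMF dM.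
Qed.

Lemma cov_affine_target F M (d : R) : d != 0 -> isP1v M -> injective M ->
  (forall x, \det (jac M x) = d) -> linear_cov M `|d| ->
  nondegenerate F -> cov F -> cov (M \o F).
Proof.
move=> d0 M1 injM dM lM nF; have [F2 _ _] := nF.
have [MF2 dMF] := det_jac_target F2 M1.
apply: (cov_target d0) => //; last by move=> x; rewrite dMF dM.
exact/continuous_isP2v/isP1v_isP2v.
Qed.

(** Allows a symmetry [P] of the reference triangle to be applied first, such as exchanging the
    coordinates or cycling the vertices. *)
Lemma cov_affine_source F P (d : R) : `|d| = 1 -> isP1v P -> injective P ->
  (forall x, \det (jac P x) = d) -> linear_cov P 1 ->
  P @` refT = refT -> P @` crefT = crefT ->
  nondegenerate F -> (nondegenerate (F \o P) -> cov (F \o P)) -> cov F.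
Proof.
move=> d1 P1 injP dP lP PT PcT nF cFP; have [F2 injF [e he]] := nF.
have [FP2 dFP] := det_jac_source F2 P1.
have d0 : d != 0 by rewrite -normr_gt0 d1.
have PcT' x : crefT x -> crefT (P x) by rewrite -[in X in _ -> X]PcT => xT; exists x.
apply: (cov_source d1 nF _ injP PT PcT _ lP).
- exact/continuous_isP2v/isP1v_isP2v.
- by move=> x; rewrite dFP dP.
apply: cFP; split => //.
  by move=> x y xT yT /injF xy; apply: injP; apply: xy; exact: PcT'.
exists (e / d) => x /PcT' /he; rewrite dFP dP mulrA divfK//.
Qed.

End affine_compositions.

Section bilinear_maps.
Context {R : realType}.
Implicit Types (x y z v : plane R) (D K : set (plane R)) (F M P : plane R -> plane R).

(** The reflection [(x.1, - x.2)], factored so that [linear_cov] follows by composition. *)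
Definition flip : plane R -> plane R := swap \o (shear (-1) 0 0 \o swap).

Lemma isP1v_comp F P : isP1v F -> isP1v P -> isP1v (F \o P).
Proof.
move=> F1 P1.
have [p0 [p1 [p2 pE]]] := P1 0; have [q0 [q1 [q2 qE]]] := P1 1.
move=> i; have [a [b [c fE]]] := F1 i.
exists (a + b * p0 + c * q0), (b * p1 + c * q1), (b * p2 + c * q2) => x.
rewrite -[(crd i \o (F \o P)) x]/((crd i \o F) (P x)) fE.
rewrite -[(P x).1]/((crd 0 \o P) x) -[(P x).2]/((crd 1 \o P) x) pE qE; ring.
Qed.

(** [cov_core] needs [a * det] to be positive. If it is negative, reflecting the second component
    makes it positive, and a second reflection restores [F]. *)
Lemma cov_bilinear_core (c1 c2 a b c d e : R)
    (F := fun x => (c1 + a * x.1 + b * x.2, c2 + c * x.1 + d * x.2 + e * (x.1 * x.2))) :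
  a != 0 -> nondegenerate F -> cov F.
Proof.
move=> a0 nF; have [_ _ [eps heps]] := nF.
have f1 : isP1v flip.
  apply: isP1v_comp; first exact: isP1v_swap.
  by apply: isP1v_comp; [exact: isP1v_shear|exact: isP1v_swap].
have fE x : flip x = (x.1, - x.2).
  by rewrite /flip/= /swap /shear/=; congr pair; ring.
have fi : injective flip.
  by move=> [x1 x2] [y1 y2]; rewrite !fE => -[-> /oppr_inj ->].
have df x : \det (jac flip x) = -1.
  by rewrite det_jac_central; [rewrite !fE /dir/=; field|exact: isP1v_isP2v].
have n10 : (-1 : R) != 0 by rewrite oppr_eq0 oner_eq0.
have lf : linear_cov flip `|-1|.
  rewrite -[`|_|]mul1r -[X in _ * X]mulr1; apply: linear_cov_comp.
    exact: linear_cov_swap.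
  by apply: linear_cov_comp; [exact: linear_cov_shear|exact: linear_cov_swap].
have [ae|ae] := ltP 0 (a * eps).
  apply: cov_core => // x /heps; rewrite -(pmulr_rgt0 _ ae) => h.
  have a2 : 0 < eps ^+ 2.
    by rewrite exprn_even_gt0//=; apply: contraTneq ae => ->; rewrite mulr0 ltxx.
  by rewrite -(pmulr_rgt0 _ a2); move: h; congr (0 < _); ring.
have ae0 : a * eps < 0.
  rewrite lt_neqAle ae andbT mulf_eq0 negb_or a0/=.
  have : 0 < eps * \det (jac F (0, 0)) by apply: heps; apply/crefTE; split => /=; lra.
  by apply: contraTneq => ->; rewrite mul0r ltxx.
have -> : F = flip \o (flip \o F).
  by apply/funext => x; rewrite /= !fE/= opprK.
have nfF : nondegenerate (flip \o F) by exact: nondegenerate_target df nF.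
apply: (cov_affine_target n10 f1 fi df lf nfF).
have fFE : flip \o F = (fun x => (c1 + a * x.1 + b * x.2,
    - c2 + - c * x.1 + - d * x.2 + - e * (x.1 * x.2))).
  by apply/funext => x; rewrite /= fE /F/=; congr pair; ring.
rewrite fFE in nfF *; apply: cov_core => // x /heps; rewrite -fFE.
have [F2 _ _] := nF; have [_ ->] := det_jac_target F2 f1; rewrite df => h.
have : 0 < - (a * eps) * (eps * \det (jac F x)) by rewrite mulr_gt0// oppr_gt0.
have a2 : 0 < eps ^+ 2.
  by rewrite exprn_even_gt0//=; apply: contraTneq ae0 => ->; rewrite mulr0 ltxx.
by rewrite -(pmulr_rgt0 (a * _) a2); congr (0 < _); ring.
Qed.

(** If [a = 0], exchanging the reference coordinates puts [b] in its place; both cannot vanish,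
    since the determinant would. *)
Lemma cov_bilinear_vertical (c1 c2 a b c d e : R)
    (F := fun x => (c1 + a * x.1 + b * x.2, c2 + c * x.1 + d * x.2 + e * (x.1 * x.2))) :
  nondegenerate F -> cov F.
Proof.
move=> nF; have [a0|] := eqVneq a 0; last by move=> a0; exact: cov_bilinear_core.
apply: (@cov_affine_source _ F swap (-1)) => //.
- by rewrite normrN1.
- exact: isP1v_swap.
- exact: swap_inj.
- exact: det_swap.
- exact: linear_cov_swap.
- by apply: swap_ref; left.
- by apply: swap_ref; right.
have -> : F \o swap = (fun x => (c1 + b * x.1 + a * x.2, c2 + d * x.1 + c * x.2 + e * (x.1 * x.2))).
  by apply/funext => x; rewrite /F /swap/=; congr pair; ring.
move=> nFs; apply: cov_bilinear_core nFs.
have [F2 _ [eps heps]] := nF.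
have : 0 < eps * \det (jac F (0, 0)) by apply: heps; apply/crefTE; split => /=; lra.
rewrite det_jac_central// /F /dir/= a0; apply: contraTneq => ->.
by rewrite -leNgt le_eqVlt; apply/orP; left; apply/eqP; field.
Qed.

(** The product term is removed from the first component by an affine change of the target: the
    components are exchanged if [e2 = 0], and otherwise [e1 / e2] times the second is subtracted
    from the first. *)
Lemma cov_bilinear (c1 c2 a b c d e1 e2 : R)
    (F := fun x => (c1 + a * x.1 + b * x.2 + e1 * (x.1 * x.2), c2 + c * x.1 + d * x.2 + e2 * (x.1 * x.2))) :
  nondegenerate F -> cov F.
Proof.
move=> nF; have [e20|e20] := eqVneq e2 0.
  have FE : F = swap \o (swap \o F) by apply/funext.
  have n10 : (-1 : R) != 0 by rewrite oppr_eq0 oner_eq0.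
  have nsF := nondegenerate_target n10 isP1v_swap (@swap_inj R) (@det_swap R) nF.
  rewrite FE; apply: (cov_affine_target n10 isP1v_swap (@swap_inj R) (@det_swap R) _ nsF).
    by rewrite normrN1; exact: linear_cov_swap.
  have sFE : swap \o F = (fun x => (c2 + c * x.1 + d * x.2, c1 + a * x.1 + b * x.2 + e1 * (x.1 * x.2))).
    by apply/funext => x; rewrite /F /swap/= e20; congr pair; ring.
  by rewrite sFE in nsF *; exact: cov_bilinear_vertical nsF.
pose k := e1 / e2.
have shi l := @shear_inj R 1 l 0 (oner_neq0 _).
have nsF := nondegenerate_target (oner_neq0 _) (isP1v_shear 1 (- k) 0) (shi _)
  (det_shear 1 (- k) 0) nF.
have -> : F = shear 1 k 0 \o (shear 1 (- k) 0 \o F).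
  by apply/funext => x; rewrite /F /shear/=; congr pair; ring.
apply: (cov_affine_target (oner_neq0 _) (isP1v_shear 1 k 0) (shi _) (det_shear 1 k 0) _ nsF).
  by apply: linear_cov_shear; exact: oner_neq0.
have sFE : shear 1 (- k) 0 \o F = (fun x =>
    (c1 - k * c2 + (a - k * c) * x.1 + (b - k * d) * x.2, c2 + c * x.1 + d * x.2 + e2 * (x.1 * x.2))).
  by apply/funext => x; rewrite /F /shear/= /k; congr pair; field.
by rewrite sFE in nsF *; exact: cov_bilinear_vertical nsF.
Qed.

(** The affine symmetry sending [rvtx 0] to [rvtx 1], [rvtx 1] to [rvtx 2] and [rvtx 2] to [rvtx 0];
    composing with its [i]-th iterate moves corner [i] to the origin. *)
Definition rotate1 x : plane R := (1 - x.1 - x.2, x.1).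

Lemma rotate1_ref (T : set (plane R)) : T = refT \/ T = crefT -> rotate1 @` T = T.
Proof.
case=> ->; apply/seteqP; split=> [_ [x /[swap] <-]|x].
- by move=> /refTE[? ? ?]; apply/refTE; split => //=; lra.
- move=> /refTE[? ? ?]; exists (x.2, 1 - x.1 - x.2).
    by apply/refTE; split => //=; lra.
  by rewrite /rotate1/= [RHS]surjective_pairing; congr pair; ring.
- by move=> /crefTE[? ? ?]; apply/crefTE; split => //=; lra.
- move=> /crefTE[? ? ?]; exists (x.2, 1 - x.1 - x.2).
    by apply/crefTE; split => //=; lra.
  by rewrite /rotate1/= [RHS]surjective_pairing; congr pair; ring.
Qed.

Lemma isP1v_rotate1 : isP1v rotate1.
Proof.
by apply: isP1v_pair; [exists 1, (-1), (-1)|exists 0, 1, 0] => x; rewrite /rotate1/=; ring.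
Qed.

Lemma rotate1_inj : injective rotate1.
Proof. by move=> [x1 x2] [y1 y2] [/= e1 e2]; congr pair; lra. Qed.

Lemma det_rotate1 x : \det (jac rotate1 x) = 1.
Proof.
by rewrite det_jac_central; [rewrite /rotate1 /dir/=; field|exact/isP1v_isP2v/isP1v_rotate1].
Qed.

Lemma cov_rotate1 F : nondegenerate F ->
  (nondegenerate (F \o rotate1) -> cov (F \o rotate1)) -> cov F.
Proof.
move=> nF; apply: (@cov_affine_source _ F rotate1 1) nF.
- by rewrite normr1.
- exact: isP1v_rotate1.
- exact: rotate1_inj.
- exact: det_rotate1.
- have -> : rotate1 = shear (-1) (-1) 1 \o swap.
    by apply/funext => x; rewrite /rotate1 /shear /swap/=; congr pair; ring.
  have n10 : (-1 : R) != 0 by rewrite oppr_eq0 oner_eq0.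
  by have := linear_cov_comp (linear_cov_shear (-1) 1 n10) linear_cov_swap; rewrite normrN1 mulr1.
- by apply: rotate1_ref; left.
- by apply: rotate1_ref; right.
Qed.

End bilinear_maps.

(** * Integrals of polynomials over the reference triangle *)

Section reference_integrals.
Context {R : realType}.
Implicit Types (x y z v : plane R) (D K : set (plane R)) (F M P : plane R -> plane R).
Notation mplane := (measurableTypeR R * measurableTypeR R)%type.

Definition bilinear F := exists c1 c2 a b c d e1 e2 : R, forall x,
  F x = (c1 + a * x.1 + b * x.2 + e1 * (x.1 * x.2),
         c2 + c * x.1 + d * x.2 + e2 * (x.1 * x.2)).

Lemma cov_chart F n : nondegenerate F -> bilinear (F \o iter n rotate1) -> cov F.
Proof.
elim: n F => [|n IH] F nF.
  move=> [c1 [c2 [a [b [c [d [e1 [e2 FE]]]]]]]]; 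
  have FE' : F = _ := funext FE.
  by rewrite FE' in nF *; exact: cov_bilinear nF.
move=> bF; apply: cov_rotate1 => // nFr; apply: IH => //.
Qed.

Lemma leb2_refT : (leb2 (refT : set mplane) < +oo)%E.
Proof.
have sub : (refT : set mplane) `<=` [set` `[0 : R, 1]] `*` [set` `[0 : R, 1]].
  by move=> x /refTE[? ? ?]; split; rewrite /= in_itv/=; apply/andP; split; lra.
have m01 : measurable ([set` `[0 : R, 1]] : set (measurableTypeR R)) by exact: measurable_itv.
have E : (leb2 ([set` `[0%R : R, 1%R]] `*` [set` `[0%R : R, 1%R]] : set mplane) < +oo)%E.
  have /= := product_measure1E (@lebesgue_measure R) (@lebesgue_measure R) m01 m01.
  rewrite /leb2 => ->; rewrite lebesgue_measure_itv/= lte_fin ltr01.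
  by rewrite -EFinB subr0 mule1 ltry.
apply: (le_lt_trans _ E); apply: le_measure => //; rewrite inE.
  by apply: open_measurable_plane; exact: open_refT.
exact: measurableX.
Qed.

Lemma integrable_refT (h : plane R -> R) : {within crefT, continuous h} ->
  leb2.-integrable (refT : set mplane) (EFin \o h).
Proof.
move=> ch.
have mT : measurable (refT : set mplane) by apply: open_measurable_plane; exact: open_refT.
apply: measurable_bounded_integrable => //; first exact: leb2_refT.
  exact: (within_continuous_measurable open_refT (@refT_sub_crefT R)).
have : bounded_set (h @` crefT).
  by apply: compact_bounded; apply: continuous_compact => //; exact: compact_crefT.
move=> [M [Mr HM]]; exists M; split => // B MB x /refT_sub_crefT xT.
by apply: (HM _ MB); exists x.
Qed.

Lemma integral_cubic (a b c d w : R) : 0 < w ->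
  (\int[@lebesgue_measure R]_(t in [set` `]0%R, w[]) (a + b * t + c * t ^+ 2 + d * t ^+ 3)%:E
   = (a * w + b * w ^+ 2 / 2 + c * w ^+ 3 / 3 + d * w ^+ 4 / 4)%:E)%E.
Proof.
move=> w0.
pose p : {poly R} := a *: 'X + (b / 2) *: 'X^2 + (c / 3) *: 'X^3 + (d / 4) *: 'X^4.
have pE t : p.[t] = a * t + b * t ^+ 2 / 2 + c * t ^+ 3 / 3 + d * t ^+ 4 / 4.
  by rewrite /p !hornerE/=; field.
have dpE t : p^`().[t] = a + b * t + c * t ^+ 2 + d * t ^+ 3.
  rewrite /p !derivD !derivZ derivX !derivXn !hornerE/= ?hornerMn ?hornerE/=.
  by field.
have cp : continuous (fun t => a + b * t + c * t ^+ 2 + d * t ^+ 3).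
  by under eq_fun do rewrite -dpE; exact: continuous_horner.
rewrite -(@integral_itv_bndoo _ _ _ _ true false); last first.
  by apply/measurable_EFinP; apply: measurable_funTS; exact: continuous_measurable_fun.
rewrite (@continuous_FTC2 _ _ (horner p))//.
- by rewrite !pE; congr EFin; field.
- exact: continuous_subspaceT.
- split.
  + by move=> t _; exact: derivable_horner.
  + by apply: cvg_at_right_filter; exact: continuous_horner.
  + by apply: cvg_at_left_filter; exact: continuous_horner.
- by move=> t _; rewrite derive1E derive_val dpE.
Qed.

Lemma integral_refT_quadratic (a b c d e g : R) :
  (\int[leb2]_(x in refT) (a + b * x.1 + c * x.2
        + d * x.1 ^+ 2 + e * (x.1 * x.2) + g * x.2 ^+ 2)%:E =
   (a / 2 + b / 6 + c / 6 + d / 12 + e / 24 + g / 12)%:E)%E.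
Proof.
pose f x := a + b * x.1 + c * x.2 + d * x.1 ^+ 2 + e * (x.1 * x.2) + g * x.2 ^+ 2.
have cf : continuous f by apply: continuous_isP2; exists a, b, c, d, e, g.
have mT : measurable (refT : set mplane) by apply: open_measurable_plane; exact: open_refT.
have If := integrable_refT (continuous_subspaceT cf).
rewrite -[LHS]/(\int[leb2]_(x in refT) (EFin \o f) x)%E integral_mkcond.
rewrite -integral12_prod_meas1; last exact/(integrable_mkcond _ mT).
(* The integrand is the inner integral over a slice of length [1 - t], expanded in powers of [t]. *)
transitivity (\int[@lebesgue_measure R]_(t in [set` `]0%R, 1%R[]) (a + c / 2 + g / 3
    + (b - a + e / 2 - c - g) * t
    + (d - b + c / 2 - e + g) * t ^+ 2 + (- d + e / 2 - g / 3) * t ^+ 3)%:E)%E; last first.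
  by rewrite integral_cubic//; congr EFin; field.
rewrite [RHS]integral_mkcond; apply: eq_integral => s _; rewrite /fubini_F patchE.
case: ifPn => [|/negP]; rewrite inE/= in_itv/= => s01.
  move/andP: s01 => [s0 s1].
  transitivity (\int[@lebesgue_measure R]_(t in [set` `]0%R, (1 - s)%R[])
      (a + b * s + d * s ^+ 2 + (c + e * s) * t + g * t ^+ 2 + 0 * t ^+ 3)%:E)%E.
    rewrite [RHS]integral_mkcond; apply: eq_integral => t _; rewrite !patchE.
    have -> : ((s, t) \in (refT : set mplane)) = (t \in [set` `]0%R, 1 - s[]).
      apply/idP/idP; rewrite !inE/= in_itv/=.
        by move=> /refTE/=[? ? ?]; apply/andP; split; lra.
      by move=> /andP[? ?]; apply/refTE; split => /=; lra.
    by case: ifP => // _; congr EFin; rewrite /f/=; ring.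
  rewrite integral_cubic; last by lra.
  by congr EFin; field.
rewrite integral0_eq// => t _; rewrite patchE memNset// => /refTE/=[? ? ?].
by apply: s01; apply/andP; split; lra.
Qed.

End reference_integrals.

Section chart_integrals.
Context {R : realType}.
Implicit Types (x y z v : plane R) (D K : set (plane R)) (F M P : plane R -> plane R).
Notation mplane := (measurableTypeR R * measurableTypeR R)%type.

(** A pointwise choice of preimages; its continuity on the closed element comes from compactness of
    [crefT]. *)
Definition refinv F y : plane R := xget (0, 0) [set x | crefT x /\ F x = y].

Lemma refinvK F x : nondegenerate F -> crefT x -> refinv F (F x) = x.
Proof.
move=> [_ injF _] xT; rewrite /refinv; case: xgetP => [y _ [yT Fyx]|/(_ x)].
  exact: injF.
by case.
Qed.

Lemma within_continuous_refinv F : nondegenerate F ->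
  {within F @` crefT, continuous (refinv F)}.
Proof.
move=> nF; apply: within_continuous_inverse; first exact: compact_crefT.
  by apply: continuous_isP2v; case: nF.
by move=> x; exact: refinvK.
Qed.

(** [g] is only controlled on the open element, while [cov] asks for continuity up to the boundary:
    [h \o refinv F] is the required extension. Applying [cov] to [|g|] gives integrability, and
    applying it to the positive and negative parts gives the formula. *)
Lemma chart_integral F (g h : plane R -> R) : nondegenerate F -> cov F ->
  (forall x, crefT x -> 0 < \det (jac F x)) ->
  {within crefT, continuous h} -> (forall x, refT x -> g (F x) = h x) ->
  [/\ measurable_fun (F @` refT : set mplane) g,
    leb2.-integrable (F @` refT : set mplane) (EFin \o g)
  & (\int[leb2]_(y in F @` refT) (g y)%:E =
     \int[leb2]_(x in refT) (h x * \det (jac F x))%:E)%E].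
Proof.
move=> nF covF dF ch gF; pose g' := h \o refinv F.
have FT : F @` refT `<=` F @` crefT by apply: image_subset; exact: refT_sub_crefT.
have F2 : isP2v F by case: nF.
have cg' : {within F @` crefT, continuous g'}.
  apply: (within_continuous_image_comp (B := crefT)) ch.
    exact: within_continuous_refinv.
  by move=> _ [_ [x xT <-] <-]; rewrite refinvK.
have g'F x : crefT x -> g' (F x) = h x by move=> xT; rewrite /g'/= refinvK.
have gg' y : (F @` refT) y -> g y = g' y.
  by move=> [x xT <-]; rewrite gF// g'F//; exact: refT_sub_crefT.
have oFT := nondegenerate_open nF.
have mFT := open_measurable_plane oFT.
have mT : measurable (refT : set mplane) by apply: open_measurable_plane; exact: open_refT.
have mg : measurable_fun (F @` refT : set mplane) g.
  apply: (eq_measurable_fun g'); first by move=> y /set_mem/gg' ->.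
  exact: (within_continuous_measurable oFT FT).
have cdet : continuous (fun x => \det (jac F x)).
  move=> x; under [fun _ => \det _]funext do rewrite det_jac.
  by apply: cvgB; apply: cvgM; apply: continuous_isP2; apply/isP1_isP2/isP1_pder.
have covp (k : R -> R) : continuous k -> (forall t, 0 <= k t) ->
  (\int[leb2]_(y in F @` refT) (k (g y))%:E =
   \int[leb2]_(x in refT) (k (h x) * \det (jac F x))%:E)%E.
  move=> ck k0; transitivity (\int[leb2]_(y in F @` refT) ((k \o g') y)%:E)%E.
    by apply: eq_integral => y /set_mem/gg' ->.
  rewrite (covF (k \o g'))//; last 2 first.
  - by move=> x /=.
  - apply: (within_continuous_image_comp (B := setT)) cg' _ _ => //.
    exact: continuous_subspaceT.
  apply: eq_integral => x /set_mem/refT_sub_crefT xT.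
  by rewrite -[(k \o g') _]/(k (g' (F x))) g'F// gtr0_norm// dF.
split => //.
  apply/integrableP; split; first exact/measurable_EFinP.
  rewrite [ltLHS](_ : _ = (\int[leb2]_(y in F @` refT) (`|g y|)%:E)%E); last by [].
  rewrite (covp (fun t : R => `|t|))//; last exact: norm_continuous.
  have : {within crefT, continuous (fun x => `|h x| * \det (jac F x))}.
    move=> x; apply: cvgM; first by apply: cvg_norm; exact: ch.
    exact: (continuous_subspaceT cdet).
  move=> /integrable_refT /integrableP[_].
  rewrite [X in (X < _)%E -> _](_ : _ = (\int[leb2]_(x in refT) (`|h x| * \det (jac F x))%:E)%E)//.
  apply: eq_integral => x /set_mem/refT_sub_crefT xT /=.
  by rewrite ger0_norm// mulr_ge0// ltW// dF.
have cmax0 : continuous (fun t : R => Num.max t 0).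
  by move=> t; apply: continuous_max => //; exact: cvg_cst.
have cmaxN0 : continuous (fun t : R => Num.max (- t) 0).
  by move=> t; apply: continuous_max => //; [exact: cvgN|exact: cvg_cst].
rewrite integralE [RHS]integralE; congr (_ - _)%E.
  transitivity (\int[leb2]_(y in F @` refT) (Num.max (g y) 0)%:E)%E.
    by apply: eq_integral => y _; rewrite funeposE EFin_max.
  rewrite (covp (fun t => Num.max t 0))//; last by move=> t; rewrite le_max lexx orbT.
  apply: eq_integral => x /set_mem/refT_sub_crefT xT.
  by rewrite funeposE -EFin_max maxr_pMl ?mul0r// ltW// dF.
transitivity (\int[leb2]_(y in F @` refT) (Num.max (- g y) 0)%:E)%E.
  by apply: eq_integral => y _; rewrite funenegE EFin_max.
rewrite (covp (fun t => Num.max (- t) 0))//; last by move=> t; rewrite le_max lexx orbT.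
apply: eq_integral => x /set_mem/refT_sub_crefT xT.
by rewrite funenegE -EFinN -EFin_max -mulNr maxr_pMl ?mul0r// ltW// dF.
Qed.

End chart_integrals.

(** * Divergence of the Piola transform *)

Section piola_divergence.
Context {R : realType}.
Implicit Types (x y z v : plane R) (D K : set (plane R)) (F M P : plane R -> plane R).

(** Carathéodory's criterion, with slope function [psi]. *)
Lemma is_derive_slope (phi psi : R -> R) (l : R) :
  (\forall h \near (0 : R), phi h - phi 0 = h * psi h) -> psi @ (0 : R) --> l ->
  is_derive (0 : R) (1 : R) phi l.
Proof.
move=> phipsi cpsi.
suff cv : (fun h => h^-1 *: ((phi \o shift 0) (h *: (1 : R)) - phi 0)) @ (0 : R)^' --> l.
  by split; [apply/cvg_ex; exists l|exact: cvg_lim].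
apply: (@cvg_trans _ (psi @ (0 : R)^')); last first.
  by apply: cvg_trans cpsi; apply: cvg_app; exact: cvg_within.
apply: near_eq_cvg; near=> h.
have h0 : h != 0 by near: h; exact: nbhs_dnbhs_neq.
rewrite /= addr0 [h *: 1]mulr1 (_ : phi h - phi 0 = h * psi h); last first.
  by near: h; apply: cvg_within.
by rewrite [_ *: _]mulrA mulVf ?mul1r.
Unshelve. all: by end_near. Qed.

Lemma cvg_line v y : (fun h : R => h *: v + y) @ (0 : R) --> y.
Proof.
have : {for (0 : R), continuous (fun h : R => h *: v + y)}.
  by apply: cvgD; [apply: cvgZr_tmp; exact: cvg_id|exact: cvg_cst].
by move=> h; rewrite -[X in _ --> X]add0r -(scale0r v).
Qed.

(* Entry [k] of column [j] of the inverse of the Jacobian matrix. *)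
Definition jac_inv F (j k : 'I_2) x : R := (if k == 0 then
    pder 1 (crd 1 \o F) x * (dir j).1 - pder 1 (crd 0 \o F) x * (dir j).2
  else pder 0 (crd 0 \o F) x * (dir j).2 - pder 0 (crd 1 \o F) x * (dir j).1)
  / \det (jac F x).

Section curve.
Variables (F : plane R -> plane R) (x0 : plane R) (j : 'I_2).
Hypotheses (nF : nondegenerate F) (x0T : refT x0).

(** The curve in reference coordinates above the line through [F x0] in direction [j]. Partial
    derivatives on the element are derivatives along it at 0. *)
Let xi (h : R) := refinv F (h *: dir j + F x0).

Let xi0 : xi 0 = x0.
Proof.
by rewrite /xi scale0r add0r refinvK//; exact: refT_sub_crefT.
Qed.

Lemma near_refinv : \forall h \near (0 : R), refT (xi h) /\ F (xi h) = h *: dir j + F x0.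
Proof.
have : nbhs (F x0) (F @` refT).
  by apply: open_nbhs_nbhs; split; [exact: nondegenerate_open|exists x0].
have cl := @cvg_line (dir j) (F x0).
move=> /cl; apply: (@filterS _ _ _ ((fun h : R => h *: dir j + F x0) @^-1` (F @` refT))).
move=> h [x xT Fx]; rewrite /xi -Fx refinvK//.
exact: refT_sub_crefT.
Qed.

Let cvg_xi : xi @ (0 : R) --> x0.
Proof.
have oF := nondegenerate_open nF.
have FT : F @` refT `<=` F @` crefT by apply: image_subset; exact: refT_sub_crefT.
have := continuous_subspaceW FT (within_continuous_refinv nF).
rewrite continuous_open_subspace// => /(_ (F x0)).
rewrite inE => /(_ (ex_intro2 _ _ x0 x0T erefl)) ci.
have cl := @cvg_line (dir j) (F x0).
have {}ci : refinv F @ F x0 --> x0.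
  by rewrite -[X in _ --> X](refinvK nF (refT_sub_crefT x0T)).
exact: cvg_comp cl ci.
Qed.

Let m (h : R) := midpt (xi h) x0.

Let cvg_m (f : plane R -> R) : isP2 f -> (fun h => f (m h)) @ (0 : R) --> f x0.
Proof.
move=> f2; have cm : m @ (0 : R) --> x0.
  have E : midpt x0 x0 = x0.
    by case: x0 => a b; rewrite /midpt /=; congr pair; rewrite /= /GRing.scale/=; field.
  rewrite -[X in _ --> X]E /m /midpt.
  by apply: cvgZl_tmp; apply: cvgD; [exact: cvg_xi|exact: cvg_cst].
by apply: cvg_comp cm _; exact: continuous_isP2.
Qed.

Let q (k : 'I_2) (h : R) := jac_inv F j k (m h).

Let q0 (k : 'I_2) := jac_inv F j k x0.

Let F2 i : isP2 (crd i \o F). Proof. by case: nF => F2 _ _; exact: F2. Qed.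

Let dF2 i k : isP2 (pder i (crd k \o F)).
Proof. by apply/isP1_isP2/isP1_pder. Qed.

Let cvg_q k : q k @ (0 : R) --> q0 k.
Proof.
rewrite /q /q0 /jac_inv; apply: cvgM.
  rewrite /=; case: (k == 0); apply: cvgB; apply: cvgM; try exact: cvg_cst; exact: (cvg_m (dF2 _ _)).
apply: cvgV; first by apply: nondegenerate_det => //; exact: refT_sub_crefT.
under [fun _ => \det _]funext do rewrite det_jac; rewrite det_jac.
by apply: cvgB; apply: cvgM; exact: (cvg_m (dF2 _ _)).
Qed.

(** By the midpoint rule, the displacement [xi h - x0] solves exactly a linear system whose matrix
    is the Jacobian at the midpoint [m h], which lies in the triangle by convexity. Cramer's rule
    gives the slopes [q k h], and these converge because [m h] tends to [x0]. *)
Lemma is_derive_refinv (f : plane R -> R) : isP2 f ->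
  is_derive (0 : R) (1 : R) (fun h => f (xi h)) (pder 0 f x0 * q0 0 + pder 1 f x0 * q0 1).
Proof.
move=> f2; have df2 i : isP2 (pder i f) by apply/isP1_isP2/isP1_pder.
apply: (@is_derive_slope _ (fun h => pder 0 f (m h) * q 0 h + pder 1 f (m h) * q 1 h)); last first.
  by apply: cvgD; apply: cvgM; [exact: cvg_m|exact: cvg_q|exact: cvg_m|exact: cvg_q].
move: near_refinv; apply: filterS => h [xT Fxi].
rewrite xi0 (isP2_midpoint_rule f2) -/(m h).
have mT : crefT (m h).
  move: xT x0T => /refTE[x1 x2 x12] /refTE[y1 y2 y12].
  by rewrite /m /midpt; apply/crefTE; rewrite /= /GRing.scale/=; split; lra.
have d0 := nondegenerate_det nF mT.
have E (k : 'I_2) : h * crd k (dir j) =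
    pder 0 (crd k \o F) (m h) * ((xi h).1 - x0.1) + pder 1 (crd k \o F) (m h) * ((xi h).2 - x0.2).
  rewrite -(isP2_midpoint_rule (F2 k)) /= Fxi.
  by rewrite /crd; case: ifP => _ /=; rewrite addrK.
have alg0 (a b c d X Y : R) :
  X * (a * d - b * c) = d * (a * X + b * Y) - b * (c * X + d * Y) by ring.
have alg1 (a b c d X Y : R) :
  Y * (a * d - b * c) = a * (c * X + d * Y) - c * (a * X + b * Y) by ring.
have E0 : h * (dir j).1 = _ := E 0; have E1 : h * (dir j).2 = _ := E 1.
have -> : (xi h).1 - x0.1 = h * q 0 h.
  rewrite /q /jac_inv eqxx; apply: (mulIf d0); rewrite -mulrA divfK// mulrBr !(mulrCA h) E0 E1 det_jac.
  exact: alg0.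
have -> : (xi h).2 - x0.2 = h * q 1 h.
  rewrite /q /jac_inv /=; apply: (mulIf d0); rewrite -mulrA divfK// mulrBr !(mulrCA h) E0 E1 det_jac.
  exact: alg1.
by rewrite mulrDr !(mulrCA h).
Qed.

End curve.

Lemma crd_mxv_piola F x y (i : 'I_2) : crd i (mxv (piola F x) y) =
  (pder 0 (crd i \o F) x * y.1 + pder 1 (crd i \o F) x * y.2) / \det (jac F x).
Proof.
have alg (d a b s t : R) : d * a * s + d * b * t = (a * s + b * t) * d by ring.
have [->|i1] := eqVneq i 0; first by rewrite /crd/= !mxE; exact: alg.
have -> : i = 1 by case: i i1 => [[|[|]]] // lt2 _; apply/val_inj.
by rewrite /crd/= !mxE; exact: alg.
Qed.

Lemma divergE (u : plane R -> plane R) x :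
  diverg u x = pder 0 (crd 0 \o u) x + pder 1 (crd 1 \o u) x.
Proof.
rewrite /diverg big_ord_recl big_ord1; congr (_ + _).
Qed.

(** The component [i] of [u] is [N i / J] along each curve [xi j]. After differentiating, the terms
    that contain [vh] without derivative cancel by the symmetry of the second derivatives of [F]. *)
Lemma diverg_piola F (u vh : plane R -> plane R) x : nondegenerate F -> isP2v vh ->
  (forall x, refT x -> u (F x) = mxv (piola F x) (vh x)) -> refT x ->
  diverg u (F x) = diverg vh x / \det (jac F x).
Proof.
move=> nF vh2 uF xT.
have F2 i : isP2 (crd i \o F) by case: nF => F2 _ _; exact: F2.
have dF2 i k : isP2 (pder i (crd k \o F)) by apply/isP1_isP2/isP1_pder.
have d0 : \det (jac F x) != 0 by apply: nondegenerate_det => //; exact: refT_sub_crefT.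
pose D i k := pder k (crd i \o F); pose v k := crd k \o vh.
have D2 i k : isP2 (D i k) by exact: dF2.
have v2 k : isP2 (v k) by exact: vh2.
pose xi j h := refinv F (h *: dir j + F x).
have dE y : \det (jac F y) = D 0 0 y * D 1 1 y - D 0 1 y * D 1 0 y by rewrite det_jac.
have xi0 j : xi j 0 = x by rewrite /xi scale0r add0r refinvK//; exact: refT_sub_crefT.
pose N i y := D i 0 y * v 0 y + D i 1 y * v 1 y.
pose J y := D 0 0 y * D 1 1 y - D 0 1 y * D 1 0 y.
pose d (f : plane R -> R) j := pder 0 f x * jac_inv F j 0 x + pder 1 f x * jac_inv F j 1 x.
pose dN i j y := D i 0 y * d (v 0) j + v 0 y * d (D i 0) j + (D i 1 y * d (v 1) j + v 1 y * d (D i 1) j).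
pose dJ j y := D 0 0 y * d (D 1 1) j + D 1 1 y * d (D 0 0) j - (D 0 1 y * d (D 1 0) j + D 1 0 y * d (D 0 1) j).
have uE i j : is_derive (F x) (dir j) (crd i \o u)
    (N i x * (- J x ^- 2 * dJ j x) + (J x)^-1 * dN i j x).
  apply: is_derive_line.
  apply: (@near_eq_is_derive _ _ _ (fun h => N i (xi j h) * (J (xi j h))^-1)).
    have := near_refinv j nF xT; apply: filterS => h [xiT Fxi].
    by rewrite /= -Fxi uF// crd_mxv_piola dE.
  have DD k l := is_derive_refinv j nF xT (D2 k l).
  have Dv k := is_derive_refinv j nF xT (v2 k).
  have dNi := is_deriveD (is_deriveM (DD i 0) (Dv 0)) (is_deriveM (DD i 1) (Dv 1)).
  have dJi := is_deriveB (is_deriveM (DD 0 0) (DD 1 1)) (is_deriveM (DD 0 1) (DD 1 0)).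
  have J0 : J (xi j 0) != 0 by rewrite xi0 /J -dE.
  have : is_derive (0 : R) (1 : R) (fun h => N i (xi j h) * (J (xi j h))^-1)
    (N i (xi j 0) * (- J (xi j 0) ^- 2 * dJ j (xi j 0)) + (J (xi j 0))^-1 * dN i j (xi j 0)).
    exact: is_deriveM dNi (is_deriveV (f := fun h => J (xi j h)) J0 dJi).
  by rewrite xi0.
have dvh : diverg vh x = pder 0 (v 0) x + pder 1 (v 1) x by exact: divergE.
rewrite divergE dvh [pder 0 (crd 0 \o u) _]derive_val [pder 1 (crd 1 \o u) _]derive_val.
have q00 : jac_inv F 0 0 x = D 1 1 x / J x by rewrite /jac_inv dE /= mulr1 mulr0 subr0.
have q01 : jac_inv F 0 1 x = - D 1 0 x / J x by rewrite /jac_inv dE /= mulr1 mulr0 sub0r.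
have q10 : jac_inv F 1 0 x = - D 0 1 x / J x by rewrite /jac_inv dE /= mulr1 mulr0 sub0r.
have q11 : jac_inv F 1 1 x = D 0 0 x / J x by rewrite /jac_inv dE /= mulr1 mulr0 subr0.
rewrite /N /dN /dJ /d q00 q01 q10 q11 dE -/(J x).
have J0 : J x != 0 by rewrite /J -dE.
have HE i : pder 0 (D i 1) x = pder 1 (D i 0) x by rewrite /D pder_comm.
move: HE J0; rewrite /J; clear -d; clear d; clearbody D v.
move=> /[dup] /(_ 0) -> /(_ 1) ->.
move: (pder 0 (v 0) x) (pder 1 (v 0) x) (pder 0 (v 1) x) (pder 1 (v 1) x).
move: (pder 0 (D 0 0) x) (pder 1 (D 0 0) x) (pder 1 (D 0 1) x).
move: (pder 0 (D 1 0) x) (pder 1 (D 1 0) x) (pder 1 (D 1 1) x).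
move: (D 0 0 x) (D 0 1 x) (D 1 0 x) (D 1 1 x) (v 0 x) (v 1 x).
by clear=> *; field.
Qed.

End piola_divergence.

(** * Triangles and meshes *)

Section triangles.
Context {R : realType}.
Implicit Types (x y z p q c : plane R) (v : 'I_3 -> plane R) (F : plane R -> plane R).

Definition cross x y : R := x.1 * y.2 - x.2 * y.1.

Lemma affTE v x : affT v x = (1 - x.1 - x.2) *: v 0 + x.1 *: v 1 + x.2 *: v 2%R.
Proof.
rewrite /affT !big_ord_recl big_ord0 addr0 addrA.
congr (_ + _ *: v _ + _ *: v _); exact/val_inj.
Qed.

Lemma affT1 v x : (affT v x).1 = (1 - x.1 - x.2) * (v 0).1 + x.1 * (v 1).1 + x.2 * (v 2%R).1.
Proof. by rewrite affTE. Qed.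

Lemma affT2 v x : (affT v x).2 = (1 - x.1 - x.2) * (v 0).2 + x.1 * (v 1).2 + x.2 * (v 2%R).2.
Proof. by rewrite affTE. Qed.

Lemma isP1v_affT v : isP1v (affT v).
Proof.
apply: isP1v_pair.
  by exists (v 0).1, ((v 1).1 - (v 0).1), ((v 2%R).1 - (v 0).1) => x; rewrite affT1; ring.
by exists (v 0).2, ((v 1).2 - (v 0).2), ((v 2%R).2 - (v 0).2) => x; rewrite affT2; ring.
Qed.

Lemma plane_eq x y : x.1 = y.1 -> x.2 = y.2 -> x = y.
Proof. by case: x y => [a b] [c d] /= -> ->. Qed.

Lemma rvtx0 : rvtx 0 = (0, 0) :> plane R. Proof. by []. Qed.
Lemma rvtx1 : rvtx 1 = (1, 0) :> plane R. Proof. by []. Qed.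
Lemma rvtx2 : rvtx 2%R = (0, 1) :> plane R. Proof. by []. Qed.

Lemma affT_rvtx v i : affT v (rvtx i) = v i.
Proof.
move: i; apply: ord3_ind; apply: plane_eq; rewrite ?affT1 ?affT2 ?rvtx0 ?rvtx1 ?rvtx2 /=; ring.
Qed.

Lemma midpt1 x y : (midpt x y).1 = (x.1 + y.1) / 2.
Proof. by rewrite /midpt /= /GRing.scale/= mulrC. Qed.

Lemma midpt2 x y : (midpt x y).2 = (x.2 + y.2) / 2.
Proof. by rewrite /midpt /= /GRing.scale/= mulrC. Qed.

Lemma isP1v_midpt F x y : isP1v F -> F (midpt x y) = midpt (F x) (F y).
Proof.
move=> F1; have [p0 [p1 [p2 pE]]] := F1 0; have [q0 [q1 [q2 qE]]] := F1 1.
have p1E z : (F z).1 = p0 + p1 * z.1 + p2 * z.2 by rewrite -pE.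
have q1E z : (F z).2 = q0 + q1 * z.1 + q2 * z.2 by rewrite -qE.
by apply: plane_eq; rewrite ?(midpt1, midpt2, p1E, q1E); field.
Qed.

Lemma affT_rnode v i j : affT v (rnode i j) = midpt (v i) (v j).
Proof. by rewrite /rnode isP1v_midpt ?affT_rvtx//; exact: isP1v_affT. Qed.

(** Twice the signed area of the triangle. *)
Definition area v := cross (v 1 - v 0) (v 2%R - v 0).

(** Indices are added modulo 3, so that edge [i] runs from vertex [i + 1] to vertex [i + 2] in the
    orientation of the triangle. *)
Lemma add11 : (1 + 1 : 'I_3) = 2%R. Proof. exact/val_inj. Qed.
Lemma add12 : (1 + 2%R : 'I_3) = 0. Proof. exact/val_inj. Qed.
Lemma add21 : (2%R + 1 : 'I_3) = 0. Proof. exact/val_inj. Qed.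
Lemma add22 : (2%R + 2%R : 'I_3) = 1. Proof. exact/val_inj. Qed.
Definition add3E := (@add0r 'I_3, add11, add12, add21, add22).

Lemma area_rot v i : cross (v (i + 1) - v i) (v (i + 2%R) - v i) = area v.
Proof. by move: i; apply: ord3_ind; rewrite !add3E /area /cross/=; ring. Qed.

Lemma det_affT v x : \det (jac (affT v) x) = area v.
Proof.
rewrite det_jac_central; last exact/isP1v_isP2v/isP1v_affT.
by rewrite !affT1 !affT2 /area /cross /dir/=; field.
Qed.

Lemma bary_sum3 (i : 'I_3) x : bary i x + bary (i + 1) x + bary (i + 2%R) x = 1.
Proof. by move: i; apply: ord3_ind; rewrite !add3E /bary/=; ring. Qed.

Lemma affT_rot v (i : 'I_3) x :
  affT v x = bary i x *: v i + bary (i + 1) x *: v (i + 1) + bary (i + 2%R) x *: v (i + 2%R).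
Proof.
by move: i; apply: ord3_ind; rewrite !add3E affTE /bary/=; apply: plane_eq => /=;
  rewrite /GRing.scale/=; ring.
Qed.

Lemma bary_ex (i : 'I_3) (a b c : R) : a + b + c = 1 ->
  exists x, [/\ bary i x = a, bary (i + 1) x = b & bary (i + 2%R) x = c].
Proof.
move=> abc; move: i; apply: ord3_ind; rewrite !add3E /bary/=.
- by exists (b, c); split => //=; lra.
- by exists (a, b); split => //=; lra.
- by exists (c, a); split => //=; lra.
Qed.

Lemma ord3_rot (P : 'I_3 -> Prop) (i : 'I_3) : P i -> P (i + 1) -> P (i + 2%R) -> forall j, P j.
Proof.
by move: i; apply: ord3_ind; rewrite !add3E => Pa Pb Pc; apply: ord3_ind.
Qed.

Lemma area_neq0 v : injective (affT v) -> area v != 0.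
Proof.
move=> vi; apply/eqP => a0.
have [e|e] := eqVneq (v 1 - v 0) 0.
  have : rvtx 1 = rvtx 0 :> plane R.
    by apply: vi; rewrite !affT_rvtx; apply/eqP; rewrite -subr_eq0 e.
  by rewrite rvtx0 rvtx1 => -[/eqP]; rewrite oner_eq0.
move: a0 e; rewrite /area /cross; set a := v 1 - v 0; set b := v 2%R - v 0 => a0 e.
have aff s t : affT v (s, t) = v 0 + s *: a + t *: b.
  by rewrite affTE; apply: plane_eq; rewrite /= /GRing.scale/= /a /b/=; ring.
clearbody a b.
(* When the determinant is 0, [(b.1, - a.1)] and [(b.2, - a.2)] lie in the kernel of the linear
   part; injectivity then forces [a = 0]. *)
have /vi/eqP : affT v (b.1, - a.1) = affT v (0, 0).
  rewrite !aff; apply: plane_eq; rewrite /= /GRing.scale/=; lra.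
rewrite xpair_eqE => /andP[/eqP b1]; rewrite oppr_eq0 => /eqP a1.
have /vi/eqP : affT v (b.2, - a.2) = affT v (0, 0).
  by rewrite !aff; apply: plane_eq; rewrite /= /GRing.scale/=; lra.
rewrite xpair_eqE => /andP[/eqP b2]; rewrite oppr_eq0 => /eqP a2.
by move/negP: e; apply; apply/eqP; apply: plane_eq.
Qed.

Definition tri v : set (plane R) := affT v @` refT.
Definition ctri v : set (plane R) := affT v @` crefT.
Definition edge v i : set (plane R) := affT v @` redge i.

Lemma open_tri v : injective (affT v) -> open (tri v).
Proof.
move=> vi; apply: open_image_P2v; first exact: open_refT.
- exact/isP1v_isP2v/isP1v_affT.
- by move=> x _; rewrite det_affT; exact: area_neq0.
- by move=> x y _ _ /vi.
Qed.

Lemma compact_ctri v : compact (ctri v).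
Proof.
apply: continuous_compact; last exact: compact_crefT.
by apply: continuous_subspaceT; exact/continuous_isP2v/isP1v_isP2v/isP1v_affT.
Qed.

Lemma edgeE v i : edge v i = segment (v (i + 1)) (v (i + 2%R)).
Proof.
apply/seteqP; split=> [_ [x [xT x0] <-]|_ [t /andP[t0 t1] ->]].
  have s3 := bary_sum3 i x; rewrite x0 add0r in s3.
  exists (bary (i + 2%R) x); first by have := xT (i + 1); have := xT (i + 2%R) => ? ?; apply/andP; split; lra.
  by rewrite (affT_rot v i) x0 scale0r add0r; congr (_ *: _ + _); lra.
have [|x [x0 x1 x2]] := @bary_ex i 0 (1 - t) t; first by lra.
exists x; last by rewrite (affT_rot v i) x0 x1 x2 scale0r add0r.
by split => //; apply: (ord3_rot (i := i)); rewrite ?x0 ?x1 ?x2; lra.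
Qed.

Lemma edge_distinct v i j : injective (affT v) -> edge v i = edge v j -> i = j.
Proof.
move=> vi eij.
have : edge v i (v (i + 1)).
  by rewrite edgeE; exists 0; rewrite ?lexx ?ler01// subr0 scale1r scale0r addr0.
rewrite eij => -[x [_ xj] xi1].
have : edge v i (v (i + 2%R)).
  by rewrite edgeE; exists 1; rewrite ?lexx ?ler01// subrr scale1r scale0r add0r.
rewrite eij => -[y [_ yj] yi2].
move: xi1 yi2; rewrite -[v (i + 1)]affT_rvtx -[v (i + 2%R)]affT_rvtx => /vi xE /vi yE.
move: xj yj; rewrite xE yE.
move: i j {eij xE yE}; apply: ord3_ind; apply: ord3_ind; rewrite !add3E /bary/= => // h1 h2; exfalso; lra.
Qed.

(** Each direction vector is a multiple of the other, with factors of modulus at most 1 and product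
    1. So the factors are both 1 or both -1, and the end points have parameters 0 and 1. *)
Lemma segment_eq p q p' q' : p != q -> segment p q = segment p' q' ->
  (p = p' /\ q = q') \/ (p = q' /\ q = p').
Proof.
move=> pq s.
have sp (a b : plane R) : segment a b a by exists 0; rewrite ?lexx ?ler01// subr0 scale1r scale0r addr0.
have sq (a b : plane R) : segment a b b by exists 1; rewrite ?lexx ?ler01// subrr scale1r scale0r add0r.
have := sp p q; have := sq p q; rewrite s => -[t /andP[t0 t1] qE] [r /andP[r0 r1] pE].
have := sp p' q'; have := sq p' q'; rewrite -s => -[t' /andP[t'0 t'1] q'E] [r' /andP[r'0 r'1] p'E].
have E1 : q - p = (t - r) *: (q' - p').
  by rewrite qE pE; apply: plane_eq; rewrite /= /GRing.scale/=; ring.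
have E2 : q' - p' = (t' - r') *: (q - p).
  by rewrite q'E p'E; apply: plane_eq; rewrite /= /GRing.scale/=; ring.
have : (t - r) * (t' - r') = 1.
  apply/eqP; rewrite -subr_eq0; have : ((t - r) * (t' - r') - 1) *: (q - p) = 0.
    by rewrite scalerBl -scalerA -E2 -E1 scale1r subrr.
  move/eqP; rewrite scaler_eq0 => /orP[//|].
  by move=> /eqP/subr0_eq qp; move: pq; rewrite qp eqxx.
move=> h; have [tr|tr] := lerP r t.
  have rt : r = 0 /\ t = 1 by split; nra.
  by left; rewrite pE qE rt.1 rt.2 subr0 subrr !scale1r !scale0r addr0 add0r.
have rt : r = 1 /\ t = 0 by split; nra.
by right; rewrite pE qE rt.1 rt.2 subr0 subrr !scale1r !scale0r addr0 add0r.
Qed.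

Lemma tri_comb v i (a b c : R) : 0 < a -> 0 < b -> 0 < c -> a + b + c = 1 ->
  tri v (a *: v i + b *: v (i + 1) + c *: v (i + 2%R)).
Proof.
move=> a0 b0 c0 abc; have [x [x0 x1 x2]] := bary_ex i abc.
exists x; last by rewrite (affT_rot v i) x0 x1 x2.
by apply: (ord3_rot (i := i)); rewrite ?x0 ?x1 ?x2.
Qed.

(* The overlap is near the midpoint of the common edge. *)
Lemma tri_overlap v v' i i' : 0 < area v -> 0 < area v' ->
  v (i + 1) = v' (i' + 1) -> v (i + 2%R) = v' (i' + 2%R) -> exists x, tri v x /\ tri v' x.
Proof.
rewrite -(area_rot v i) -(area_rot v' i') => a0 a0' e1 e2.
move: a0 a0'; rewrite -e1 -e2.
set p := v (i + 1); set q := v (i + 2%R); set c := v i; set c' := v' i'.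
move=> a0 a0'.
(* [al], [be], [ga] are the barycentric coordinates of [c] in the second triangle. [al] is the ratio
   of the two signed areas, and is positive because the orientations agree. *)
pose A := cross (p - c') (q - c').
pose al := cross (p - c) (q - c) / A.
pose be := cross (c - c') (q - c') / A.
pose ga := cross (p - c') (c - c') / A.
have A0 : A != 0 by rewrite gt_eqF.
have al0 : 0 < al by rewrite divr_gt0.
have abg : al + be + ga = 1.
  by rewrite /al /be /ga -!mulrDl; apply: (mulIf A0); rewrite divfK// mul1r /A /cross/=; ring.
have cE : c = al *: c' + be *: p + ga *: q.
  apply: plane_eq; apply: (mulIf A0); rewrite /= /GRing.scale/= !mulrDl;
    rewrite ![_ / A * _ * A]mulrAC !divfK//; rewrite /A /cross/=; ring.
(* Since [ep * (1 + |be| + |ga|) = 1 / 2], the weights [ep * be + (1 - ep) / 2] and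
   [ep * ga + (1 - ep) / 2] are positive. *)
pose ep := (2 * (1 + `|be| + `|ga|))^-1.
have n1 : 0 <= `|be| by []. have n2 : 0 <= `|ga| by [].
have ep0 : 0 < ep by rewrite invr_gt0; lra.
have epE : ep * (2 * (1 + `|be| + `|ga|)) = 1 by rewrite mulVf//; lra.
exists (ep *: c + ((1 - ep) / 2) *: p + ((1 - ep) / 2) *: q); split.
  by apply: tri_comb => //; nra.
have -> : ep *: c + ((1 - ep) / 2) *: p + ((1 - ep) / 2) *: q =
   (ep * al) *: v' i' + (ep * be + (1 - ep) / 2) *: v' (i' + 1) + (ep * ga + (1 - ep) / 2) *: v' (i' + 2%R).
  by rewrite -e1 -e2 -/p -/q -/c' {1}cE; apply: plane_eq; rewrite /= /GRing.scale/=; ring.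
have b1 := ler_norm (- be); have b2 := ler_norm (- ga); rewrite !normrN in b1 b2.
apply: tri_comb; [nra|nra|nra|].
have h : ep * (al + be + ga) = ep by rewrite abg mulr1.
lra.
Qed.

End triangles.

(** * Corners with two straight edges, and edges through interior vertices *)

Section internal_edges.
Context {R : realType}.
Implicit Types (x y z p q c : plane R) (v : 'I_3 -> plane R) (F : plane R -> plane R).

Lemma rnode1 (i j : 'I_3) : (rnode i j : plane R).1 = ((rvtx i).1 + (rvtx j).1) / 2.
Proof. exact: midpt1. Qed.

Lemma rnode2 (i j : 'I_3) : (rnode i j : plane R).2 = ((rvtx i).2 + (rvtx j).2) / 2.
Proof. exact: midpt2. Qed.

(* The quadratic part is a multiple of the product of the two barycentric coordinates
   vanishing on the two edges along which [f] is affine. *)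
Lemma corner_quadratic (f : plane R -> R) (i : 'I_3) : isP2 f ->
  (forall j, j != i -> f (rnode i j) = (f (rvtx i) + f (rvtx j)) / 2) ->
  [/\ exists c a b e : R, forall x, f (iter i rotate1 x) = c + a * x.1 + b * x.2 + e * (x.1 * x.2),
      pder 0 f (rvtx i) = f (rvtx 1) - f (rvtx 0)
    & pder 1 f (rvtx i) = f (rvtx 2%R) - f (rvtx 0)].
Proof.
move=> [a [b [c [d [e [g fE]]]]]]; have [d0 d1] := pder_isP2 fE.
rewrite /pder !derive_val.
move: i; apply: ord3_ind => mid.
- have := mid 1 isT; have := mid 2%R isT.
  rewrite !fE !rnode1 !rnode2 rvtx0 rvtx1 rvtx2 /= => m2 m1.
  have {}m1 : d = 0 by lra. have {}m2 : g = 0 by lra.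
  rewrite m1 m2; split; [|ring|ring].
  by exists a, b, c, e => x; rewrite fE m1 m2; ring.
- have := mid 0 isT; have := mid 2%R isT.
  rewrite !fE !rnode1 !rnode2 rvtx0 rvtx1 rvtx2 /= => m2 m1.
  have {}m1 : d = 0 by lra. have {}m2 : e = g by lra.
  rewrite m1 m2; split; [|ring|ring].
  by exists (a + b), (c - b + g), (- b), (- g) => x; rewrite fE m1 m2 /rotate1 /=; ring.
- have := mid 0 isT; have := mid 1 isT.
  rewrite !fE !rnode1 !rnode2 rvtx0 rvtx1 rvtx2 /= => m2 m1.
  have {}m1 : g = 0 by lra. have {}m2 : e = d by lra.
  rewrite m1 m2; split; [|ring|ring].
  by exists (a + c), (- c), (b - c + d), (- d) => x; rewrite fE m1 m2 /rotate1 /=; ring.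
Qed.

(** The product of the two barycentric coordinates has zero gradient at the corner, so the Jacobian
    there is that of the affine interpolant. This links the sign of [det DF] to the orientation of
    the affine triangle. *)
Lemma corner_chart F (i : 'I_3) : isP2v F ->
  (forall j, j != i -> F (rnode i j) = midpt (F (rvtx i)) (F (rvtx j))) ->
  bilinear (F \o iter i rotate1) /\
  \det (jac F (rvtx i)) = area (fun j => F (rvtx j)).
Proof.
move=> F2 mid.
have [||[c0 [a0 [b0 [e0 E0]]]] p00 p01] := @corner_quadratic (crd 0 \o F) i; first exact: F2.
  by move=> j /mid h; rewrite /crd/= h midpt1.
have [||[c1 [a1 [b1 [e1 E1]]]] p10 p11] := @corner_quadratic (crd 1 \o F) i; first exact: F2.
  by move=> j /mid h; rewrite /crd/= h midpt2.
split; last by rewrite det_jac p00 p01 p10 p11 /area /cross /crd/=; ring.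
exists c0, c1, a0, b0, a1, b1, e0, e1 => x; apply: plane_eq; [exact: E0|exact: E1].
Qed.

Lemma closure_refT : crefT `<=` closure (@refT R).
Proof.
move=> x /crefTE[x1 x2 x12] U /nbhs_box[r r0 rU].
pose t := Num.min r 1 / 2.
have [m0 m1 mr] : [/\ 0 < Num.min r 1, Num.min r 1 <= 1 & Num.min r 1 <= r].
  by split; [rewrite lt_min r0 ltr01|rewrite ge_min lexx orbT|rewrite ge_min lexx].
have t0 : 0 < t by rewrite /t; lra.
have t1 : t < 1 by rewrite /t; lra.
have tr : t < r by rewrite /t; lra.
clearbody t.
(* A point slightly moved from [x] towards the centroid. *)
exists ((1 - t) * x.1 + t / 3, (1 - t) * x.2 + t / 3); split.
  by apply/refTE; split => /=; nra.
by apply: rU; split => /=; rewrite in_itv/=; apply/andP; split; nra.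
Qed.

Lemma closure_tri v : ctri v `<=` closure (tri v).
Proof.
move=> _ [x xT <-] U Ux.
have : nbhs x (affT v @^-1` U).
  by apply: (continuous_isP2v (isP1v_isP2v (isP1v_affT v))).
by move=> /(closure_refT xT)[y [yT Uy]]; exists (affT v y); split => //; exists y.
Qed.

Lemma tri_ctri v : tri v `<=` ctri v.
Proof. by apply: image_subset; exact: refT_sub_crefT. Qed.

Lemma bary_rvtx0 (i : 'I_3) : bary i (rvtx i : plane R) = 1.
Proof. by move: i; apply: ord3_ind; rewrite /bary /rvtx/=; ring. Qed.

Lemma bary_rvtx1 (i : 'I_3) : bary (i + 1) (rvtx i : plane R) = 0.
Proof. by move: i; apply: ord3_ind; rewrite !add3E /bary /rvtx/=; ring. Qed.

Lemma bary_line (i : 'I_3) x y (s : R) :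
  bary i (s *: (x - y) + y) = (1 - s) * bary i y + s * bary i x.
Proof. by move: i; apply: ord3_ind; rewrite /bary/= /GRing.scale/=; ring. Qed.

Lemma nbhs0_pos (P : set R) : nbhs (0 : R) P -> exists2 s : R, 0 < s < 1 & P s.
Proof.
move=> /nbhs_ballP[r /= r0 rP].
have [m0 m1 mr] : [/\ 0 < Num.min r 1, Num.min r 1 <= 1 & Num.min r 1 <= r].
  by split; [rewrite lt_min r0 ltr01|rewrite ge_min lexx orbT|rewrite ge_min lexx].
exists (Num.min r 1 / 2); first by apply/andP; split; lra.
by apply: rP; rewrite /ball/= sub0r normrN ger0_norm; lra.
Qed.

Lemma closed_ctri v : closed (ctri v).
Proof. by apply: compact_closed; [exact: hausdorff_plane|exact: compact_ctri]. Qed.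

Lemma ord3_third (i j : 'I_3) : j != i ->
  exists l, [/\ l != i, l != j & forall P : 'I_3 -> Prop, P i -> P j -> P l -> forall k, P k].
Proof.
move: i j; apply: ord3_ind; apply: ord3_ind => // _;
  [exists 2%R|exists 1|exists 2%R|exists 0|exists 1|exists 0];
  by split=> // P ? ? ?; exact: ord3_ind.
Qed.

Section mesh.
Context {E : finType} (vtx : E -> 'I_3 -> plane R) (Gh : plane R -> plane R)
  (F : E -> plane R -> plane R) (Omega : set (plane R)) (sigma C : R)
  (G : plane R -> plane R).
Hypothesis hmesh : curved_mesh vtx Gh F Omega sigma C G.

Let affT_inj e : injective (affT (vtx e)) := mesh_nondeg hmesh (e := e).

Lemma tri_in_interior e x : tri (vtx e) x -> tOmega vtx x.
Proof.
move=> ex; rewrite /tOmega; move: x ex; rewrite -[forall x, _]/(tri (vtx e) `<=` _) -open_subsetE.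
  by move=> y /tri_ctri ey; exists e.
exact: open_tri.
Qed.

(** Conformity allows distinct closed triangles to meet only in a common vertex or edge, where some
    barycentric coordinate is 0. *)
Lemma tri_ctri_disjoint e e' x : tri (vtx e) x -> ctri (vtx e') x -> e = e'.
Proof.
move=> [y yT yx] e'x; apply/eqP; apply: contrapT => /negP ee'.
have ex : ctri (vtx e) x by apply: tri_ctri; exists y.
have yv i : y != rvtx i.
  by apply/eqP => yE; have := yT (i + 1); rewrite yE bary_rvtx1 ltxx.
have [h|[i [i' [_ h]]]|[i [i' [_ h]]]] := mesh_conforming hmesh ee'.
- by have : (ctT vtx e `&` ctT vtx e') x by []; rewrite h.
- have : (ctT vtx e `&` ctT vtx e') x by [].
  rewrite h => xi; have := yv i; rewrite (_ : y = rvtx i) ?eqxx//.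
  by apply: (@affT_inj e); rewrite yx affT_rvtx.
- have : (ctT vtx e `&` ctT vtx e') x by [].
  rewrite h => -[z [_ zi]]; rewrite -yx => /affT_inj zy.
  by move: (yT i); rewrite -zy zi ltxx.
Qed.

Lemma vtx_tOmega e i : ~ boundary_vtx vtx e i -> tOmega vtx (vtx e i).
Proof.
move=> nb; apply: contrapT => nt; apply: nb; split.
  have : ctri (vtx e) (vtx e i).
    exists (rvtx i); last exact: affT_rvtx.
    by apply/crefTE; move: (i); apply: ord3_ind; rewrite ?rvtx0 ?rvtx1 ?rvtx2; split => /=; lra.
  by move=> /closure_tri; apply: closureS => x; exact: tri_in_interior.
by rewrite (interior_id _).1//; exact: open_interior.
Qed.

(* Near an interior vertex, points of an edge that belonged to a single element could
   not be interior to the union of the elements. *)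
Lemma internal_edge_vtx e i j : tOmega vtx (vtx e i) -> j != i -> internal_edge vtx e j.
Proof.
move=> ti ji; apply: contrapT => nint.
have [l [li lj ijl]] := ord3_third ji.
(* Edge [j] joins vertices [i] and [l]; for small positive [s] this is a point of its relative
   interior close to vertex [i]. *)
pose x s : plane R := s *: (rvtx l - rvtx i) + rvtx i.
have bx k s : bary k (x s) = (1 - s) * bary k (rvtx i) + s * bary k (rvtx l) by exact: bary_line.
have bne (k m : 'I_3) : k != m -> bary k (rvtx m : plane R) = 0.
  by move: k m; apply: ord3_ind; apply: ord3_ind; rewrite /bary /rvtx //= => _; ring.
have : (fun s => affT (vtx e) (x s)) @ (0 : R) --> vtx e i.
  rewrite -affT_rvtx; apply: cvg_comp (@cvg_line _ _ _) _.
  exact/continuous_isP2v/isP1v_isP2v/isP1v_affT.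
have oO : open (tOmega vtx) by exact: open_interior.
move=> /(_ _ (open_nbhs_nbhs (conj oO ti))) /nbhs0_pos[s /andP[s0 s1] /= zO].
have xj : bary j (x s) = 0 by rewrite bx !bne ?mulr0 ?addr0// eq_sym.
have xi : 0 < bary i (x s) by rewrite bx bary_rvtx0 (bne i l) 1?eq_sym//; lra.
have xl : 0 < bary l (x s) by rewrite bx bary_rvtx0 (bne l i)//; lra.
have xT : crefT (x s) by apply: ijl; rewrite ?xj// ltW.
have nz e' : e' != e -> ~ ctri (vtx e') (affT (vtx e) (x s)).
  move=> e'e e'z; rewrite eq_sym in e'e.
  have zz : (ctT vtx e `&` ctT vtx e') (affT (vtx e) (x s)) by split => //; exists (x s).
  have [h|[k [k' [_ h]]]|[k [k' [kk' h]]]] := mesh_conforming hmesh e'e.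
  - by rewrite h in zz.
  - rewrite h /= -affT_rvtx in zz; move: zz => /affT_inj xk.
    move: xi xl; rewrite xk; have [->|ki] := eqVneq k i; first by rewrite (bne l i)// ltxx.
    by rewrite (bne i k) 1?eq_sym// ltxx.
  - rewrite h in zz; case: zz => y [_ yk] /affT_inj yx; rewrite yx in yk.
    have kj : k = j.
      move: k {h kk'} yk; apply: ijl => //; first by move=> h; rewrite h ltxx in xi.
      by move=> h; rewrite h ltxx in xl.
    by apply: nint; exists e', k'; rewrite -kj; split => //; rewrite eq_sym.
pose z : plane R := affT (vtx e) (x s).
have near_z : nbhs z (ctri (vtx e)).
  have Fz : Filter (nbhs z) by exact: nbhs_filter.
  have : nbhs z [set y | forall e', e' != e -> ~ ctri (vtx e') y].
    apply: (@filter_forall _ _ (fun e' y => e' != e -> ~ ctri (vtx e') y) _ Fz) => e'.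
    have [->|e'e] := eqVneq e' e; first exact: nearW.
    have : nbhs z (~` ctri (vtx e')).
      apply: open_nbhs_nbhs; split; first by apply: closed_openC; exact: closed_ctri.
      exact: nz.
    by apply: filterS.
  apply: filterS2 (open_nbhs_nbhs (conj oO zO)) => y /interior_subset[e' _ e'y] ney.
  have [<-//|e'e] := eqVneq e' e; by case: (ney e' e'e).
(* Moving from the edge point away from the centroid [g] makes coordinate [j] negative, so every
   neighbourhood of the point leaves the triangle. *)
pose g : plane R := (3^-1, 3^-1).
have bg k : bary k g = 3^-1 by move: k; apply: ord3_ind; rewrite /bary/=; field.
have : (fun t => affT (vtx e) (t *: (x s - g) + x s)) @ (0 : R) --> affT (vtx e) (x s).
  apply: cvg_comp (@cvg_line _ _ _) _.
  exact/continuous_isP2v/isP1v_isP2v/isP1v_affT.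
move=> /(_ _ near_z) /nbhs0_pos[t /andP[t0 t1] /= [y yT /affT_inj yE]].
have := yT j; rewrite yE.
have -> : t *: (x s - g) + x s = (1 + t) *: (x s - g) + g.
  by rewrite scalerDl scale1r [RHS]addrAC subrK addrC.
by rewrite bary_line bg xj mulr0 addr0 leNgt => /negP; apply; lra.
Qed.

End mesh.
End internal_edges.

Section mesh_charts.
Context {R : realType}.
Implicit Types (x y z p q c : plane R) (v : 'I_3 -> plane R).

Lemma crefT_rnode (i j : 'I_3) : crefT (rnode i j : plane R).
Proof.
by apply/crefTE; rewrite !rnode1 !rnode2; move: i j; apply: ord3_ind; apply: ord3_ind;
  rewrite ?rvtx0 ?rvtx1 ?rvtx2 /=; split; lra.
Qed.

Lemma rnodexx (i : 'I_3) : rnode i i = rvtx i :> plane R.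
Proof. by apply: plane_eq; rewrite ?rnode1 ?rnode2; field. Qed.

Lemma redge_rnode (i j l : 'I_3) : j != i -> l != i -> redge i (rnode j l : plane R).
Proof.
move=> ji li; split; first exact: crefT_rnode.
have b0 k : k != i -> bary i (rvtx k : plane R) = 0.
  by move: i k {ji li}; apply: ord3_ind; apply: ord3_ind; rewrite /bary /rvtx //= => _; ring.
rewrite (_ : rnode j l = 2^-1 *: (rvtx j - rvtx l) + rvtx l).
  by rewrite bary_line !b0// !mulr0 addr0.
by apply: plane_eq; rewrite ?rnode1 ?rnode2 /= /GRing.scale/=; field.
Qed.

Section mesh.
Context {E : finType} (vtx : E -> 'I_3 -> plane R) (Gh : plane R -> plane R)
  (F : E -> plane R -> plane R) (Omega : set (plane R)) (sigma C : R)
  (G : plane R -> plane R).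
Hypothesis hmesh : curved_mesh vtx Gh F Omega sigma C G.

(** A vertex is the degenerate node [midpt p p], so [Gh_nodes] with [j = l] applies. *)
Lemma F_rvtx e i : F e (rvtx i) = vtx e i.
Proof.
have mm p : midpt p p = p by apply: plane_eq; rewrite ?midpt1 ?midpt2; field.
rewrite (F_Gh hmesh); last by rewrite -rnodexx; exact: crefT_rnode.
by rewrite affT_rvtx -[vtx e i]mm (Gh_nodes hmesh) mm (G_vtx hmesh).
Qed.

Lemma F_rnode e i j : F e (rnode i j) = Gh (midpt (vtx e i) (vtx e j)).
Proof. by rewrite (F_Gh hmesh) ?affT_rnode//; exact: crefT_rnode. Qed.

Lemma straight_mid e i j l : straight (elEdge F e i) -> j != i -> l != i ->
  F e (rnode j l) = midpt (F e (rvtx j)) (F e (rvtx l)).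
Proof.
move=> /(F_affine_edge hmesh)[L L1 FL] ji li.
rewrite -(rnodexx j) -(rnodexx l) !FL; try exact: redge_rnode.
by rewrite !rnodexx /rnode (isP1v_midpt _ _ L1).
Qed.

Lemma mesh_corner e : exists i : 'I_3, bilinear (F e \o iter i rotate1) /\
  \det (jac (F e) (rvtx i)) = area (vtx e).
Proof.
have [i nbi] := mesh_two_bdry_vtx hmesh e.
have iO := vtx_tOmega hmesh nbi.
exists i; rewrite [vtx e](_ : _ = fun j => F e (rvtx j)); last first.
  by apply/funext => j; rewrite F_rvtx.
apply: corner_chart; first exact: (F_P2 hmesh).
move=> j ji; have [l [li lj _]] := ord3_third ji.
apply: (@straight_mid e l i j); [|by rewrite eq_sym|by rewrite eq_sym].
by apply: (mesh_internal_straight hmesh); exact: (internal_edge_vtx hmesh iO li).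
Qed.

(** The affine triangles inherit their orientation from [F_det] at the corner of [mesh_corner]. *)
Lemma area_vtx e : 0 < area (vtx e).
Proof.
have [i [_ <-]] := mesh_corner e; apply: (F_det hmesh).
by rewrite -rnodexx; exact: crefT_rnode.
Qed.

Lemma nondegenerate_F e : nondegenerate (F e).
Proof.
split; [exact: (F_P2 hmesh)|exact: (F_inj hmesh)|].
by exists 1 => x xT; rewrite mul1r; exact: (F_det hmesh).
Qed.

Lemma cov_F e : cov (F e).
Proof.
by have [i [bi _]] := mesh_corner e; exact: cov_chart (nondegenerate_F e) bi.
Qed.

Lemma nondegenerate_affT e : nondegenerate (affT (vtx e)).
Proof.
split.
- exact/isP1v_isP2v/isP1v_affT.
- by move=> x y _ _ /(mesh_nondeg hmesh).
- by exists 1 => x xT; rewrite mul1r det_affT; exact: area_vtx.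
Qed.

Lemma cov_affT e : cov (affT (vtx e)).
Proof.
apply: (@cov_chart _ _ 0%N); first exact: nondegenerate_affT.
exists (vtx e 0).1, (vtx e 0).2, ((vtx e 1).1 - (vtx e 0).1), ((vtx e 2%R).1 - (vtx e 0).1),
  ((vtx e 1).2 - (vtx e 0).2), ((vtx e 2%R).2 - (vtx e 0).2), 0, 0 => x.
by apply: plane_eq; rewrite /= ?affT1 ?affT2; ring.
Qed.

Lemma elTE e : elT vtx Gh e = F e @` refT.
Proof.
rewrite /elT /tT image_comp; apply/seteqP; split=> [_ [x xT <-]|_ [x xT <-]]; exists x => //=;
  by rewrite (F_Gh hmesh)//; exact: refT_sub_crefT.
Qed.

Lemma open_elT e : open (elT vtx Gh e).
Proof. by rewrite elTE; apply: nondegenerate_open; exact: nondegenerate_F. Qed.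

Lemma elT_Omegah e : elT vtx Gh e `<=` Omegah vtx Gh.
Proof.
rewrite -open_subsetE; last exact: open_elT.
by move=> x ex; exists e => //; exact: subset_closure.
Qed.

(** Global injectivity of [Gh] transfers disjointness to the curved elements, and keeps the image of
    the affine skeleton inside [tOmega] out of the open elements. *)
Lemma elT_tri e x : tOmega vtx x -> elT vtx Gh e (Gh x) -> tri (vtx e) x.
Proof.
move=> xO [y ey Ghyx]; rewrite -(Gh_inj hmesh _ xO Ghyx)//.
exact: (tri_in_interior hmesh ey).
Qed.

Lemma elT_disjoint e e' x : elT vtx Gh e x -> elT vtx Gh e' x -> e = e'.
Proof.
move=> [y ey <-] e'y; have yO : tOmega vtx y by exact: (tri_in_interior hmesh ey).
by apply: (tri_ctri_disjoint hmesh ey); apply: tri_ctri; exact: elT_tri.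
Qed.

Lemma elT_Omegah_F e x : refT x -> Omegah vtx Gh (F e x).
Proof. by move=> xT; apply: (@elT_Omegah e); rewrite elTE; exists x. Qed.

End mesh.
End mesh_charts.

(** * Flux balance *)

Section edge_fluxes.
Context {R : realType}.
Implicit Types (x y z p q c : plane R) (v : 'I_3 -> plane R).

(* Simpson's rule, times 6, for the flux through edge [i], scaled by its length; it is
   exact since the normal component of a quadratic field is quadratic. *)
Definition edge_flux (vh : plane R -> plane R) (i : 'I_3) : R :=
  let t := rvtx (i + 2%R) - rvtx (i + 1) in
  cross (vh (rvtx (i + 1))) t + 4 * cross (vh (rnode (i + 1) (i + 2%R))) t
  + cross (vh (rvtx (i + 2%R))) t.

Lemma sum_ord3 (f : 'I_3 -> R) : \sum_i f i = f 0 + f 1 + f 2%R.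
Proof.
rewrite !big_ord_recl big_ord0 addr0 addrA.
congr (_ + f _ + f _); exact/val_inj.
Qed.

Lemma rnodeE (i j : 'I_3) :
  rnode i j = (((rvtx i).1 + (rvtx j).1) / 2, ((rvtx i).2 + (rvtx j).2) / 2) :> plane R.
Proof. by apply: plane_eq; rewrite ?rnode1 ?rnode2. Qed.

Lemma integral_diverg (vh : plane R -> plane R) : isP2v vh ->
  (\int[leb2]_(x in refT) (diverg vh x)%:E = ((\sum_i edge_flux vh i) / 6)%:E)%E.
Proof.
move=> vh2; have [a [b [c [d [e [g fE]]]]]] := vh2 0.
have [a' [b' [c' [d' [e' [g' fE']]]]]] := vh2 1.
have [d0 _] := pder_isP2 fE; have [_ d1] := pder_isP2 fE'.
have p1E z : (vh z).1 = a + b * z.1 + c * z.2 + d * z.1 ^+ 2 + e * (z.1 * z.2) + g * z.2 ^+ 2 by rewrite -fE.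
have q1E z : (vh z).2 = a' + b' * z.1 + c' * z.2 + d' * z.1 ^+ 2 + e' * (z.1 * z.2) + g' * z.2 ^+ 2 by rewrite -fE'.
transitivity (\int[leb2]_(x in refT) (b + c' + (2 * d + e') * x.1 + (e + 2 * g') * x.2
    + 0 * x.1 ^+ 2 + 0 * (x.1 * x.2) + 0 * x.2 ^+ 2)%:E)%E.
  apply: eq_integral => x _; rewrite divergE /pder !derive_val; congr EFin; ring.
rewrite integral_refT_quadratic; congr EFin.
rewrite sum_ord3 /edge_flux !add3E !rnodeE !rvtx0 !rvtx1 !rvtx2 /cross !p1E !q1E /=.
by field.
Qed.

(** On each edge [phi_ref] is a multiple of the Legendre polynomial of degree 2, which has mean 0;
    its nodal values are -1, 1/2, -1. *)
Lemma edge_flux_phi (a b : R) i :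
  edge_flux (fun x => (a * phi_ref x, b * phi_ref x)) i = 0.
Proof.
by move: i; apply: ord3_ind;
  rewrite /edge_flux !add3E !rnodeE ?rvtx0 ?rvtx1 ?rvtx2 /cross /phi_ref/=; field.
Qed.

(** The midpoint value makes [f] affine along the line through [p] and [q]: its second-order
    coefficient [K] there is 0, so the directional derivative is the same at all three nodes. *)
Lemma quadratic_mid_grad (f : plane R -> R) p q x : isP2 f ->
  f (midpt p q) = (f p + f q) / 2 -> x = p \/ x = q \/ x = midpt p q ->
  pder 0 f x * (q.1 - p.1) + pder 1 f x * (q.2 - p.2) = f q - f p.
Proof.
move=> [a [b [c [d [e [g fE]]]]]] mid; have [d0 d1] := pder_isP2 fE.
rewrite /pder !derive_val.
have K : d * (q.1 - p.1) ^+ 2 + e * ((q.1 - p.1) * (q.2 - p.2)) + g * (q.2 - p.2) ^+ 2 = 0.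
  have -> : 0 = 2 * (f p + f q - 2 * f (midpt p q)) by rewrite mid; field.
  by rewrite !fE midpt1 midpt2; field.
rewrite !fE => -[->|[->|->]].
- by apply/eqP; rewrite -subr_eq0 -oppr_eq0 -[X in _ == X]K; apply/eqP; ring.
- by apply/eqP; rewrite -subr_eq0 -[X in _ == X]K; apply/eqP; ring.
- by rewrite midpt1 midpt2; field.
Qed.

(** [F] is affine along the edge, so its Jacobian maps the reference edge vector to the physical
    one. A matrix multiplies [cross] by its determinant, which the Piola factor divides out. *)
Lemma cross_piola (F : plane R -> plane R) (i : 'I_3) x y :
  isP2v F -> \det (jac F x) != 0 ->
  F (rnode (i + 1) (i + 2%R)) = midpt (F (rvtx (i + 1))) (F (rvtx (i + 2%R))) ->
  x = rvtx (i + 1) \/ x = rvtx (i + 2%R) \/ x = rnode (i + 1) (i + 2%R) ->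
  cross (mxv (piola F x) y) (F (rvtx (i + 2%R)) - F (rvtx (i + 1))) =
  cross y (rvtx (i + 2%R) - rvtx (i + 1)).
Proof.
move=> F2 d0 mid xE.
have g0 := @quadratic_mid_grad (crd 0 \o F) _ _ _ (F2 0) _ xE.
have g1 := @quadratic_mid_grad (crd 1 \o F) _ _ _ (F2 1) _ xE.
rewrite /cross.
have -> : (F (rvtx (i + 2%R)) - F (rvtx (i + 1))).1 =
    (crd 0 \o F) (rvtx (i + 2%R)) - (crd 0 \o F) (rvtx (i + 1)) by [].
have -> : (F (rvtx (i + 2%R)) - F (rvtx (i + 1))).2 =
    (crd 1 \o F) (rvtx (i + 2%R)) - (crd 1 \o F) (rvtx (i + 1)) by [].
rewrite -g0; last by rewrite [LHS](_ : _ = (F (rnode (i + 1) (i + 2%R))).1)// mid midpt1.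
rewrite -g1; last by rewrite [LHS](_ : _ = (F (rnode (i + 1) (i + 2%R))).2)// mid midpt2.
rewrite -[(mxv _ _).1]/(crd 0 (mxv (piola F x) y)) -[(mxv _ _).2]/(crd 1 (mxv (piola F x) y)).
rewrite !crd_mxv_piola; move: d0; rewrite det_jac.
move: (pder 0 (crd 0 \o F) x) (pder 1 (crd 0 \o F) x) (pder 0 (crd 1 \o F) x) (pder 1 (crd 1 \o F) x).
move: (rvtx (i + 2%R)) (rvtx (i + 1)) => [q1 q2] [p1 p2] /=.
by clear=> A B A' B' d0; field.
Qed.

Lemma mxv_piola_inj (F : plane R -> plane R) x y :
  \det (jac F x) != 0 -> mxv (piola F x) y = 0 -> y = 0.
Proof.
move=> d0 h; have h0 : crd 0 (mxv (piola F x) y) = 0 by rewrite h.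
have h1 : crd 1 (mxv (piola F x) y) = 0 by rewrite h.
move: h0 h1 d0; rewrite !crd_mxv_piola det_jac.
move: (pder 0 (crd 0 \o F) x) (pder 1 (crd 0 \o F) x) (pder 0 (crd 1 \o F) x) (pder 1 (crd 1 \o F) x).
move=> A B A' B' h0 h1 d0.
have {}h0 : A * y.1 + B * y.2 = 0 by apply/eqP; move/eqP: h0; rewrite mulf_eq0 invr_eq0 (negbTE d0) orbF.
have {}h1 : A' * y.1 + B' * y.2 = 0 by apply/eqP; move/eqP: h1; rewrite mulf_eq0 invr_eq0 (negbTE d0) orbF.
apply: plane_eq; apply: (mulfI d0) => /=.
  rewrite mulr0; transitivity (B' * (A * y.1 + B * y.2) - B * (A' * y.1 + B' * y.2)); first by ring.
  by rewrite h0 h1 !mulr0 subrr.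
rewrite mulr0; transitivity (A * (A' * y.1 + B' * y.2) - A' * (A * y.1 + B * y.2)); first by ring.
by rewrite h0 h1 !mulr0 subrr.
Qed.

(** The nodal conditions of [Wh] are limits from open elements. They pull back through the
    continuous [F], and are determined there because [a] lies in the closure of [refT]. *)
Lemma piola_limit (F w vh : plane R -> plane R) a l :
  isP2v F -> isP2v vh -> crefT a -> \det (jac F a) != 0 ->
  (forall x, refT x -> w (F x) = mxv (piola F x) (vh x)) ->
  w @ within (F @` refT) (nbhs (F a)) --> l -> l = mxv (piola F a) (vh a).
Proof.
move=> F2 vh2 aT d0 wF wl.
have PF : ProperFilter (within refT (nbhs a)) by exact: within_nbhs_proper (closure_refT aT).
apply: (@cvg_unique _ (@norm_hausdorff _ _) ((w \o F) @ within refT (nbhs a))).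
- apply: cvg_comp wl => W; rewrite /nbhs/= /within/= => WN.
  have := continuous_isP2v F2 (x := a); move=> /(_ _ WN); rewrite /nbhs/=.
  by apply: filterS => x; rewrite /= => h xT; apply: h; exists x.
- apply: (@cvg_trans _ ((fun x => mxv (piola F x) (vh x)) @ within refT (nbhs a))).
    by apply: near_eq_cvg; rewrite near_withinE; apply: nearW => x xT; rewrite /= wF.
  apply: cvg_trans (_ : (fun x => mxv (piola F x) (vh x)) @ a --> _).
    by apply: cvg_app; exact: cvg_within.
  have c2 (i : 'I_2) : (fun x => crd i (mxv (piola F x) (vh x))) @ a --> crd i (mxv (piola F a) (vh a)).
    under [fun _ => _]funext do rewrite crd_mxv_piola det_jac.
    rewrite crd_mxv_piola det_jac.
    have cp (k m : 'I_2) : pder k (crd m \o F) @ a --> pder k (crd m \o F) a.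
      by apply: continuous_isP2; apply/isP1_isP2/isP1_pder.
    apply: cvgM.
      apply: cvgD; apply: cvgM; try exact: cp; [exact: (continuous_isP2 (vh2 0))|exact: (continuous_isP2 (vh2 1))].
    apply: cvgV; first by rewrite -det_jac.
    by apply: cvgB; apply: cvgM; exact: cp.
  by apply: (@cvg_pair _ _ _ _ (nbhs (crd 0 (mxv (piola F a) (vh a))))
    (nbhs (crd 1 (mxv (piola F a) (vh a))))); [exact: (c2 0)|exact: (c2 1)].
Qed.

End edge_fluxes.

Section flux_balance.
Context {R : realType}.
Implicit Types (x y z p q c : plane R) (v : 'I_3 -> plane R).

(** Each term is a sum over its at most one partner; exchanging the two summations shows that the
    total equals its negative. *)
Lemma sum_matching (T : finType) (r : rel T) (f : T -> R) :
  symmetric r -> (forall x y z : T, r x y -> r x z -> y = z) ->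
  (forall x y : T, r x y -> f y = - f x) -> (forall x : T, (forall y : T, ~~ r x y) -> f x = 0) ->
  \sum_x f x = 0.
Proof.
move=> symr unir fN f0.
have fE (x : T) : f x = \sum_(y | r x y) f x.
  have [/existsP[y xy]|/existsPn nx] := boolP [exists y, r x y].
    rewrite (big_pred1 y)// => z; apply/idP/eqP => [xz|->//].
    exact: unir xz xy.
  by rewrite big_pred0 ?f0// => y; apply/negbTE/nx.
have : \sum_x f x = - \sum_x f x.
  transitivity (\sum_x \sum_(y | r x y) f x); first by apply: eq_bigr => y _; exact: fE.
  rewrite (exchange_big_dep predT)//= -sumrN; apply: eq_bigr => y _.
  rewrite [in RHS]fE -sumrN; apply: eq_big => [z|z zy]; first by rewrite symr.
  by rewrite (fN _ _ zy) opprK.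
lra.
Qed.

Section mesh.
Context {E : finType} (vtx : E -> 'I_3 -> plane R) (Gh : plane R -> plane R)
  (F : E -> plane R -> plane R) (Omega : set (plane R)) (sigma C : R)
  (G : plane R -> plane R).
Hypothesis hmesh : curved_mesh vtx Gh F Omega sigma C G.

(** Equal edges have the same end points in one of two orders. In the same order, both triangles,
    being positively oriented, would lie on the same side of the edge and overlap, contrary to
    conformity. *)
Lemma shared_edge e e' i i' : e != e' -> tedge vtx e i = tedge vtx e' i' ->
  vtx e (i + 1) = vtx e' (i' + 2%R) /\ vtx e (i + 2%R) = vtx e' (i' + 1).
Proof.
move=> ee'; rewrite -[tedge _ _ _]/(edge (vtx e) i) -[tedge _ _ _]/(edge (vtx e') i') !edgeE.
have n12 : vtx e (i + 1) != vtx e (i + 2%R).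
  apply/eqP; rewrite -[vtx e (i + 1)]affT_rvtx -[vtx e (i + 2%R)]affT_rvtx => /(mesh_nondeg hmesh).
  have := bary_rvtx0 (R := R) (i + 1) => /[swap] ->.
  move: (i); apply: ord3_ind; rewrite !add3E /bary /rvtx/= => h; lra.
case/(segment_eq n12) => // -[e1 e2].
have [x [ex e'x]] := tri_overlap (area_vtx hmesh e) (area_vtx hmesh e') e1 e2.
by move: ee'; rewrite (tri_ctri_disjoint hmesh ex (tri_ctri e'x)) eqxx.
Qed.

Variables (w : plane R -> plane R) (vh : E -> plane R -> plane R).
Hypotheses (hw : Wh vtx Gh F w) (vh2 : forall e, isP2v (vh e))
  (wvh : forall e x, refT x -> w (F e x) = mxv (piola (F e) x) (vh e x)).

Lemma Wh_limit e j l (a : plane R) :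
  w @ within (elT vtx Gh e) (nbhs (F e (rnode j l))) --> a ->
  a = mxv (piola (F e) (rnode j l)) (vh e (rnode j l)).
Proof.
rewrite (elTE hmesh); apply: piola_limit => //; first exact: (F_P2 hmesh).
- exact: crefT_rnode.
- by rewrite gt_eqF//; apply: (F_det hmesh); exact: crefT_rnode.
- exact: wvh.
Qed.

Lemma edge_flux_boundary e i : ~ internal_edge vtx e i -> edge_flux (vh e) i = 0.
Proof.
move=> ni; have [_ _ wb] := hw.
have vh0 j l : j != i -> l != i -> vh e (rnode j l) = 0.
  move=> ji li; have := wb e i _ ni (ex_intro _ j (ex_intro _ l (And3 ji li erefl))).
  move=> /(@Wh_limit e) /esym; apply: mxv_piola_inj.
  by rewrite gt_eqF//; apply: (F_det hmesh); exact: crefT_rnode.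
have i1 : i + 1 != i by move: (i); apply: ord3_ind.
have i2 : i + 2%R != i by move: (i); apply: ord3_ind.
rewrite /edge_flux -!rnodexx !vh0// /cross/=; ring.
Qed.

Lemma edge_flux_shared e e' i i' : e != e' -> tedge vtx e i = tedge vtx e' i' ->
  edge_flux (vh e') i' = - edge_flux (vh e) i.
Proof.
move=> ee' ii'; have [_ wi _] := hw.
have ie : internal_edge vtx e i by exists e', i'; split; [rewrite eq_sym|].
have ie' : internal_edge vtx e' i' by exists e, i.
have nz (k : 'I_3) : k + 1 != k /\ k + 2%R != k by move: k; apply: ord3_ind.
(* [Wh] provides a single limit for all elements at the edge, [e] included; both Piola values equal
   it. *)
have node k m j l : tedge vtx e i = tedge vtx e' i' -> k != i -> m != i ->
    j != i' -> l != i' -> F e (rnode k m) = F e' (rnode j l) ->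
    mxv (piola (F e) (rnode k m)) (vh e (rnode k m)) =
    mxv (piola (F e') (rnode j l)) (vh e' (rnode j l)).
  move=> _ ki mi ji li Fe.
  have [a wa] := wi e i _ ie (ex_intro _ k (ex_intro _ m (And3 ki mi erefl))).
  rewrite -(Wh_limit (wa e i erefl)); apply: (@Wh_limit e').
  by rewrite -Fe; exact: (wa e' i' (esym ii')).
have [v1 v2] := shared_edge ee' ii'.
have n1 := node (i + 1) (i + 1) (i' + 2%R) (i' + 2%R) ii' (nz i).1 (nz i).1 (nz i').2 (nz i').2.
have n2 := node (i + 2%R) (i + 2%R) (i' + 1) (i' + 1) ii' (nz i).2 (nz i).2 (nz i').1 (nz i').1.
have n3 := node (i + 1) (i + 2%R) (i' + 1) (i' + 2%R) ii' (nz i).1 (nz i).2 (nz i').1 (nz i').2.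
rewrite !rnodexx !(F_rvtx hmesh) in n1 n2; rewrite !(F_rnode hmesh) in n3.
have {}n1 := n1 v1; have {}n2 := n2 v2.
have {}n3 : mxv (piola (F e) (rnode (i + 1) (i + 2%R))) (vh e (rnode (i + 1) (i + 2%R))) =
    mxv (piola (F e') (rnode (i' + 1) (i' + 2%R))) (vh e' (rnode (i' + 1) (i' + 2%R))).
  apply: n3; congr Gh; rewrite v1 v2.
  by apply: plane_eq; rewrite !(midpt1, midpt2) addrC.
have flux e0 i0 : internal_edge vtx e0 i0 -> forall x,
    x = rvtx (i0 + 1) \/ x = rvtx (i0 + 2%R) \/ x = rnode (i0 + 1) (i0 + 2%R) ->
    cross (vh e0 x) (rvtx (i0 + 2%R) - rvtx (i0 + 1)) =
    cross (mxv (piola (F e0) x) (vh e0 x)) (vtx e0 (i0 + 2%R) - vtx e0 (i0 + 1)).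
  move=> ie0 x xE; rewrite -!(F_rvtx hmesh) cross_piola//; first exact: (F_P2 hmesh).
    rewrite gt_eqF//; apply: (F_det hmesh).
    by case: xE => [->|[->|->]]; rewrite -?rnodexx; exact: crefT_rnode.
  apply: (straight_mid hmesh (i := i0)); [|exact: (nz i0).1|exact: (nz i0).2].
  exact: (mesh_internal_straight hmesh).
rewrite /edge_flux !(flux e' i' ie') ?(flux e i ie); try by intuition.
rewrite -n1 -n2 -n3 v1 v2.
move: (mxv _ _) (mxv _ _) (mxv _ _) (vtx e' _) (vtx e' _) => A B D p q.
rewrite /cross/=; ring.
Qed.

Lemma sum_edge_flux : \sum_e \sum_i edge_flux (vh e) i = 0.
Proof.
rewrite pair_bigA /=.
apply: (@sum_matching _ (fun x y : E * 'I_3 => (x.1 != y.1) && `[< tedge vtx x.1 x.2 = tedge vtx y.1 y.2 >])).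
- by move=> x y; rewrite eq_sym; congr andb; apply/asboolP/asboolP.
- move=> [e i] [e1 i1] [e2 i2] /= /andP[ee1 /asboolP ii1] /andP[ee2 /asboolP ii2].
  have [v1 v1'] := shared_edge ee1 ii1; have [v2 v2'] := shared_edge ee2 ii2.
  (* If three elements shared an edge, each pair would traverse it in opposite directions, and its
     two end points would coincide. *)
  have e12 : e1 = e2.
    apply: contrapT => /eqP e12.
    have [h1 h2] : vtx e1 (i1 + 1) = vtx e2 (i2 + 2%R) /\ vtx e1 (i1 + 2%R) = vtx e2 (i2 + 1).
      by apply: shared_edge => //; rewrite -ii1.
    have : rvtx (i1 + 1) = rvtx (i1 + 2%R) :> plane R.
      by apply: (mesh_nondeg hmesh) (e1) _ _ _; rewrite !affT_rvtx h1 -v2 v1.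
    by move=> /eqP; move: (i1); apply: ord3_ind; rewrite !add3E /rvtx/= xpair_eqE ?oner_eq0 ?[0 == 1]eq_sym ?oner_eq0 ?andbF.
  subst e2; congr pair; apply: (@edge_distinct _ (vtx e1)); first exact: (mesh_nondeg hmesh).
  by rewrite -[edge _ _]/(tedge vtx e1 i1) -ii1.
- by move=> [e i] [e' i'] /= /andP[ee' /asboolP]; exact: edge_flux_shared.
- move=> [e i] /= ne; apply: edge_flux_boundary => -[e' [i' [e'e ii']]].
  by have := ne (e', i'); rewrite /= eq_sym e'e/= => /asboolP; apply.
Qed.

End mesh.
End flux_balance.

(** * Integration over the mesh *)

Section pullbacks.
Context {R : realType}.
Implicit Types (x y z p q : plane R) (v : 'I_3 -> plane R).
Notation mplane := (measurableTypeR R * measurableTypeR R)%type.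

Lemma integral_pieces (E : finType) (T : E -> set (plane R)) (D : set (plane R))
    (f : plane R -> R) (s : E -> R) :
  measurable (D : set mplane) -> (forall e, measurable (T e : set mplane)) ->
  (forall e, T e `<=` D) -> (forall e e' x, T e x -> T e' x -> e = e') ->
  (forall x, D x -> (forall e, ~ T e x) -> f x = 0) ->
  (forall e, leb2.-integrable (T e : set mplane) (EFin \o f)) ->
  (forall e, (\int[leb2]_(x in T e) (f x)%:E = (s e)%:E)%E) ->
  leb2.-integrable (D : set mplane) (EFin \o f) /\
  (\int[leb2]_(x in D) (f x)%:E = (\sum_e s e)%:E)%E.
Proof.
move=> mD mT TD disj f0 fint fs.
pose g (e : E) : mplane -> \bar R := (EFin \o f) \_ (T e).
have gint e : leb2.-integrable (D : set mplane) (g e).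
  apply: (integrableS measurableT) => //.
  exact/(integrable_mkcond _ (mT e)).
have fg x : D x -> (f x)%:E = (\sum_e g e x)%E.
  move=> Dx; have [[e ex]|ne] := pselect (exists e, T e x).
    rewrite (bigD1 e)//= big1 ?adde0.
      by rewrite /g patchE mem_set.
    move=> e' e'e; rewrite /g patchE memNset// => e'x.
    by rewrite (disj _ _ _ e'x ex) eqxx in e'e.
  rewrite f0// ?big1// => e; last by move=> ex; apply: ne; exists e.
  by move=> _; rewrite /g patchE memNset// => ex; apply: ne; exists e.
split.
  apply: (@eq_integrable _ _ _ _ _ mD (fun x => (\sum_e g e x)%E)) => //.
    by move=> x /set_mem Dx; rewrite /= fg.
  exact: integrable_sum.
transitivity (\int[leb2]_(x in D) (\sum_e g e x)%E)%E.
  by apply: eq_integral => x /set_mem Dx; rewrite fg.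
rewrite integral_sum// -sumEFin; apply: eq_bigr => e _.
by rewrite /g -integral_mkcondr setIC setIidl.
Qed.

Lemma isP1_value (f : plane R -> R) : isP1 f -> forall x,
  f x = f (rvtx 0) + (f (rvtx 1) - f (rvtx 0)) * x.1 + (f (rvtx 2%R) - f (rvtx 0)) * x.2.
Proof.
by move=> [a [b [c fE]]] x; rewrite !fE rvtx0 rvtx1 rvtx2/=; ring.
Qed.

Lemma integral_refT_isP1 (f : plane R -> R) : isP1 f ->
  (\int[leb2]_(x in refT) (f x)%:E =
   ((f (rvtx 0) + f (rvtx 1) + f (rvtx 2%R)) / 6)%:E)%E.
Proof.
move=> f1; set A := f (rvtx 0); set B := f (rvtx 1); set C := f (rvtx 2%R).
transitivity (\int[leb2]_(x in refT) (A + (B - A) * x.1 + (C - A) * x.2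
    + 0 * x.1 ^+ 2 + 0 * (x.1 * x.2) + 0 * x.2 ^+ 2)%:E)%E.
  by apply: eq_integral => x _; rewrite (isP1_value f1 x); congr EFin; rewrite -/A -/B -/C; ring.
by rewrite integral_refT_quadratic; congr EFin; field.
Qed.

(* At [c = 0] this is positive definite in the vertex values. *)
Lemma integral_refT_sqr (f : plane R -> R) (c : R) : isP1 f ->
  (\int[leb2]_(x in refT) ((f x - c) * f x)%:E =
   ((f (rvtx 0) ^+ 2 + f (rvtx 1) ^+ 2 + f (rvtx 2%R) ^+ 2
     + (f (rvtx 0) + f (rvtx 1) + f (rvtx 2%R)) ^+ 2) / 24
    - c * ((f (rvtx 0) + f (rvtx 1) + f (rvtx 2%R)) / 6))%:E)%E.
Proof.
move=> f1; set A := f (rvtx 0); set B := f (rvtx 1); set C := f (rvtx 2%R).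
transitivity (\int[leb2]_(x in refT) ((A - c) * A
    + ((B - A) * A + (A - c) * (B - A)) * x.1 + ((C - A) * A + (A - c) * (C - A)) * x.2
    + (B - A) ^+ 2 * x.1 ^+ 2 + (2 * (B - A) * (C - A)) * (x.1 * x.2)
    + (C - A) ^+ 2 * x.2 ^+ 2)%:E)%E.
  by apply: eq_integral => x _; rewrite (isP1_value f1 x); congr EFin; rewrite -/A -/B -/C; ring.
by rewrite integral_refT_quadratic; congr EFin; field.
Qed.

(** Cramer's rule. This formula is affine on the whole plane, as needed for the test function to be
    in P1 on each affine element. *)
Definition affT_inv v y : plane R :=
  (cross (y - v 0) (v 2%R - v 0) / area v, cross (v 1 - v 0) (y - v 0) / area v).

Lemma isP1v_affT_inv v : isP1v (affT_inv v).
Proof.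
apply: isP1v_pair.
  exists (- cross (v 0) (v 2%R - v 0) / area v), ((v 2%R - v 0).2 / area v),
    (- (v 2%R - v 0).1 / area v) => x.
  by rewrite /affT_inv /cross/=; ring.
exists (- cross (v 1 - v 0) (v 0) / area v), (- (v 1 - v 0).2 / area v),
  ((v 1 - v 0).1 / area v) => x.
by rewrite /affT_inv /cross/=; ring.
Qed.

Lemma affT_invK v x : area v != 0 -> affT_inv v (affT v x) = x.
Proof.
move=> a0; apply: plane_eq; rewrite /affT_inv/=; apply: (mulIf a0); rewrite divfK//.
  by rewrite /cross/= affT1 affT2 /area /cross/=; ring.
by rewrite /cross/= affT1 affT2 /area /cross/=; ring.
Qed.

Lemma isP1_comp (f : plane R -> R) (P : plane R -> plane R) : isP1 f -> isP1v P -> isP1 (f \o P).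
Proof.
move=> [a [b [c fE]]] P1.
have [p0 [p1 [p2 pE]]] := P1 0; have [q0 [q1 [q2 qE]]] := P1 1.
exists (a + b * p0 + c * q0), (b * p1 + c * q1), (b * p2 + c * q2) => x.
by rewrite /= fE -[(P x).1]/((crd 0 \o P) x) -[(P x).2]/((crd 1 \o P) x) pE qE; ring.
Qed.

Lemma isP1_diverg (vh : plane R -> plane R) : isP2v vh -> isP1 (diverg vh).
Proof.
move=> vh2; have [a [b [c fE]]] := isP1_pder 0 (vh2 0).
have [a' [b' [c' fE']]] := isP1_pder 1 (vh2 1).
by exists (a + a'), (b + b'), (c + c') => x; rewrite divergE fE fE'; ring.
Qed.

Lemma mxvD (A : 'M[R]_2) x y : mxv A (x + y) = mxv A x + mxv A y.
Proof. by apply: plane_eq => /=; ring. Qed.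

Lemma isP2v_phi (a b : R) : isP2v (fun x => (a * phi_ref x, b * phi_ref x)).
Proof.
apply: isP2v_pair.
  by exists (- a), (6 * a), (6 * a), (- 6 * a), (- 6 * a), (- 6 * a) => x; rewrite /phi_ref/=; ring.
by exists (- b), (6 * b), (6 * b), (- 6 * b), (- 6 * b), (- 6 * b) => x; rewrite /phi_ref/=; ring.
Qed.

Lemma isP2vD (F1 F2 : plane R -> plane R) : isP2v F1 -> isP2v F2 -> isP2v (fun x => F1 x + F2 x).
Proof.
have add (f g : plane R -> R) : isP2 f -> isP2 g -> isP2 (fun x => f x + g x).
  move=> [a [b [c [d [e [h fE]]]]]] [a' [b' [c' [d' [e' [h' gE]]]]]].
  by exists (a + a'), (b + b'), (c + c'), (d + d'), (e + e'), (h + h') => x; rewrite fE gE; ring.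
by move=> F12 F22; apply: isP2v_pair; [exact: (add _ _ (F12 0) (F22 0))|exact: (add _ _ (F12 1) (F22 1))].
Qed.

Lemma edge_fluxD (F1 F2 : plane R -> plane R) i :
  edge_flux (fun x => F1 x + F2 x) i = edge_flux F1 i + edge_flux F2 i.
Proof. by rewrite /edge_flux /cross/=; ring. Qed.

Section mesh.
Context {E : finType} (vtx : E -> 'I_3 -> plane R) (Gh : plane R -> plane R)
  (F : E -> plane R -> plane R) (Omega : set (plane R)) (sigma C : R)
  (G : plane R -> plane R).
Hypothesis hmesh : curved_mesh vtx Gh F Omega sigma C G.

Lemma Vh_pullback u : Vh vtx Gh F u -> exists vh : E -> plane R -> plane R,
  [/\ forall e, isP2v (vh e),
      forall e x, refT x -> u (F e x) = mxv (piola (F e) x) (vh e x)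
    & \sum_e \sum_i edge_flux (vh e) i = 0].
Proof.
move=> [w [phi [hw [_ hphi] uE]]]; have [hw1 _ _] := hw.
have /choice[wh whP] : forall e, exists wh : plane R -> plane R, isP2v wh /\
    forall x, refT x -> w (F e x) = mxv (piola (F e) x) (wh x).
  by move=> e; have [wh ? ?] := hw1 e; exists wh.
have /choice[ab abP] : forall e, exists ab : R * R, forall x, refT x ->
    phi (F e x) = mxv (piola (F e) x) (ab.1 * phi_ref x, ab.2 * phi_ref x).
  by move=> e; have [a [b h]] := hphi e; exists (a, b).
exists (fun e x => wh e x + ((ab e).1 * phi_ref x, (ab e).2 * phi_ref x)); split.
- by move=> e; apply: isP2vD; [exact: (whP e).1|exact: isP2v_phi].
- move=> e x xT; rewrite uE ?mxvD ?(whP e).2 ?abP//.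
  exact: (elT_Omegah_F hmesh).
under eq_bigr do under eq_bigr do rewrite edge_fluxD edge_flux_phi addr0.
apply: (sum_edge_flux hmesh hw).
- by move=> e; exact: (whP e).1.
- by move=> e; exact: (whP e).2.
Qed.

Lemma divh_pullback u (vh : plane R -> plane R) e x : isP2v vh ->
  (forall x, refT x -> u (F e x) = mxv (piola (F e) x) (vh x)) -> refT x ->
  divh vtx Gh u (F e x) = diverg vh x / \det (jac (F e) x).
Proof.
move=> vh2 uF xT; rewrite /divh asboolT.
  exact: diverg_piola (nondegenerate_F hmesh e) vh2 uF xT.
by exists e => //; rewrite (elTE hmesh); exists x.
Qed.

End mesh.
End pullbacks.

Section gluing.
Context {R : realType}.
Implicit Types (x y z p q : plane R) (v : 'I_3 -> plane R).
Notation mplane := (measurableTypeR R * measurableTypeR R)%type.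
Section mesh.
Context {E : finType} (vtx : E -> 'I_3 -> plane R) (Gh : plane R -> plane R)
  (F : E -> plane R -> plane R) (Omega : set (plane R)) (sigma C : R)
  (G : plane R -> plane R).
Hypothesis hmesh : curved_mesh vtx Gh F Omega sigma C G.

(** On disjoint pieces at most one term is nonzero; the value 0 elsewhere is what [integral_pieces]
    asks for. *)
Definition glue (T : E -> set (plane R)) (h : E -> plane R -> R) y : R :=
  \sum_e (if `[< T e y >] then h e y else 0).

Lemma glue_in T h e y : (forall e e' x, T e x -> T e' x -> e = e') -> T e y ->
  glue T h y = h e y.
Proof.
move=> disj ey; rewrite /glue (bigD1 e)//= asboolT// big1 ?addr0// => e' e'e.
by rewrite asboolF// => e'y; move: e'e; rewrite (disj _ _ _ e'y ey) eqxx.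
Qed.

Lemma glue_out T h y : (forall e, ~ T e y) -> glue T h y = 0.
Proof. by move=> ny; rewrite /glue big1// => e _; rewrite asboolF. Qed.

Section charts.
Variables (Phi : E -> plane R -> plane R) (D : set (plane R))
  (f : plane R -> R) (h : E -> plane R -> R).
Hypotheses (oD : open D) (nPhi : forall e, nondegenerate (Phi e))
  (cPhi : forall e, cov (Phi e))
  (dPhi : forall e x, crefT x -> 0 < \det (jac (Phi e) x))
  (PhiD : forall e, Phi e @` refT `<=` D)
  (disj : forall e e' x, (Phi e @` refT) x -> (Phi e' @` refT) x -> e = e')
  (f0 : forall x, D x -> (forall e, ~ (Phi e @` refT) x) -> f x = 0)
  (ch : forall e, {within crefT, continuous (h e)})
  (fh : forall e x, refT x -> f (Phi e x) = h e x).

Let mPhi e : measurable (Phi e @` refT : set mplane).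
Proof. by apply: open_measurable_plane; exact: nondegenerate_open. Qed.

(** The charts are arbitrary because this serves both meshes: [affT (vtx e)] over [tOmega] and [F e]
    over [Omegah]. *)
Lemma integrable_mesh : leb2.-integrable (D : set mplane) (EFin \o f).
Proof.
have H e := chart_integral (nPhi e) (@cPhi e) (dPhi e) (@ch e) (fh e).
have Hi e : leb2.-integrable (Phi e @` refT : set mplane) (EFin \o f) by case: (H e).
apply: (proj1 (integral_pieces (T := fun e => Phi e @` refT)
  (s := fun e => fine (\int[leb2]_(x in Phi e @` refT) (f x)%:E)%E) _ mPhi PhiD disj f0 Hi _)).
  exact: open_measurable_plane.
by move=> e; rewrite fineK//; exact: integrable_fin_num.
Qed.

Lemma integral_mesh (s : E -> R) :
  (forall e, (\int[leb2]_(x in refT) (h e x * \det (jac (Phi e) x))%:E = (s e)%:E)%E) ->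
  (\int[leb2]_(x in D) (f x)%:E = (\sum_e s e)%:E)%E.
Proof.
move=> hs.
have H e := chart_integral (nPhi e) (@cPhi e) (dPhi e) (@ch e) (fh e).
have Hi e : leb2.-integrable (Phi e @` refT : set mplane) (EFin \o f) by case: (H e).
apply: (proj2 (integral_pieces _ mPhi PhiD disj f0 Hi _)).
  exact: open_measurable_plane.
by move=> e; case: (H e) => _ _ ->.
Qed.

End charts.

End mesh.
End gluing.

(** * Testing with the shifted reference divergence *)

Theorem lemma3p14 (R : realType) (k : nat) (Omega : set (plane R))
    (sigma C : R) (E : finType) (vtx : E -> 'I_3 -> plane R)
    (G Gh : plane R -> plane R) (F : E -> plane R -> plane R)
    (hk : (0 < k)%N) (hOmega : Ck_domain k Omega)
    (hmesh : curved_mesh vtx Gh F Omega sigma C G)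
    (u : plane R -> plane R) (hu : Vh vtx Gh F u)
    (hdiv : forall q : plane R -> R, Qh vtx Gh q ->
      (\int[leb2]_(x in Omegah vtx Gh) (q x * divh vtx Gh u x)%:E = 0)%E) :
  forall x, Omegah vtx Gh x -> divh vtx Gh u x = 0.
Proof.
move=> x0 _; rewrite /divh; case: asboolP => // -[e0 _]; rewrite (elTE hmesh) => -[y0 y0T <-].
have [vh [vh2 uvh sum0]] := Vh_pullback hmesh hu.
pose p e := diverg (vh e).
have p1 e : isP1 (p e) by exact: isP1_diverg.
pose I e := (p e (rvtx 0) + p e (rvtx 1) + p e (rvtx 2%R)) / 6.
have sumI : \sum_e I e = 0.
  have IE e : I e = (\sum_i edge_flux (vh e) i) / 6.
    have := integral_diverg (vh2 e); rewrite (integral_refT_isP1 (p1 e)) => h.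
    exact: EFin_inj h.
  by under eq_bigr do rewrite IE; rewrite -mulr_suml sum0 mul0r.
pose A e := area (vtx e).
have A0 e : 0 < A e by exact: (area_vtx hmesh).
(* The mean of [p] over the affine mesh: the Jacobian of [affT (vtx e)] is [A e] and the reference
   triangle has area 1/2, so element [e] contributes [A e * I e] to the integral and [A e / 2] to
   the area. *)
pose c := (\sum_e A e * I e) / (\sum_e A e / 2).
have sumA : \sum_e A e / 2 != 0.
  rewrite gt_eqF// (bigD1 e0)//=; apply: ltr_pwDl; first exact: divr_gt0.
  by apply: sumr_ge0 => e _; rewrite divr_ge0// ltW.
have triD e e' x : tri (vtx e) x -> tri (vtx e') x -> e = e'.
  by move=> ex e'x; exact: (tri_ctri_disjoint hmesh ex (tri_ctri e'x)).
have elD e e' x : (F e @` refT) x -> (F e' @` refT) x -> e = e'.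
  by rewrite -!(elTE hmesh); exact: (elT_disjoint hmesh).
have cp e d : {within crefT, continuous (fun x => p e x - d)}.
  apply: continuous_subspaceT; apply: continuous_isP2; apply: isP1_isP2.
  by have [a [b [g pE]]] := p1 e; exists (a - d), b, g => x; rewrite pE; ring.
(* [tq] and [q] have the same reference values [p e - c], carried to the affine and to the curved
   elements, so that [Gh] relates them. *)
pose tq := glue (fun e => tri (vtx e)) (fun e y => p e (affT_inv (vtx e) y) - c).
pose q := glue (fun e => F e @` refT) (fun e y => p e (refinv (F e) y) - c).
have tqE e x : refT x -> tq (affT (vtx e) x) = p e x - c.
  move=> xT; rewrite /tq (@glue_in R E _ _ e _ triD (ex_intro2 _ _ x xT erefl)).
  by rewrite affT_invK// gt_eqF//; exact: A0.
have qE e x : refT x -> q (F e x) = p e x - c.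
  move=> xT; rewrite /q (@glue_in R E _ _ e _ elD (ex_intro2 _ _ x xT erefl)).
  by rewrite refinvK//; [exact: (nondegenerate_F hmesh)|exact: refT_sub_crefT].
have detA e x : \det (jac (affT (vtx e)) x) = A e by exact: det_affT.
have sqc e d : {within crefT, continuous (fun x => (p e x - d) ^+ 2)}.
  by move=> x; rewrite /continuous_at; apply: cvgM; exact: cp.
have triO e : affT (vtx e) @` refT `<=` tOmega vtx.
  by move=> x; exact: (tri_in_interior hmesh).
have elO e : F e @` refT `<=` Omegah vtx Gh.
  by rewrite -(elTE hmesh); exact: (elT_Omegah hmesh).
have oO : open (tOmega vtx) by exact: open_interior.
have oOh : open (Omegah vtx Gh) by exact: open_interior.
have dA e x : crefT x -> 0 < \det (jac (affT (vtx e)) x) by move=> _; rewrite detA; exact: A0.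
have dF := F_det hmesh.
have L2I (D : set (plane R)) (f : plane R -> R) :
    leb2.-integrable (D : set (measurableTypeR R * measurableTypeR R)) (EFin \o f) ->
    leb2.-integrable (D : set (measurableTypeR R * measurableTypeR R)) (EFin \o (fun x => f x ^+ 2)) ->
    open D -> L2 D f.
  move=> i1 i2 oD; split.
    by apply/measurable_EFinP; apply: measurable_int i1.
  have mD := open_measurable_plane oD.
  by have /fin_numPlt/andP[] := integrable_fin_num mD i2.
have out0 (T : E -> set (plane R)) h (D : set (plane R)) x : D x -> (forall e, ~ T e x) -> glue T h x = 0.
  by move=> _; exact: glue_out.
have Qtq : tQh vtx tq.
  split.
  - apply: L2I => //.
      exact: (integrable_mesh oO (nondegenerate_affT hmesh) (cov_affT hmesh) dA triO triD
        (@out0 _ _ _) (fun e => cp e c) tqE).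
    apply: (integrable_mesh oO (nondegenerate_affT hmesh) (cov_affT hmesh) dA triO triD
        _ (fun e => sqc e c)).
      by move=> x xO nx; rewrite /tq glue_out// expr0n.
    by move=> e x xT; rewrite tqE.
  - rewrite (integral_mesh oO (nondegenerate_affT hmesh) (cov_affT hmesh) dA triO triD
        (@out0 _ _ _) (fun e => cp e c) tqE (s := fun e => A e * I e - c * (A e / 2))).
      rewrite sumrB -mulr_sumr /c divfK// subrr//.
    move=> e; have q1 : isP1 (fun x => (p e x - c) * A e).
      by have [a [b [g pE]]] := p1 e; exists ((a - c) * A e), (b * A e), (g * A e) => x; rewrite pE; ring.
    under eq_integral do rewrite detA.
    by rewrite (integral_refT_isP1 q1) /I; congr EFin; field.
  - move=> e; exists (fun x => p e (affT_inv (vtx e) x) - c).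
      have [a [b [g pE]]] := isP1_comp (p1 e) (isP1v_affT_inv (vtx e)).
      by exists (a - c), b, g => x; rewrite -[p e _]/((p e \o affT_inv (vtx e)) x) pE; ring.
    by move=> x ex; rewrite /tq (@glue_in R E _ _ e).
have Qq : Qh vtx Gh q.
  split.
    apply: L2I => //.
      exact: (integrable_mesh oOh (nondegenerate_F hmesh) (cov_F hmesh) dF elO elD
        (@out0 _ _ _) (fun e => cp e c) qE).
    apply: (integrable_mesh oOh (nondegenerate_F hmesh) (cov_F hmesh) dF elO elD
        _ (fun e => sqc e c)).
      by move=> x xO nx; rewrite /q glue_out// expr0n.
    by move=> e x xT; rewrite qE.
  exists tq => // y yO; have [[e [x xT xy]]|ny] := pselect (exists e, tri (vtx e) y).
    rewrite -xy -(F_Gh hmesh) ?tqE ?qE//; exact: refT_sub_crefT.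
  (* At a point of [tOmega] on the affine skeleton both functions are 0, since by [elT_tri] its
     image under [Gh] lies in no open element. *)
  rewrite /q /tq !glue_out//; first by move=> e ey; apply: ny; exists e.
  by move=> e; rewrite -(elTE hmesh) => /(elT_tri hmesh yO) ey; apply: ny; exists e.
(* The integral of [p e ^ 2] over the reference triangle, in terms of the vertex values. *)
pose S e := (p e (rvtx 0) ^+ 2 + p e (rvtx 1) ^+ 2 + p e (rvtx 2%R) ^+ 2
     + (p e (rvtx 0) + p e (rvtx 1) + p e (rvtx 2%R)) ^+ 2) / 24.
have S0 e : 0 <= S e by rewrite divr_ge0// !addr_ge0// sqr_ge0.
have hc e : {within crefT, continuous (fun x => (p e x - c) * (p e x / \det (jac (F e) x)))}.
  apply/subspace_continuousP => x xT; rewrite /from_subspace.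
  apply: cvg_within_filter.
  have cpe : p e @ x --> p e x by apply: continuous_isP2; exact: isP1_isP2.
  have d0 : \det (jac (F e) x) != 0 by rewrite gt_eqF//; exact: dF.
  apply: cvgM; first by apply: cvgB => //; exact: cvg_cst.
  apply: cvgM => //; apply: cvgV => //.
  under [fun _ => \det _]funext do rewrite det_jac; rewrite det_jac.
  have F2 := F_P2 hmesh e.
  by apply: cvgB; apply: cvgM; apply: continuous_isP2; apply/isP1_isP2/isP1_pder.
have := hdiv q Qq.
(* The determinant of the change of variables cancels the one dividing [p e], so element [e]
   contributes the reference integral of [(p e - c) * p e], which is [S e - c * I e]; the [I e] sum
   up to 0. *)
rewrite (integral_mesh oOh (nondegenerate_F hmesh) (cov_F hmesh) dF elO elD
  _ hc _ (s := fun e => S e - c * I e)).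
- move=> [sumS]; rewrite sumrB -mulr_sumr sumI mulr0 subr0 in sumS.
  have : S e0 = 0.
    by apply/eqP; move/eqP: sumS; rewrite psumr_eq0// => /allP/(_ e0); rewrite mem_index_enum => /(_ isT).
  move/eqP; rewrite mulf_eq0 invr_eq0 pnatr_eq0 orbF.
  rewrite paddr_eq0 ?addr_ge0 ?sqr_ge0// => /andP[+ _].
  rewrite paddr_eq0 ?addr_ge0 ?sqr_ge0// => /andP[+ v2].
  rewrite paddr_eq0 ?sqr_ge0// => /andP[v0 v1].
  rewrite (diverg_piola (nondegenerate_F hmesh e0) (vh2 e0) (uvh e0) y0T).
  move: v0 v1 v2; rewrite !sqrf_eq0 => /eqP v0 /eqP v1 /eqP v2.
  by rewrite -/(p e0) (isP1_value (p1 e0)) v0 v1 v2 subrr !mul0r !addr0 mul0r.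
- by move=> x xO nx; rewrite /q glue_out// mul0r.
- by move=> e x xT; rewrite qE// (divh_pullback hmesh (vh2 e) (uvh e) xT).
- move=> e; rewrite -(integral_refT_sqr c (p1 e)); apply: eq_integral => x /set_mem/refT_sub_crefT xT.
  by congr EFin; rewrite -mulrA divfK// gt_eqF// dF.
Qed.
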